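(* Let $q,a,b,k$ be nonzero complex numbers with $|q|<1$, such that no zero factor occurs in any denominator below (including the denominators of the terms of the series) and all the series below converge absolutely. Then $$\frac{(qab/k,kq/b;q)_\infty\,(q,k^2q/a,q^2a,q^2a^2/k^2;q^2)_\infty}{(kq,qa/k;q)_\infty}\;{}_{8}W_{7}\left(k;\frac{k^2}{ab},b,\sqrt{aq},\frac{aq}{k},\frac{-k}{\sqrt{a}};\,q,\,-\sqrt{q}\right)$$ $$=\left(\frac{k^2q}{ab},bq,\frac{a^2bq^2}{k^2},\frac{q^2a}{b};q^2\right)_\infty {}_{10}W_{9}\left(\sqrt{a};\frac{k}{\sqrt{ab}},\frac{-k}{\sqrt{ab}},\sqrt{b},-\sqrt{b},\sqrt{aq},\frac{a\sqrt{q}}{k},\frac{aq}{k};\,q,\,q\right)$$ $$-\sqrt{q}\,\frac{(1-q\sqrt{a})\left(1-\frac{a\sqrt{q}}{k}\right)}{(1-\sqrt{q})\left(1-\frac{k}{\sqrt{a}}\right)}\left(\frac{k^2}{ab},b,\frac{a^2bq^3}{k^2},\frac{q^3a}{b};q^2\right)_\infty$$ $$\times\;{}_{10}W_{9}\left(q\sqrt{a};k\sqrt{\tfrac{q}{ab}},-k\sqrt{\tfrac{q}{ab}},\sqrt{bq},-\sqrt{bq},\sqrt{aq},\frac{a\sqrt{q^3}}{k},\frac{aq}{k};\,q,\,q\right).$$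
   Context: Notation: $(x;q)_0=1$, $(x;q)_n=\prod_{j=0}^{n-1}(1-xq^j)$, $(x;q)_\infty=\prod_{j\ge 0}(1-xq^j)$, and $(x_1,\dots,x_m;q)_n=(x_1;q)_n\cdots(x_m;q)_n$ for $n$ a nonnegative integer or $\infty$. In expressions such as $k^2/ab$ the whole product after the slash is the denominator. The very-well-poised series is $${}_{r+1}W_{r}(a_1;a_4,\dots,a_{r+1};q,x)=\sum_{n=0}^{\infty}\frac{(a_1,q\sqrt{a_1},-q\sqrt{a_1},a_4,\dots,a_{r+1};q)_n}{(q,\sqrt{a_1},-\sqrt{a_1},\frac{a_1q}{a_4},\dots,\frac{a_1q}{a_{r+1}};q)_n}\,x^n .$$ Fixed complex square roots $\sqrt{a}$ and $\sqrt{q}$ are chosen, the same throughout, and $\sqrt{aq}=\sqrt{a}\sqrt{q}$, $\sqrt{q^3}=q\sqrt{q}$; every other square root is an arbitrary fixed choice (it occurs together with its negative). *)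

(* Defs.v *)
From Stdlib Require Import Reals List.
From Coquelicot Require Import Coquelicot.
Import ListNotations.
Open Scope C_scope.

(* Stdlib/Coquelicot development; [C] is [Coquelicot.Complex.C], the complex
   numbers. *)

(* Total limit and sum operators on [C], in the style of Coquelicot's [RInt]:
   meaningful when the limit (resp. the sum) exists, see the lemmas below. *)
Definition Clim_seq (u : nat -> C) : C :=
  iota (T := C_CompleteNormedModule)
    (fun l : C => filterlim u eventually (locally l)).

Definition CSeries (u : nat -> C) : C :=
  iota (T := C_CompleteNormedModule)
    (fun l : C => is_series (K := C_AbsRing) (V := C_NormedModule) u l).

Lemma Clim_seq_unique (u : nat -> C) (l : C) :
  filterlim u eventually (locally l) -> Clim_seq u = l.
Proof.
intros H.
apply (iota_unique (V := C_CompleteNormedModule)); [|exact H].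
intros l' H'.
exact (filterlim_locally_unique (V := C_NormedModule) u l' l H' H).
Qed.

Lemma CSeries_unique (u : nat -> C) (l : C) :
  is_series (K := C_AbsRing) (V := C_NormedModule) u l -> CSeries u = l.
Proof.
intros H.
apply (iota_unique (V := C_CompleteNormedModule)); [|exact H].
intros l' H'.
exact (filterlim_locally_unique (V := C_NormedModule) _ l' l H' H).
Qed.

(* (x;q)_n *)
Fixpoint qpoch (x q : C) (n : nat) : C :=
  match n with
  | O => 1
  | S m => qpoch x q m * (1 - x * q ^ m)
  end.

(* (x;q)_oo *)
Definition qpoch_inf (x q : C) : C := Clim_seq (qpoch x q).

(* (x_1,...,x_m;q)_n and (x_1,...,x_m;q)_oo *)
Definition qpochs (xs : list C) (q : C) (n : nat) : C :=
  fold_right (fun x p => qpoch x q n * p) 1 xs.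

Definition qpochs_inf (xs : list C) (q : C) : C :=
  fold_right (fun x p => qpoch_inf x q * p) 1 xs.

(* None of the factors 1 - x q^j of (x_1,...,x_m;q)_n (for any n) and of
   (x_1,...,x_m;q)_oo vanishes. *)
Definition qpochs_no_zero_factor (xs : list C) (q : C) : Prop :=
  forall x, In x xs -> forall j : nat, 1 - x * q ^ j <> 0.

(* The very-well-poised series W(a1; a4, ..., a_{r+1}; q, x). The argument [s]
   is the chosen square root of [a1] (a hypothesis [s ^ 2 = a1] is expected at
   each use) and [l] is the list [a4; ...; a_{r+1}]. *)
Definition vwp_num (a1 s : C) (l : list C) (q : C) : list C :=
  a1 :: q * s :: - (q * s) :: l.

Definition vwp_den (a1 s : C) (l : list C) (q : C) : list C :=
  q :: s :: - s :: map (fun c => a1 * q / c) l.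

Definition vwp_term (a1 s : C) (l : list C) (q x : C) (n : nat) : C :=
  qpochs (vwp_num a1 s l q) q n / qpochs (vwp_den a1 s l q) q n * x ^ n.

Definition vwp (a1 s : C) (l : list C) (q x : C) : C :=
  CSeries (vwp_term a1 s l q x).

Definition vwp_den_nonzero (a1 s : C) (l : list C) (q : C) : Prop :=
  qpochs_no_zero_factor (vwp_den a1 s l q) q.

Definition vwp_abs_cv (a1 s : C) (l : list C) (q x : C) : Prop :=
  ex_series (fun n => Cmod (vwp_term a1 s l q x n)).

(* Main.v *)
Require Import Defs.
From Stdlib Require Import Reals List Lra Lia IndefiniteDescription.
From Coquelicot Require Import Coquelicot.
Import ListNotations.
Open Scope C_scope.

(** Write p for the chosen square root of q and put mu = k / sqrt a,
    kap = a / k, be = k^2 / (a b). Then b be = mu^2, sqrt a = mu kap and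
    k = mu^2 kap, and up to signs and square roots every parameter of the three
    series is a monomial in p, mu, kap, b, be.

    The two series on the right are the even and the odd part of one series in base
    p: up to factors free of b, its N-th term is
      (b;q)_N (b q^(N+1), b q^(N+2) kap^2;q^2)_oo
    times the same expression in be. After multiplication by (k q, a q / k;q)_oo both
    sides are entire functions of kap for fixed p, mu, b, be: the infinite products
    in front of the series cancel all denominators containing kap. They are written
    sum_n left_term n and sum_N right_term N.

    By the identity theorem it is enough to compare them at kap = q^m for large m,
    since these points accumulate at 0. There both are obtained from one array
    cross_term N r. Its sums over N + r = n are the left terms, by Jackson's
    terminating 8phi7 sum in base p with p^(-n) and - p^(-n) among its parameters
    (jackson_sum, column_value). Its sums over r are the right terms, by Watson's sum
    for the very-well-poised series with parameters A = b q^N, B = be q^N, c, - c,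
    1/kap (watson_sum_value, row_value). For general kap the latter series converges
    only if |kap q| < 1, while the theorem has no such restriction; at kap = q^m the
    factor (1/kap;q)_r leaves finitely many r, the rows decay like |p|^N, and the two
    orders of summation agree (double_sum).

    Jackson's sum follows from a first-order recurrence in n with an explicit
    telescoping certificate. Watson's sum satisfies a first-order recurrence under
    B -> B q^2, again with an explicit certificate (watson_telescope). Iterating it in
    B and then, by symmetry, in A reduces the sum to its value at A = B = 0, and this
    constant is read off at A = 1, where only the first term survives.

    The analytic part uses functions given on a closed disc by absolutely convergent
    power series, with the l^1 norm of the coefficients (Wiener). In this norm
    infinite sums and infinite products are controlled by geometric series, and the
    identity theorem (Wiener_identity) is a statement about the first nonzero
    coefficient. *)

(** * Finite q-shifted factorials *)

Definition regular (x q : C) : Prop := forall j : nat, 1 - x * q ^ j <> 0.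

Lemma qpoch_S (x q : C) (n : nat) :
  qpoch x q (S n) = qpoch x q n * (1 - x * q ^ n).
Proof. reflexivity. Qed.

Lemma qpoch_add (x q : C) (n m : nat) :
  qpoch x q (n + m) = qpoch x q n * qpoch (x * q ^ n) q m.
Proof.
induction m as [|m IH].
- rewrite Nat.add_0_r; simpl; ring.
- rewrite Nat.add_succ_r, !qpoch_S, IH, Cpow_add_r; ring.
Qed.

Lemma qpoch_Sl (x q : C) (n : nat) :
  qpoch x q (S n) = (1 - x) * qpoch (x * q) q n.
Proof.
replace (S n) with (1 + n)%nat by lia.
rewrite qpoch_add; simpl.
replace (x * (q * 1)) with (x * q) by ring; ring.
Qed.

Lemma qpoch_neq_0 (x q : C) (n : nat) : regular x q -> qpoch x q n <> 0.
Proof.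
intros H; induction n as [|n IH]; simpl.
- exact C1_nz.
- apply Cmult_neq_0; auto.
Qed.

Lemma regular_shift (x q : C) (n : nat) : regular x q -> regular (x * q ^ n) q.
Proof.
intros H j; rewrite <- Cmult_assoc, <- Cpow_add_r; apply H.
Qed.

Lemma regular_0 (x q : C) : regular x q -> 1 - x <> 0.
Proof. intros H; generalize (H 0%nat); now rewrite Cmult_1_r. Qed.

Lemma regular_1 (x q : C) : regular x q -> 1 - x * q <> 0.
Proof. intros H; generalize (H 1%nat); now rewrite Cpow_1_r. Qed.

Lemma Cpow_pow2 (q : C) (n : nat) : (q ^ 2) ^ n = (q ^ n) ^ 2.
Proof. rewrite <- !Cpow_mult_r; f_equal; lia. Qed.

Lemma Cpow_double (q : C) (n : nat) : q ^ (2 * n) = (q ^ n) ^ 2.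
Proof. rewrite <- Cpow_mult_r; f_equal; lia. Qed.

Lemma qpoch_mul_opp (x q : C) (n : nat) :
  qpoch x q n * qpoch (- x) q n = qpoch (x ^ 2) (q ^ 2) n.
Proof.
induction n as [|n IH]; [simpl; ring|].
rewrite !qpoch_S, <- IH, Cpow_pow2; ring.
Qed.

Lemma qpoch_bisect (x q : C) (n : nat) :
  qpoch x q (2 * n) = qpoch x (q ^ 2) n * qpoch (x * q) (q ^ 2) n.
Proof.
induction n as [|n IH]; [simpl; ring|].
replace (2 * S n)%nat with (S (S (2 * n))) by lia.
rewrite !qpoch_S, IH, !Cpow_pow2, (Cpow_S q (2 * n)), !Cpow_double; ring.
Qed.

Lemma qpoch_bisect_S (x q : C) (n : nat) :
  qpoch x q (S (2 * n)) = qpoch x (q ^ 2) (S n) * qpoch (x * q) (q ^ 2) n.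
Proof.
rewrite !qpoch_S, qpoch_bisect, !Cpow_pow2, !Cpow_double; ring.
Qed.

Lemma regular_bisect (x q : C) :
  regular x q <-> regular x (q ^ 2) /\ regular (x * q) (q ^ 2).
Proof.
split.
- intros H; split; intros j; rewrite Cpow_pow2, <- Cpow_double.
  + apply H.
  + replace (x * q * q ^ (2 * j)) with (x * q ^ S (2 * j))
      by (rewrite Cpow_S; ring).
    apply H.
- intros [H1 H2] j.
  destruct (Nat.Even_or_Odd j) as [[i ->]|[i ->]].
  + generalize (H1 i); rewrite Cpow_pow2, Cpow_double; auto.
  + generalize (H2 i); rewrite Cpow_pow2, Nat.add_1_r, (Cpow_S q (2 * i)), Cpow_double.
    now replace (x * (q * (q ^ i) ^ 2)) with (x * q * (q ^ i) ^ 2) by ring.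
Qed.

Ltac neq_ring := match goal with
  | H : ?a <> _ |- ?b <> _ => replace b with a by ring; exact H
  end.

(** * A contiguous relation for Watson's series *)

(** The very-well-poised factor (x;q)_n (1 - x q^(2n)) / (1 - x) after
    cancellation of 1 - x. Being polynomial in x it can be used where entire
    functions of x are wanted. *)
Definition vwp_factor (x q : C) (n : nat) : C :=
  match n with
  | O => 1
  | S m => qpoch (x * q) q m * (1 - x * q ^ (2 * n))
  end.

Lemma vwp_factor_spec (x q : C) (n : nat) :
  (1 - x) * vwp_factor x q n = qpoch x q n * (1 - x * q ^ (2 * n)).
Proof.
destruct n as [|n]; [simpl; ring|].
unfold vwp_factor; rewrite qpoch_Sl; ring.
Qed.

Fixpoint csum (u : nat -> C) (n : nat) : C :=
  match n with
  | O => 0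
  | S m => csum u m + u m
  end.

(** This is (1/kap;q)_n (- kap q)^n written as a polynomial in kap; for
    kap = q^m it vanishes as soon as n > m, which is what makes the sums below
    terminate. *)
Fixpoint qpoch_inv (kap q : C) (n : nat) : C :=
  match n with
  | O => 1
  | S m => qpoch_inv kap q m * ((q ^ m - kap) * q)
  end.

(** The terms of the very-well-poised series with leading parameter
    l = kap A B and parameters A, B, c, - c, 1/kap, where c^2 = l kap q, and with
    argument - kap q: the series of Watson's q-analogue of his 3F2 sum. Both
    signs of c are merged into shifted factorials of base q^2. *)
Definition watson_term (kap q A B : C) (n : nat) : C :=
  vwp_factor (kap * A * B) q n * qpoch A q n * qpoch B q n
  * qpoch (kap ^ 2 * A * B * q) (q ^ 2) n * qpoch_inv kap q n
  / (qpoch q q n * qpoch (A * kap * q) q n * qpoch (B * kap * q) q n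
     * qpoch (kap ^ 2 * A * B * q) q n * qpoch (A * B * q) (q ^ 2) n).

(** The partial sums of watson_term (A, B) minus watson_ratio times
    watson_term (A, B q^2), in closed form: a rational function of q^n times
    the n-th term, with the factor 1 - B of that term cancelled. *)
Definition watson_cert (kap q A B : C) (n : nat) : C :=
  match n with
  | O => 0
  | S j =>
      B * (1 - kap * q) * (1 - kap ^ 2 * A * B ^ 2 * q * (q ^ n) ^ 2)
      * qpoch (kap * A * B * q) q j * qpoch A q n * qpoch (B * q) q j
      * qpoch (kap ^ 2 * A * B * q) (q ^ 2) n * qpoch_inv kap q n
      / (qpoch q q j * qpoch (A * kap * q) q j
         * qpoch (B * kap * q) q (S n) * qpoch (kap ^ 2 * A * B * q) q (S n)
         * qpoch (A * B * q) (q ^ 2) n)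
  end.

Lemma watson_cert_identity (A B kap q X l : C) : l = kap * A * B ->
  (1 - B) * (1 - l * X ^ 2) * (1 - B * kap * q * X) * (1 - B * kap * q ^ 2 * X)
  * (1 - l * kap * q * X) * (1 - l * kap * q ^ 2 * X) * (1 - A * B * q * X ^ 2)
  - (1 - B * kap ^ 2 * q ^ 2) * (1 - l * q ^ 2 * X ^ 2) * (1 - l * X)
    * (1 - l * q * X) * (1 - B * X) * (1 - B * q * X)
    * (1 - l * kap * q * X ^ 2)
  = B * (1 - kap * q)
    * ((1 - l * X) * (1 - A * X) * (1 - B * X) * (1 - l * kap * q * X ^ 2)
       * (X - kap) * q * (1 - l * kap * B * q ^ 3 * X ^ 2)
       - (1 - X) * (1 - A * kap * X) * (1 - l * kap * B * q * X ^ 2)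
         * (1 - B * kap * q ^ 2 * X) * (1 - l * kap * q ^ 2 * X)
         * (1 - A * B * q * X ^ 2)).
Proof. intros ->; ring. Qed.

Definition watson_ratio (kap q A B : C) : C :=
  (1 - kap * A * B * q) * (1 - kap * A * B * q ^ 2) * (1 - B * q)
  * (1 - B * kap ^ 2 * q ^ 2)
  / ((1 - A * B * q) * (1 - kap ^ 2 * A * B * q ^ 2)
     * (1 - B * kap * q) * (1 - B * kap * q ^ 2)).

Lemma qpoch_shift2 (x y q : C) (n : nat) : y = x * q ^ 2 ->
  (1 - x) * (1 - x * q) * qpoch y q n
  = qpoch x q n * (1 - x * q ^ n) * (1 - x * q * q ^ n).
Proof.
intros ->.
assert (H := qpoch_Sl x q (S n)).
rewrite (qpoch_Sl (x * q)), !qpoch_S, (Cpow_S q n) in H.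
replace (x * q * q) with (x * q ^ 2) in H by ring.
replace (x * q * q ^ n) with (x * (q * q ^ n)) by ring.
symmetry; rewrite H; ring.
Qed.

Lemma qpoch_shift2_sq (x y q : C) (n : nat) : y = x * q ^ 2 ->
  (1 - x) * qpoch y (q ^ 2) n = qpoch x (q ^ 2) n * (1 - x * (q ^ n) ^ 2).
Proof. intros ->; rewrite <- Cpow_pow2, <- qpoch_Sl; reflexivity. Qed.

Lemma Cmult_neq_0_inv (x y : C) : x * y <> 0 -> x <> 0 /\ y <> 0.
Proof. intros H; split; intros E; apply H; rewrite E; ring. Qed.

Lemma Cdiv_unique (c x y : C) : c <> 0 -> c * x = y -> x = y / c.
Proof. intros Hc <-; field; exact Hc. Qed.

Ltac split_neq := repeat match goal with
  | H : Cmult _ _ <> _ |- _ => apply Cmult_neq_0_inv in H; destruct H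
  end.

Ltac abstract_qpoch := repeat match goal with
  | |- context [qpoch ?x ?q ?n] =>
      let P := fresh "P" in set (P := qpoch x q n) in *; clearbody P
  | |- context [qpoch_inv ?x ?q ?n] =>
      let P := fresh "P" in set (P := qpoch_inv x q n) in *; clearbody P
  end.

Ltac nonzero := repeat match goal with
  | |- _ /\ _ => split
  | |- Cmult _ _ <> _ => apply Cmult_neq_0
  end; auto; try neq_ring.

(** The difference of the n-th summands is watson_cert (n + 1) minus
    watson_cert n; over the common factor K this is a polynomial identity in
    X = q^n. Once 1/kap terminates the series, watson_cert vanishes at the end
    and the sum satisfies a first-order recurrence in B with step q^2. *)
Lemma watson_telescope (kap q A B : C) (n : nat) :
  regular q q -> regular (A * kap * q) q -> regular (B * kap * q) q ->
  regular (kap ^ 2 * A * B * q) q -> regular (A * B * q) (q ^ 2) ->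
  csum (watson_term kap q A B) n
  - watson_ratio kap q A B * csum (watson_term kap q A (B * q ^ 2)) n
  = watson_cert kap q A B n.
Proof.
intros Hq HA HB Hl HAB.
assert (E0 := regular_0 _ _ Hq).
assert (E1 := regular_0 _ _ HAB).
assert (E2 := regular_0 _ _ HB).
assert (E3 := regular_1 _ _ HB).
assert (E4 := regular_0 _ _ Hl).
assert (E5 := regular_1 _ _ Hl).
induction n as [|n IH]; [simpl; ring|].
cbn [csum].
transitivity ((csum (watson_term kap q A B) n
  - watson_ratio kap q A B * csum (watson_term kap q A (B * q ^ 2)) n)
  + (watson_term kap q A B n
     - watson_ratio kap q A B * watson_term kap q A (B * q ^ 2) n)); [ring|].
rewrite IH; clear IH.
destruct n as [|j].
- unfold watson_cert, watson_term, watson_ratio, vwp_factor.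
  cbn [qpoch qpoch_inv Nat.mul Nat.add].
  change (q ^ 0) with (RtoC 1); change ((q ^ 2) ^ 0) with (RtoC 1).
  field; nonzero.
- set (X := q ^ S j).
  assert (EX : q ^ S (S j) = q * X) by reflexivity.
  assert (EX2 : (q ^ 2) ^ S j = X ^ 2) by apply Cpow_pow2.
  assert (EX3 : q ^ (2 * S j) = X ^ 2) by apply Cpow_double.
  assert (EX0 : q ^ S j = X) by reflexivity.
  assert (EXj : X = q * q ^ j) by reflexivity.
  clearbody X.
  (* each of the four terms of the step is K times a polynomial in X, which
     leaves exactly watson_cert_identity *)
  set (K := qpoch (kap * A * B * q) q j * qpoch A q (S j) * qpoch (B * q) q j
    * qpoch (kap ^ 2 * A * B * q) (q ^ 2) (S j) * qpoch_inv kap q (S j)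
    / (qpoch q q (S j) * qpoch (A * kap * q) q (S j)
       * qpoch (B * kap * q) q (S (S (S j)))
       * qpoch (kap ^ 2 * A * B * q) q (S (S (S j)))
       * qpoch (A * B * q) (q ^ 2) (S (S j)))).
  assert (N1 := qpoch_neq_0 _ _ (S j) Hq).
  assert (N2 := qpoch_neq_0 _ _ (S j) HA).
  assert (N3 := qpoch_neq_0 _ _ (S (S (S j))) HB).
  assert (N4 := qpoch_neq_0 _ _ (S (S (S j))) Hl).
  assert (N5 := qpoch_neq_0 _ _ (S (S j)) HAB).
  assert (W1 : watson_term kap q A B (S j)
    = K * ((1 - B) * (1 - kap * A * B * X ^ 2) * (1 - B * kap * q * X)
      * (1 - B * kap * q ^ 2 * X) * (1 - kap ^ 2 * A * B * q * X)
      * (1 - kap ^ 2 * A * B * q ^ 2 * X) * (1 - A * B * q * X ^ 2))).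
  { unfold watson_term, vwp_factor, K; clear K; rewrite EX3, (qpoch_Sl B).
    rewrite !(qpoch_S _ q (S _)), !(qpoch_S _ (q ^ 2) (S _)), EX2, EX in *.
    rewrite EX0 in *.
    abstract_qpoch; split_neq; field; nonzero. }
  assert (W2 : watson_ratio kap q A B * watson_term kap q A (B * q ^ 2) (S j)
    = K * ((1 - B * kap ^ 2 * q ^ 2) * (1 - kap * A * B * q ^ 2 * X ^ 2)
      * (1 - kap * A * B * X) * (1 - kap * A * B * q * X) * (1 - B * X)
      * (1 - B * q * X) * (1 - kap ^ 2 * A * B * q * X ^ 2))).
  { assert (V1 := qpoch_shift2 (kap * A * B * q)
      (kap * A * (B * q ^ 2) * q) q j ltac:(ring)).
    assert (V2 := qpoch_shift2_sq (kap ^ 2 * A * B * q)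
      (kap ^ 2 * A * (B * q ^ 2) * q) q (S j) ltac:(ring)).
    assert (V3 := qpoch_shift2 (B * kap * q) (B * q ^ 2 * kap * q) q (S j)
      ltac:(ring)).
    assert (V4 := qpoch_shift2 (kap ^ 2 * A * B * q)
      (kap ^ 2 * A * (B * q ^ 2) * q) q (S j) ltac:(ring)).
    assert (V5 := qpoch_shift2_sq (A * B * q)
      (A * (B * q ^ 2) * q) q (S j) ltac:(ring)).
    assert (V6 : (1 - B * q) * qpoch (B * q ^ 2) q (S j)
      = qpoch (B * q) q j * (1 - B * X) * (1 - B * q * X)).
    { replace (B * q ^ 2) with (B * q * q) by ring.
      rewrite <- qpoch_Sl, !qpoch_S, EX0, EXj; ring. }
    replace (kap * A * B * q * q ^ j) with (kap * A * B * X) in V1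
      by (rewrite EXj; ring).
    replace (kap * A * B * q * q * q ^ j) with (kap * A * B * q * X) in V1
      by (rewrite EXj; ring).
    unfold watson_ratio, watson_term, vwp_factor, K; clear W1 K; rewrite EX3.
    rewrite !(qpoch_S _ q (S _)), !(qpoch_S _ (q ^ 2) (S _)), EX2, EX in *.
    rewrite EX0 in *.
    apply Cdiv_unique in V2; [|exact E4].
    apply Cdiv_unique in V3; [|nonzero].
    apply Cdiv_unique in V4; [|nonzero].
    apply Cdiv_unique in V5; [|exact E1].
    rewrite V2, V3, V4, V5; clear V2 V3 V4 V5.
    transitivity (
      ((1 - kap * A * B * q) * (1 - kap * A * B * q * q)
       * qpoch (kap * A * (B * q ^ 2) * q) q j)
      * ((1 - B * q) * qpoch (B * q ^ 2) q (S j))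
      * (1 - B * kap ^ 2 * q ^ 2) * (1 - kap * A * B * q ^ 2 * X ^ 2)
      * qpoch A q (S j) * qpoch_inv kap q (S j)
      * qpoch (kap ^ 2 * A * B * q) (q ^ 2) (S j)
      * (1 - kap ^ 2 * A * B * q * X ^ 2)
      / (qpoch q q (S j) * qpoch (A * kap * q) q (S j)
        * (qpoch (B * kap * q) q (S j) * (1 - B * kap * q * X)
           * (1 - B * kap * q * (q * X)))
        * (qpoch (kap ^ 2 * A * B * q) q (S j) * (1 - kap ^ 2 * A * B * q * X)
           * (1 - kap ^ 2 * A * B * q * (q * X)))
        * (qpoch (A * B * q) (q ^ 2) (S j) * (1 - A * B * q * X ^ 2)))).
    - clear V1 V6; abstract_qpoch; split_neq; field; nonzero.
    - rewrite V1, V6; clear V1 V6; abstract_qpoch; split_neq; field; nonzero. }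
  assert (W3 : watson_cert kap q A B (S j)
    = K * (B * (1 - kap * q) * (1 - kap ^ 2 * A * B ^ 2 * q * X ^ 2)
      * (1 - X) * (1 - A * kap * X)
      * (1 - B * kap * q ^ 2 * X) * (1 - kap ^ 2 * A * B * q ^ 2 * X)
      * (1 - A * B * q * X ^ 2))).
  { unfold watson_cert, K; clear W1 W2 K.
    rewrite !(qpoch_S _ q (S _)), !(qpoch_S _ (q ^ 2) (S _)), EX2, EX in *.
    rewrite EX0 in *.
    assert (EA : A * kap * q * q ^ j = A * kap * X) by (rewrite EXj; ring).
    rewrite (qpoch_S q q j), (qpoch_S (A * kap * q) q j), EA in *.
    rewrite <- EXj in N1 |- *.
    abstract_qpoch; split_neq; field; nonzero. }
  assert (W4 : watson_cert kap q A B (S (S j))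
    = K * (B * (1 - kap * q) * (1 - kap ^ 2 * A * B ^ 2 * q * (q * X) ^ 2)
      * (1 - kap * A * B * X) * (1 - A * X) * (1 - B * X)
      * (1 - kap ^ 2 * A * B * q * X ^ 2) * (X - kap) * q)).
  { unfold watson_cert, K; clear W1 W2 W3 K.
    rewrite EX, (qpoch_S (kap * A * B * q) q j), (qpoch_S A q (S j)),
      (qpoch_S (B * q) q j), (qpoch_S _ (q ^ 2) (S j)).
    change (qpoch_inv kap q (S (S j))) with (qpoch_inv kap q (S j) * ((q ^ S j - kap) * q)).
    rewrite EX2, EX0.
    replace (kap * A * B * q * q ^ j) with (kap * A * B * X) by (rewrite EXj; ring).
    replace (B * q * q ^ j) with (B * X) by (rewrite EXj; ring).
    abstract_qpoch; split_neq; field; nonzero. }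
  rewrite W4, W2, W1, W3.
  assert (Core := watson_cert_identity A B kap q X _ eq_refl).
  set (L := kap * A * B) in Core.
  match type of Core with ?l = ?r =>
    transitivity (K * (B * (1 - kap * q) * (1 - kap ^ 2 * A * B ^ 2 * q * (q * X) ^ 2)
      * (1 - kap * A * B * X) * (1 - A * X) * (1 - B * X)
      * (1 - kap ^ 2 * A * B * q * X ^ 2) * (X - kap) * q) + K * (l - r)) end;
    [unfold L; ring | rewrite Core; ring].
Qed.

(** * Jackson's terminating sum *)

(** With s = mu kap and n = N + r this is, up to a factor depending on n only,
    the N-th term of the terminating very-well-poised balanced series in base p
    with leading parameter s and parameters p^(-n), - p^(-n), d p^n, - d p^n,
    kap p, where d^2 = mu^2 kap. The pairs of opposite parameters are merged into
    shifted factorials of base p^2, and the reversal N -> n - N of those with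
    negative exponents avoids dividing by 1 - kap p^(-2j), which can vanish. *)
Definition jackson_term (p mu kap : C) (N r : nat) : C :=
  qpoch (mu ^ 2 * kap) (p ^ 2) (2 * N + r)
  / qpoch (mu ^ 2 * kap ^ 2 * p ^ 2) (p ^ 2) (2 * N + r)
  * (qpoch_inv kap (p ^ 2) r / qpoch (p ^ 2) (p ^ 2) r)
  * ((1 - mu * kap * (p ^ N) ^ 2) * qpoch (mu * kap) p N
     * qpoch (kap * p) p N / (qpoch p p N * qpoch mu p N) * (- p) ^ N).

Definition jackson_value (p mu kap : C) (n : nat) : C :=
  qpoch (mu ^ 2 * kap) (p ^ 2) n * qpoch (kap * p ^ 2) (p ^ 2) n
  * qpoch (- mu) (p ^ 2) n * qpoch (- (mu * p)) (p ^ 2) n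
  / (qpoch (p ^ 2) (p ^ 2) n * qpoch (mu ^ 2) (p ^ 2) n
     * qpoch (- (p ^ 2 * mu * kap)) (p ^ 2) n
     * qpoch (- (mu * kap * p)) (p ^ 2) n) * (- p) ^ n.

Definition jackson_denom (p mu kap Y : C) : C :=
  (1 - p ^ 2 * Y) * (1 - mu ^ 2 * Y) * (1 + p ^ 2 * mu * kap * Y)
  * (1 + mu * kap * p * Y).

Definition jackson_ratio (p mu kap Y : C) : C :=
  - p * ((1 - mu ^ 2 * kap * Y) * (1 - kap * p ^ 2 * Y) * (1 + mu * Y)
         * (1 + mu * p * Y)) / jackson_denom p mu kap Y.

(** The closed form of the partial sums over N of the terms for n + 1 minus
    jackson_ratio times the terms for n; p^N (p^2)^r is q^n / p^N with q = p^2. *)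
Definition jackson_cert (p mu kap : C) (N r : nat) : C :=
  let Y := (p ^ 2) ^ (N + r) in
  qpoch (mu ^ 2 * kap) (p ^ 2) (S (2 * N + r))
  / qpoch (mu ^ 2 * kap ^ 2 * p ^ 2) (p ^ 2) (S (2 * N + r))
  * (qpoch_inv kap (p ^ 2) r / qpoch (p ^ 2) (p ^ 2) r)
  * (qpoch (mu * kap) p (S N) * qpoch (kap * p) p (S N)
     / (qpoch p p N * qpoch mu p N) * (- p) ^ N)
  * (1 - mu ^ 2 * kap * p ^ 2 * Y ^ 2) / jackson_denom p mu kap Y
  * ((p ^ 2 + mu * p) * (p ^ N * (p ^ 2) ^ r) * (1 + mu * kap * p * (p ^ N) ^ 2)
     + (1 + mu * p * Y) * (1 + mu * kap * p * Y) * p).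

Definition jackson_regular (p mu kap : C) : Prop :=
  regular p p /\ regular (p ^ 2) (p ^ 2) /\ regular mu p
  /\ regular (mu ^ 2 * kap ^ 2 * p ^ 2) (p ^ 2) /\ regular (mu ^ 2) (p ^ 2)
  /\ regular (- (p ^ 2 * mu * kap)) (p ^ 2)
  /\ regular (- (mu * kap * p)) (p ^ 2).

Lemma jackson_denom_neq_0 (p mu kap : C) (n : nat) :
  jackson_regular p mu kap ->
  jackson_denom p mu kap ((p ^ 2) ^ n) <> 0.
Proof.
intros (Hp & Hq & Hmu & Ha & Hmu2 & Hs & Hsp).
unfold jackson_denom; nonzero.
- generalize (Hs n); intros H E; apply H; rewrite <- E; ring.
- generalize (Hsp n); intros H E; apply H; rewrite <- E; ring.
Qed.

Lemma jackson_value_S (p mu kap : C) (n : nat) :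
  jackson_regular p mu kap ->
  jackson_value p mu kap (S n)
  = jackson_ratio p mu kap ((p ^ 2) ^ n) * jackson_value p mu kap n.
Proof.
intros H; assert (D := jackson_denom_neq_0 _ _ _ n H).
destruct H as (Hp & Hq & Hmu & Ha & Hmu2 & Hs & Hsp).
assert (N1 := qpoch_neq_0 _ _ n Hq).
assert (N2 := qpoch_neq_0 _ _ n Hmu2).
assert (N3 := qpoch_neq_0 _ _ n Hs).
assert (N4 := qpoch_neq_0 _ _ n Hsp).
unfold jackson_value, jackson_ratio, jackson_denom in *.
rewrite !(qpoch_S _ (p ^ 2) n), (Cpow_S (- p) n).
set (Y := (p ^ 2) ^ n) in *; clearbody Y.
set (U := (- p) ^ n); clearbody U.
replace (1 - - (p ^ 2 * mu * kap) * Y) with (1 + p ^ 2 * mu * kap * Y) by ring.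
replace (1 - - (mu * kap * p) * Y) with (1 + mu * kap * p * Y) by ring.
abstract_qpoch; split_neq; field; nonzero.
Qed.

Lemma jackson_cert_identity (p X Z mu kap q s k a Y V D : C) :
  q = p ^ 2 -> s = mu * kap -> k = mu * s -> a = s ^ 2 ->
  Y = q * X ^ 2 * Z -> V = q * X ^ 4 * Z ->
  D = (1 - q * Y) * (1 - mu ^ 2 * Y) * (1 + q * s * Y) * (1 + s * p * Y) ->
  - p * D * (1 - k * q * V) * (Z - kap) * q * (1 - s * q * X ^ 2)
  - p ^ 2 * (1 - k * Y) * (1 - kap * q * Y) * (1 + mu * Y) * (1 + mu * p * Y)
    * (1 - a * q ^ 2 * V) * (1 - q * Z) * (1 - s * q * X ^ 2)
  = (1 - k * q * Y ^ 2)
    * (- (1 - q * Z) * (1 - k * q * V) * (1 - s * p * X) * (1 - kap * q * X)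
         * ((q + mu * p) * q * X * Z * (1 + s * p ^ 3 * X ^ 2)
            + (1 + mu * p * Y) * (1 + s * p * Y) * p ^ 2)
       - (1 - a * q ^ 2 * V) * (Z - kap) * q * (1 - p * X) * (1 - mu * X)
         * ((q + mu * p) * q * X * Z * (1 + s * p * X ^ 2)
            + (1 + mu * p * Y) * (1 + s * p * Y) * p)).
Proof. intros; subst; ring. Qed.

(** All four terms share the factor K; the rest is jackson_cert_identity. *)
Lemma jackson_cert_step (p mu kap : C) (N r : nat) :
  jackson_regular p mu kap ->
  jackson_term p mu kap (S N) (S r)
  - jackson_ratio p mu kap ((p ^ 2) ^ (S N + r)) * jackson_term p mu kap (S N) r
  = jackson_cert p mu kap (S N) r - jackson_cert p mu kap N (S r).
Proof.
intros H; set (M := (2 * N + r)%nat).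
assert (D := jackson_denom_neq_0 _ _ _ (S N + r) H).
destruct H as (Hp & Hq & Hmu & Ha & Hmu2 & Hs & Hsp).
assert (N1 := qpoch_neq_0 _ _ (S (S (S M))) Ha).
assert (N2 := qpoch_neq_0 _ _ (S r) Hq).
assert (N3 := qpoch_neq_0 _ _ (S N) Hp).
assert (N4 := qpoch_neq_0 _ _ (S N) Hmu).
unfold jackson_term, jackson_cert, jackson_ratio.
replace (N + S r)%nat with (S N + r)%nat by lia.
replace (2 * S N + S r)%nat with (S (S (S M))) by lia.
replace (2 * S N + r)%nat with (S (S M)) by lia.
replace (2 * N + S r)%nat with (S M) by lia.
set (X := p ^ N).
set (Z := (p ^ 2) ^ r).
assert (EV : (p ^ 2) ^ M = X ^ 4 * Z).
{ unfold M, X, Z; rewrite Cpow_add_r, <- !Cpow_mult_r; f_equal; f_equal; lia. }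
assert (EY : (p ^ 2) ^ (S N + r) = p ^ 2 * X ^ 2 * Z).
{ unfold X, Z; rewrite Cpow_add_r, (Cpow_S (p ^ 2) N), Cpow_pow2; reflexivity. }
rewrite EY in *.
set (V := p ^ 2 * X ^ 4 * Z).
set (Y := p ^ 2 * X ^ 2 * Z) in *.
assert (EM0 : (p ^ 2) ^ S M = V) by (rewrite Cpow_S, EV; unfold V; ring).
assert (EM1 : (p ^ 2) ^ S (S M) = p ^ 2 * V) by (rewrite Cpow_S, EM0; ring).
change (qpoch_inv kap (p ^ 2) (S r)) with (qpoch_inv kap (p ^ 2) r * ((Z - kap) * p ^ 2)).
rewrite !(qpoch_S _ (p ^ 2) (S _)), !(qpoch_S p p), !(qpoch_S mu p), 
  !(qpoch_S (mu * kap) p), !(qpoch_S (kap * p) p), (qpoch_S (p ^ 2) (p ^ 2) r),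
  EM0, EM1, (Cpow_S p N), (Cpow_S (p ^ 2) r), (Cpow_S (- p) N) in *.
assert (Core := jackson_cert_identity p X Z mu kap _ _ _ _ Y V _
  eq_refl eq_refl eq_refl eq_refl eq_refl eq_refl eq_refl).
change (p ^ N) with X in N3, N4 |- *.
change ((p ^ 2) ^ r) with Z in N2 |- *.
replace (_ * (1 - mu ^ 2 * Y) * _ * _) with (jackson_denom p mu kap Y) in Core
  by (unfold jackson_denom; ring).
match type of Core with ?u - ?v = ?c * (?w - ?z) =>
  set (n1 := u) in Core; set (n2 := v) in Core;
  set (n0 := c) in Core; set (n3 := w) in Core; set (n4 := z) in Core
end.
clear EV EY EM0 EM1.
clearbody V Y Z X.
set (Dd := jackson_denom p mu kap Y) in *; clearbody Dd.
set (U := (- p) ^ N); clearbody U.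
set (K := qpoch (mu ^ 2 * kap) (p ^ 2) (S M) * (1 - mu ^ 2 * kap * V)
  / (qpoch (mu ^ 2 * kap ^ 2 * p ^ 2) (p ^ 2) (S M)
     * (1 - mu ^ 2 * kap ^ 2 * p ^ 2 * V)
     * (1 - mu ^ 2 * kap ^ 2 * p ^ 2 * (p ^ 2 * V)))
  * (qpoch_inv kap (p ^ 2) r / (qpoch (p ^ 2) (p ^ 2) r * (1 - p ^ 2 * Z)))
  * (qpoch (mu * kap) p N * (1 - mu * kap * X) * (qpoch (kap * p) p N
     * (1 - kap * p * X)) / (qpoch p p N * (1 - p * X)
     * (qpoch mu p N * (1 - mu * X))) * U) / Dd).
transitivity (K * n1 - K * n2).
{ unfold K, n1, n2; clear K n1 n2 n3 n4 n0 Core.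
  f_equal; abstract_qpoch; split_neq; field; nonzero. }
transitivity (K * n0 * n3 - K * n0 * n4).
{ transitivity (K * (n1 - n2)); [ring | rewrite Core; ring]. }
unfold K, n0, n3, n4; clear K n1 n2 n3 n4 n0 Core.
f_equal; abstract_qpoch; split_neq; field; nonzero.
Qed.

Lemma jackson_cert_0 (p mu kap : C) (n : nat) : jackson_regular p mu kap ->
  jackson_term p mu kap 0 (S n)
  - jackson_ratio p mu kap ((p ^ 2) ^ n) * jackson_term p mu kap 0 n
  = jackson_cert p mu kap 0 n.
Proof.
intros H.
assert (D := jackson_denom_neq_0 _ _ _ n H).
destruct H as (Hp & Hq & Hmu & Ha & Hmu2 & Hs & Hsp).
assert (N1 := qpoch_neq_0 _ _ (S n) Ha).
assert (N2 := qpoch_neq_0 _ _ (S n) Hq).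
unfold jackson_term, jackson_cert, jackson_ratio.
replace (2 * 0 + S n)%nat with (S n) by lia.
replace (2 * 0 + n)%nat with n by lia.
replace (0 + n)%nat with n by lia.
cbn [qpoch_inv].
rewrite !(qpoch_S _ (p ^ 2) n), !(qpoch_S _ p 0) in *.
change (qpoch (mu * kap) p 0) with (RtoC 1).
change (qpoch (kap * p) p 0) with (RtoC 1).
change (qpoch mu p 0) with (RtoC 1).
change (qpoch p p 0) with (RtoC 1).
change (p ^ 0) with (RtoC 1).
change ((- p) ^ 0) with (RtoC 1).
unfold jackson_denom in *.
set (Y := (p ^ 2) ^ n) in *; clearbody Y.
abstract_qpoch; split_neq; field; nonzero.
Qed.

Lemma jackson_cert_last (p mu kap : C) (n : nat) : jackson_regular p mu kap ->
  jackson_term p mu kap (S n) 0 = - jackson_cert p mu kap n 0.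
Proof.
intros H.
assert (D := jackson_denom_neq_0 _ _ _ n H).
destruct H as (Hp & Hq & Hmu & Ha & Hmu2 & Hs & Hsp).
assert (N1 := qpoch_neq_0 _ _ (S (S (2 * n))) Ha).
assert (N3 := qpoch_neq_0 _ _ (S n) Hp).
assert (N4 := qpoch_neq_0 _ _ (S n) Hmu).
unfold jackson_term, jackson_cert.
rewrite !Nat.add_0_r.
replace (2 * S n)%nat with (S (S (2 * n))) by lia.
rewrite !(qpoch_S _ (p ^ 2) (S _)), (qpoch_S p p n), (qpoch_S mu p n),
  (Cpow_S (p ^ 2) (2 * n)), Cpow_double, !Cpow_pow2 in *.
change (qpoch (p ^ 2) (p ^ 2) 0) with (RtoC 1).
change (qpoch_inv kap (p ^ 2) 0) with (RtoC 1).
change ((p ^ 2) ^ 0) with (RtoC 1).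
rewrite (Cpow_S p n), (Cpow_S (- p) n).
unfold jackson_denom in *.
set (X := p ^ n) in *; clearbody X.
abstract_qpoch; split_neq; field; nonzero.
Qed.

Lemma jackson_partial (p mu kap : C) (n M : nat) : jackson_regular p mu kap ->
  (M <= n)%nat ->
  csum (fun N => jackson_term p mu kap N (S n - N)) (S M)
  - jackson_ratio p mu kap ((p ^ 2) ^ n)
    * csum (fun N => jackson_term p mu kap N (n - N)) (S M)
  = jackson_cert p mu kap M (n - M).
Proof.
intros H; induction M as [|M IH]; intros HM.
- cbn [csum]; rewrite !Nat.sub_0_r, <- (jackson_cert_0 _ _ _ n H); ring.
- destruct (Nat.le_exists_sub _ _ HM) as (r & -> & _).
  specialize (IH ltac:(lia)).
  cbn [csum] in *.
  replace (r + S M - S M)%nat with r by lia.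
  replace (S (r + S M) - S M)%nat with (S r) by lia.
  replace (r + S M - M)%nat with (S r) in IH |- * by lia.
  assert (E := jackson_cert_step p mu kap M r H).
  replace (S M + r)%nat with (r + S M)%nat in E by lia.
  transitivity (jackson_cert p mu kap M (S r)
    + (jackson_cert p mu kap (S M) r - jackson_cert p mu kap M (S r))); [|ring].
  rewrite <- E, <- IH; ring.
Qed.

(** Jackson's terminating 8phi7 sum in base p, by induction on n: the two sides
    satisfy the same first-order recurrence, for the left side because
    jackson_partial telescopes and its last value is cancelled by the extra term
    N = n + 1. *)
Lemma jackson_sum (p mu kap : C) (n : nat) : jackson_regular p mu kap ->
  csum (fun N => jackson_term p mu kap N (n - N)) (S n)
  = (1 - mu * kap) * jackson_value p mu kap n.
Proof.
intros H; induction n as [|n IH].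
- unfold jackson_term, jackson_value; cbn; field.
- rewrite jackson_value_S by exact H.
  assert (E := jackson_partial _ _ _ n n H (le_n n)).
  rewrite IH, Nat.sub_diag in E.
  change (csum ?u (S (S n))) with (csum u (S n) + u (S n)).
  cbv beta; rewrite Nat.sub_diag, jackson_cert_last, <- E by exact H; ring.
Qed.

(** * Limits and series of complex numbers *)

Definition tends (u : nat -> C) (l : C) : Prop :=
  forall eps : R, (0 < eps)%R ->
  exists N : nat, forall n, (N <= n)%nat -> (Cmod (u n - l) < eps)%R.

Lemma tends_filterlim (u : nat -> C) (l : C) :
  filterlim u eventually
    (locally (T := NormedModule.UniformSpace _ C_NormedModule) l) <-> tends u l.
Proof.
split.
- intros H eps He.
  destruct (H (fun z => Cmod (z - l) < eps)%R) as [N HN].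
  + apply (locally_le_locally_norm (V := C_NormedModule)).
    exists (mkposreal eps He); intros y Hy; exact Hy.
  + exists N; exact HN.
- intros H P HP.
  apply (locally_norm_le_locally (V := C_NormedModule)) in HP.
  destruct HP as [eps He].
  destruct (H eps (cond_pos eps)) as [N HN].
  exists N; intros n Hn; apply He; exact (HN n Hn).
Qed.

Lemma Cmod_sub_sym (x y : C) : Cmod (x - y) = Cmod (y - x).
Proof. rewrite <- Cmod_opp; f_equal; ring. Qed.

Lemma Cmod_sub_0 (x y : C) :
  (forall eps : R, (0 < eps)%R -> (Cmod (x - y) <= eps)%R) -> x = y.
Proof.
intros H.
assert (E : Cmod (x - y) = 0%R).
{ apply Rle_antisym; [|apply Cmod_ge_0].
  apply Rle_plus_epsilon; intros e He; specialize (H e He); lra. }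
apply Cmod_eq_0 in E.
replace x with (x - y + y) by ring; rewrite E; ring.
Qed.

Lemma tends_unique (u : nat -> C) (l l' : C) :
  tends u l -> tends u l' -> l = l'.
Proof.
intros H H'; apply Cmod_sub_0; intros e He.
destruct (H (e / 2)%R) as [N HN]; [lra|].
destruct (H' (e / 2)%R) as [N' HN']; [lra|].
specialize (HN (N + N')%nat ltac:(lia)).
specialize (HN' (N + N')%nat ltac:(lia)).
assert (T := Cmod_triangle (l - u (N + N')%nat) (u (N + N')%nat - l')).
replace (l - u (N + N')%nat + (u (N + N')%nat - l')) with (l - l') in T by ring.
rewrite Cmod_sub_sym in HN; lra.
Qed.

Lemma tends_ext_ev (u v : nat -> C) (l : C) (K : nat) :
  (forall n, (K <= n)%nat -> u n = v n) -> tends u l -> tends v l.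
Proof.
intros E H e He; destruct (H e He) as [N HN].
exists (N + K)%nat; intros n Hn; rewrite <- E by lia; apply HN; lia.
Qed.

Lemma tends_ext (u v : nat -> C) (l : C) :
  (forall n, u n = v n) -> tends u l -> tends v l.
Proof. intros E; apply (tends_ext_ev u v l 0); auto. Qed.

Lemma tends_const (c : C) : tends (fun _ => c) c.
Proof.
intros e He; exists 0%nat; intros; replace (c - c) with (RtoC 0) by ring.
now rewrite Cmod_0.
Qed.

Lemma tends_plus (u v : nat -> C) (l k : C) :
  tends u l -> tends v k -> tends (fun n => u n + v n) (l + k).
Proof.
intros H H' e He.
destruct (H (e / 2)%R) as [N HN]; [lra|].
destruct (H' (e / 2)%R) as [N' HN']; [lra|].
exists (N + N')%nat; intros n Hn.
specialize (HN n ltac:(lia)); specialize (HN' n ltac:(lia)).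
replace (u n + v n - (l + k)) with ((u n - l) + (v n - k)) by ring.
assert (T := Cmod_triangle (u n - l) (v n - k)); lra.
Qed.

Lemma tends_bounded (u : nat -> C) (l : C) : tends u l ->
  exists K N, (0 < K)%R /\ forall n, (N <= n)%nat -> (Cmod (u n) <= K)%R.
Proof.
intros H; destruct (H 1%R) as [N HN]; [lra|].
exists (Cmod l + 1)%R, N; split; [generalize (Cmod_ge_0 l); lra|].
intros n Hn; specialize (HN n Hn).
assert (T := Cmod_triangle (u n - l) l).
replace (u n - l + l) with (u n) in T by ring; lra.
Qed.

Lemma tends_mult (u v : nat -> C) (l k : C) :
  tends u l -> tends v k -> tends (fun n => u n * v n) (l * k).
Proof.
intros H H' e He.
destruct (tends_bounded _ _ H) as (K & N0 & HK & HN0).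
set (L := (Cmod k + 1)%R).
assert (HL : (0 < L)%R) by (unfold L; generalize (Cmod_ge_0 k); lra).
destruct (H (e / 2 / L)%R) as [N HN]; [apply Rdiv_lt_0_compat; lra|].
destruct (H' (e / 2 / K)%R) as [N' HN']; [apply Rdiv_lt_0_compat; lra|].
exists (N0 + N + N')%nat; intros n Hn.
specialize (HN0 n ltac:(lia)).
specialize (HN n ltac:(lia)); specialize (HN' n ltac:(lia)).
replace (u n * v n - l * k) with (u n * (v n - k) + (u n - l) * k) by ring.
eapply Rle_lt_trans; [apply Cmod_triangle|]; rewrite !Cmod_mult.
assert (A1 : (Cmod (u n) * Cmod (v n - k) <= K * Cmod (v n - k))%R)
  by (apply Rmult_le_compat_r; [apply Cmod_ge_0 | exact HN0]).
assert (A2 : (K * Cmod (v n - k) < K * (e / 2 / K))%R)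
  by (apply Rmult_lt_compat_l; lra).
assert (A3 : (Cmod (u n - l) * Cmod k <= Cmod (u n - l) * L)%R)
  by (apply Rmult_le_compat_l; [apply Cmod_ge_0 | unfold L; lra]).
assert (A4 : (Cmod (u n - l) * L < e / 2 / L * L)%R)
  by (apply Rmult_lt_compat_r; lra).
replace (K * (e / 2 / K))%R with (e / 2)%R in A2 by (field; lra).
replace (e / 2 / L * L)%R with (e / 2)%R in A4 by (field; lra).
lra.
Qed.

Lemma tends_scal (c : C) (u : nat -> C) (l : C) :
  tends u l -> tends (fun n => c * u n) (c * l).
Proof. intros H; apply tends_mult; [apply tends_const | exact H]. Qed.

Lemma tends_minus (u v : nat -> C) (l k : C) :
  tends u l -> tends v k -> tends (fun n => u n - v n) (l - k).
Proof.
intros H H'.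
replace (l - k) with (l + - (1) * k) by ring.
apply tends_ext with (fun n => u n + - (1) * v n); [intros; ring|].
apply tends_plus; [exact H | now apply tends_scal].
Qed.

Lemma tends_inv (u : nat -> C) (l : C) : l <> 0 ->
  tends u l -> tends (fun n => / u n) (/ l).
Proof.
intros Hl H e He.
assert (Hm : (0 < Cmod l)%R) by now apply Cmod_gt_0.
destruct (H (Cmod l / 2)%R) as [N HN]; [lra|].
destruct (H (e * (Cmod l * Cmod l) / 2)%R) as [N' HN'].
{ apply Rdiv_lt_0_compat; [|lra]; repeat apply Rmult_lt_0_compat; lra. }
exists (N + N')%nat; intros n Hn.
specialize (HN n ltac:(lia)); specialize (HN' n ltac:(lia)).
assert (T := Cmod_triangle (l - u n) (u n)).
replace (l - u n + u n) with l in T by ring.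
rewrite (Cmod_sub_sym l) in T.
assert (Hu : (Cmod l / 2 < Cmod (u n))%R) by lra.
assert (Hun : u n <> 0) by (apply Cmod_gt_0; lra).
replace (/ u n - / l) with ((l - u n) / (u n * l)) by (field; auto).
rewrite Cmod_div, Cmod_mult, (Cmod_sub_sym l) by now apply Cmult_neq_0.
apply Rmult_lt_reg_r with (Cmod (u n) * Cmod l)%R;
  [apply Rmult_lt_0_compat; lra|].
unfold Rdiv at 1; rewrite Rmult_assoc, Rinv_l, Rmult_1_r
  by (apply Rgt_not_eq, Rmult_lt_0_compat; lra).
eapply Rlt_trans; [exact HN'|].
assert (Q : (e * Cmod l * (Cmod l / 2) < e * Cmod l * Cmod (u n))%R)
  by (apply Rmult_lt_compat_l; [apply Rmult_lt_0_compat; lra | lra]).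
lra.
Qed.

Lemma tends_subseq (u : nat -> C) (l : C) (f : nat -> nat) :
  (forall n, (n <= f n)%nat) -> tends u l -> tends (fun n => u (f n)) l.
Proof.
intros Hf H e He; destruct (H e He) as [N HN].
exists N; intros n Hn; apply HN; specialize (Hf n); lia.
Qed.

Lemma tends_unshift (u : nat -> C) (l : C) (k : nat) :
  tends (fun n => u (n + k)%nat) l -> tends u l.
Proof.
intros H e He; destruct (H e He) as [N HN].
exists (N + k)%nat; intros n Hn.
replace n with (n - k + k)%nat by lia; apply HN; lia.
Qed.

Lemma tends_Cmod_le (u : nat -> C) (l : C) (B : R) (K : nat) :
  (forall n, (K <= n)%nat -> (Cmod (u n) <= B)%R) -> tends u l ->
  (Cmod l <= B)%R.
Proof.
intros HB H; apply Rle_plus_epsilon; intros e He.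
destruct (H e He) as [N HN].
specialize (HN (N + K)%nat ltac:(lia)); specialize (HB (N + K)%nat ltac:(lia)).
assert (T := Cmod_triangle (l - u (N + K)%nat) (u (N + K)%nat)).
replace (l - u (N + K)%nat + u (N + K)%nat) with l in T by ring.
rewrite Cmod_sub_sym in HN; lra.
Qed.

Lemma tends_Cpow_0 (q : C) : (Cmod q < 1)%R -> tends (fun n => q ^ n) 0.
Proof.
intros Hq e He.
destruct (pow_lt_1_zero (Cmod q)) with (2 := He) as [N HN].
- rewrite Rabs_pos_eq; [exact Hq | apply Cmod_ge_0].
- exists N; intros n Hn; replace (q ^ n - 0) with (q ^ n) by ring.
  rewrite Cmod_pow; eapply Rle_lt_trans; [apply Rle_abs | now apply HN].
Qed.

Fixpoint rsum (u : nat -> R) (n : nat) : R :=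
  match n with
  | O => 0
  | S m => (rsum u m + u m)%R
  end.

Definition sums (u : nat -> C) (l : C) : Prop := tends (csum u) l.

Lemma sum_n_csum (u : nat -> C) (n : nat) :
  sum_n (G := C_AbelianMonoid) u n = csum u (S n).
Proof.
induction n as [|n IH].
- rewrite sum_O; simpl; ring.
- rewrite sum_Sn, IH; reflexivity.
Qed.

Lemma is_series_sums (u : nat -> C) (l : C) :
  is_series (K := C_AbsRing) (V := C_NormedModule) u l <-> sums u l.
Proof.
unfold is_series; rewrite tends_filterlim; unfold sums; split; intros H.
- apply (tends_unshift _ _ 1); revert H; apply tends_ext; intros n.
  rewrite Nat.add_1_r; apply sum_n_csum.
- apply tends_ext with (fun n => csum u (S n));
    [intros n; symmetry; apply sum_n_csum|].
  apply (tends_subseq _ _ S); [lia | exact H].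
Qed.

Lemma rsum_sum_n (u : nat -> R) (n : nat) : sum_n u n = rsum u (S n).
Proof.
induction n as [|n IH].
- rewrite sum_O; simpl; ring.
- rewrite sum_Sn, IH; reflexivity.
Qed.

Lemma csum_ext (u v : nat -> C) (n : nat) :
  (forall i, (i < n)%nat -> u i = v i) -> csum u n = csum v n.
Proof.
induction n as [|n IH]; intros H; [reflexivity|].
simpl; rewrite IH, (H n); auto.
Qed.

Lemma csum_plus (u v : nat -> C) (n : nat) :
  csum (fun i => u i + v i) n = csum u n + csum v n.
Proof. induction n as [|n IH]; simpl; [|rewrite IH]; ring. Qed.

Lemma csum_scal (c : C) (u : nat -> C) (n : nat) :
  csum (fun i => c * u i) n = c * csum u n.
Proof. induction n as [|n IH]; simpl; [|rewrite IH]; ring. Qed.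

Lemma csum_add (u : nat -> C) (n m : nat) :
  csum u (n + m) = csum u n + csum (fun i => u (n + i)%nat) m.
Proof.
induction m as [|m IH]; simpl.
- rewrite Nat.add_0_r; ring.
- rewrite Nat.add_succ_r; simpl; rewrite IH; ring.
Qed.

Lemma csum_swap (a : nat -> nat -> C) (n m : nat) :
  csum (fun i => csum (a i) m) n = csum (fun j => csum (fun i => a i j) n) m.
Proof.
induction n as [|n IH]; simpl.
- induction m as [|m IHm]; simpl; [|rewrite <- IHm]; ring.
- now rewrite IH, csum_plus.
Qed.

Lemma csum_0 (u : nat -> C) (n : nat) :
  (forall i, (i < n)%nat -> u i = 0) -> csum u n = 0.
Proof.
induction n as [|n IH]; intros H; [reflexivity|].
simpl; rewrite IH, (H n); auto; ring.
Qed.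

Lemma rsum_le (u v : nat -> R) (n : nat) :
  (forall i, (i < n)%nat -> (u i <= v i)%R) -> (rsum u n <= rsum v n)%R.
Proof.
induction n as [|n IH]; intros H; simpl; [lra|].
apply Rplus_le_compat; auto.
Qed.

Lemma rsum_ext (u v : nat -> R) (n : nat) :
  (forall i, u i = v i) -> rsum u n = rsum v n.
Proof. intros H; induction n as [|n IH]; simpl; congruence. Qed.

Lemma rsum_scal (c : R) (u : nat -> R) (n : nat) :
  rsum (fun i => c * u i)%R n = (c * rsum u n)%R.
Proof. induction n as [|n IH]; simpl; [|rewrite IH]; ring. Qed.

Lemma rsum_plus (u v : nat -> R) (n : nat) :
  rsum (fun i => u i + v i)%R n = (rsum u n + rsum v n)%R.
Proof. induction n as [|n IH]; simpl; [|rewrite IH]; ring. Qed.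

Lemma rsum_add (u : nat -> R) (n m : nat) :
  rsum u (n + m) = (rsum u n + rsum (fun i => u (n + i)%nat) m)%R.
Proof.
induction m as [|m IH]; simpl.
- rewrite Nat.add_0_r; ring.
- rewrite Nat.add_succ_r; simpl; rewrite IH; ring.
Qed.

Lemma rsum_swap (a : nat -> nat -> R) (n m : nat) :
  rsum (fun i => rsum (a i) m) n = rsum (fun j => rsum (fun i => a i j) n) m.
Proof.
induction n as [|n IH]; simpl.
- induction m as [|m IHm]; simpl; [|rewrite <- IHm]; ring.
- now rewrite IH, rsum_plus.
Qed.

Lemma rsum_nonneg (u : nat -> R) (n : nat) :
  (forall i, (0 <= u i)%R) -> (0 <= rsum u n)%R.
Proof.
intros H; induction n as [|n IH]; simpl; [lra|]; specialize (H n); lra.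
Qed.

Lemma rsum_term_le (u : nat -> R) (n : nat) :
  (forall i, (0 <= u i)%R) -> (u n <= rsum u (S n))%R.
Proof. intros H; simpl; generalize (rsum_nonneg u n H); lra. Qed.

Lemma Cmod_csum_le (u : nat -> C) (n : nat) :
  (Cmod (csum u n) <= rsum (fun i => Cmod (u i)) n)%R.
Proof.
induction n as [|n IH]; simpl; [rewrite Cmod_0; lra|].
eapply Rle_trans; [apply Cmod_triangle|]; lra.
Qed.

Lemma rsum_geom (x : R) (n : nat) : (0 <= x < 1)%R ->
  (rsum (fun i => x ^ i) n <= / (1 - x))%R.
Proof.
intros Hx.
assert (E : ((1 - x) * rsum (fun i => x ^ i) n = 1 - x ^ n)%R)
  by (induction n as [|n IH]; simpl; [|rewrite Rmult_plus_distr_l, IH]; ring).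
apply Rmult_le_reg_l with (1 - x)%R; [lra|].
rewrite E, Rinv_r by lra.
generalize (pow_le x n (proj1 Hx)); lra.
Qed.

Lemma sums_abs (u : nat -> C) (B : R) :
  (forall n, (rsum (fun i => Cmod (u i)) n <= B)%R) ->
  exists l, sums u l /\ (Cmod l <= B)%R.
Proof.
intros HB.
assert (H : ex_series (fun i => Cmod (u i))).
{ destruct (ex_finite_lim_seq_incr (sum_n (fun i => Cmod (u i))) B)
    as [l Hl].
  - intros n; rewrite sum_Sn; generalize (Cmod_ge_0 (u (S n)));
      unfold plus; simpl; lra.
  - intros n; rewrite rsum_sum_n; apply HB.
  - exists l; exact Hl. }
destruct (ex_series_le (K := C_AbsRing) (V := C_CompleteNormedModule)
  u (fun i => Cmod (u i))) as [l Hl]; [intros n; apply Rle_refl | exact H |].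
apply is_series_sums in Hl; exists l; split; [exact Hl|].
refine (tends_Cmod_le _ _ _ 0 _ Hl); intros n _.
eapply Rle_trans; [apply Cmod_csum_le | apply HB].
Qed.

(** * Interchange of summations *)

(** A bound on finitely many absolute values survives a termwise limit. *)
Lemma rsum_Cmod_lim (u : nat -> nat -> C) (c : nat -> C) (T : R) (M : nat) :
  (forall m, tends (u m) (c m)) ->
  (forall K, (rsum (fun m => Cmod (u m K)) M <= T)%R) ->
  (rsum (fun m => Cmod (c m)) M <= T)%R.
Proof.
intros Hu HT.
assert (H : forall e, (0 < e)%R -> exists K0, forall K, (K0 <= K)%nat ->
  (rsum (fun m => Cmod (c m)) M <= rsum (fun m => Cmod (u m K)) M + e)%R).
{ clear HT; induction M as [|M IH]; intros e He.
  - exists 0%nat; intros; simpl; lra.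
  - destruct (IH (e / 2)%R) as [K1 H1]; [lra|].
    destruct (Hu M (e / 2)%R) as [K2 H2]; [lra|].
    exists (K1 + K2)%nat; intros K HK; simpl.
    specialize (H1 K ltac:(lia)); specialize (H2 K ltac:(lia)).
    assert (Tr := Cmod_triangle (c M - u M K) (u M K)).
    replace (c M - u M K + u M K) with (c M) in Tr by ring.
    rewrite (Cmod_sub_sym (c M)) in Tr; lra. }
apply Rle_plus_epsilon; intros e He.
destruct (H e He) as [K HK]; specialize (HK K (le_n K)); specialize (HT K); lra.
Qed.

Lemma column_sums_bound (a : nat -> nat -> C) (B : nat -> R) (T : R)
    (c : nat -> C) (M : nat) :
  (forall n, (rsum (fun m => Cmod (a n m)) M <= B n)%R) ->
  (forall K, (rsum B K <= T)%R) ->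
  (forall m, sums (fun n => a n m) (c m)) ->
  (rsum (fun m => Cmod (c m)) M <= T)%R.
Proof.
intros HB HT Hc.
apply (rsum_Cmod_lim (fun m K => csum (fun n => a n m) K)); [exact Hc|].
intros K; eapply Rle_trans; [|apply (HT K)].
apply Rle_trans with (rsum (fun m => rsum (fun n => Cmod (a n m)) K) M).
- apply rsum_le; intros i _; apply Cmod_csum_le.
- rewrite rsum_swap; apply rsum_le; intros i _; apply HB.
Qed.

Lemma rsum_tail (B : nat -> R) (T : R) :
  (forall n, (0 <= B n)%R) -> (forall K, (rsum B K <= T)%R) ->
  forall e, (0 < e)%R ->
  exists K0, forall K, (K0 <= K)%nat ->
  forall L, (rsum (fun i => B (K + i)%nat) L <= e)%R.
Proof.
intros HB HT e He.
destruct (ex_finite_lim_seq_incr (rsum B) T) as [l Hl].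
- intros n; simpl; specialize (HB n); lra.
- exact HT.
- assert (Hle : forall n, (rsum B n <= l)%R).
  { apply (is_lim_seq_incr_compare _ _ Hl).
    intros n; simpl; specialize (HB n); lra. }
  apply is_lim_seq_spec in Hl; destruct (Hl (mkposreal e He)) as [K0 HK].
  exists K0; intros K HKK L.
  specialize (HK K HKK); simpl in HK; apply Rabs_def2 in HK.
  specialize (Hle (K + L)%nat); rewrite rsum_add in Hle; lra.
Qed.

Lemma tends_csum (u : nat -> nat -> C) (l : nat -> C) (K : nat) :
  (forall n, tends (u n) (l n)) ->
  tends (fun M => csum (fun n => u n M) K) (csum l K).
Proof.
intros H; induction K as [|K IH]; simpl.
- apply tends_const.
- now apply tends_plus.
Qed.

(** Absolutely convergent double series may be summed in either order. The
    hypotheses are bounds on partial sums; the existence of the column sums is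
    part of the conclusion because they will be the coefficients of a power
    series. The remainder after K rows is again such a double series, with total
    bound the tail of B, so column_sums_bound controls it. *)
Lemma double_sum (a : nat -> nat -> C) (B : nat -> R) (T : R) (f : nat -> C) :
  (forall n M, (rsum (fun m => Cmod (a n m)) M <= B n)%R) ->
  (forall K, (rsum B K <= T)%R) ->
  (forall n, sums (a n) (f n)) ->
  exists (c : nat -> C) (F : C),
    (forall m, sums (fun n => a n m) (c m)) /\
    (forall M, (rsum (fun m => Cmod (c m)) M <= T)%R) /\
    sums c F /\ sums f F.
Proof.
intros HB HT Hf.
assert (HB0 : forall n, (0 <= B n)%R) by (intros n; apply (HB n 0%nat)).
destruct (functional_choice (fun m l => sums (fun n => a n m) l)) as [c Hc].
{ intros m; destruct (sums_abs (fun n => a n m) T) as [l [Hl _]];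
    [|now exists l].
  intros K; eapply Rle_trans; [|apply (HT K)].
  apply rsum_le; intros n _; eapply Rle_trans; [|apply (HB n (S m))].
  apply (rsum_term_le (fun j => Cmod (a n j))); intros; apply Cmod_ge_0. }
assert (HcT : forall M, (rsum (fun m => Cmod (c m)) M <= T)%R)
  by (intros M; apply (column_sums_bound a B T c M); auto).
destruct (sums_abs c T HcT) as [F [HF _]].
exists c, F; repeat split; auto.
intros e He.
destruct (rsum_tail B T HB0 HT (e / 2)%R) as [K0 HK0]; [lra|].
exists K0; intros K HK.
rewrite Cmod_sub_sym.
apply Rle_lt_trans with (e / 2)%R; [|lra].
refine (tends_Cmod_le
  (fun M => csum (fun m => c m - csum (fun n => a n m) K) M) _ _ 0 _ _).
- intros M _; eapply Rle_trans; [apply Cmod_csum_le|].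
  apply (column_sums_bound (fun n => a (K + n)%nat) (fun n => B (K + n)%nat));
    [intros n; apply HB | apply HK0, HK |].
  intros m.
  apply tends_ext with
    (fun L => csum (fun n => a n m) (L + K) - csum (fun n => a n m) K).
  + intros L; rewrite (Nat.add_comm L K), csum_add; ring.
  + apply tends_minus; [|apply tends_const].
    apply (tends_subseq _ _ (fun L => L + K)%nat); [lia | apply Hc].
- apply tends_ext with (fun M => csum c M - csum (fun n => csum (a n) M) K).
  + intros M; rewrite csum_swap.
    clear; induction M as [|M IH]; simpl; [|rewrite <- IH]; ring.
  + apply tends_minus; [exact HF|].
    now apply (tends_csum (fun n M => csum (a n) M)).
Qed.

(** * Absolutely convergent power series on a disc *)

(** Membership in the Wiener algebra of the closed disc of radius r, with norm at
    most B. A bound on the l^1 norm of the coefficients, rather than on the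
    supremum of f, makes infinite sums of such functions elementary: no Cauchy
    estimate is needed. *)
Definition Wiener (r : R) (f : C -> C) (B : R) : Prop :=
  exists c : nat -> C,
    (forall M, (rsum (fun m => Cmod (c m) * r ^ m)%R M <= B)%R) /\
    (forall z, (Cmod z <= r)%R -> sums (fun m => c m * z ^ m) (f z)).

Lemma Wiener_nonneg (r : R) (f : C -> C) (B : R) : Wiener r f B -> (0 <= B)%R.
Proof. intros [c [H _]]; exact (H 0%nat). Qed.

Lemma Wiener_mono (r : R) (f : C -> C) (B B' : R) :
  (B <= B')%R -> Wiener r f B -> Wiener r f B'.
Proof.
intros HB [c [H1 H2]]; exists c; split; [|exact H2].
intros M; eapply Rle_trans; [apply H1 | exact HB].
Qed.

Lemma Wiener_ext (r : R) (f g : C -> C) (B : R) :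
  (forall z, f z = g z) -> Wiener r f B -> Wiener r g B.
Proof.
intros E [c [H1 H2]]; exists c; split; [exact H1|].
intros z Hz; rewrite <- E; auto.
Qed.

Lemma Cmod_term_le (c z : C) (r : R) (m : nat) : (Cmod z <= r)%R ->
  (Cmod (c * z ^ m) <= Cmod c * r ^ m)%R.
Proof.
intros Hz; rewrite Cmod_mult, Cmod_pow.
apply Rmult_le_compat_l; [apply Cmod_ge_0|].
apply pow_incr; split; [apply Cmod_ge_0 | exact Hz].
Qed.

Lemma Wiener_bound (r : R) (f : C -> C) (B : R) (z : C) :
  Wiener r f B -> (Cmod z <= r)%R -> (Cmod (f z) <= B)%R.
Proof.
intros [c [H1 H2]] Hz.
refine (tends_Cmod_le _ _ _ 0 _ (H2 z Hz)); intros n _.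
eapply Rle_trans; [apply Cmod_csum_le|].
eapply Rle_trans; [|apply (H1 n)].
apply rsum_le; intros i _; now apply Cmod_term_le.
Qed.

Lemma Wiener_const_1 (r : R) : Wiener r (fun _ => 1) 1.
Proof.
exists (fun m => match m with O => RtoC 1 | _ => RtoC 0 end).
assert (E : forall n (u : nat -> C),
  csum (fun m => match m with O => RtoC 1 | _ => RtoC 0 end * u m) (S n) = u O).
{ intros n u; induction n as [|n IH]; [simpl; ring|].
  change (csum ?v (S (S n))) with (csum v (S n) + v (S n)); rewrite IH; ring. }
split.
- intros [|M]; [simpl; lra|].
  induction M as [|M IH]; [simpl; rewrite Cmod_1; lra|].
  change (rsum ?v (S (S M))) with (rsum v (S M) + v (S M))%R.
  cbv beta iota; rewrite Cmod_0, Rmult_0_l; lra.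
- intros z _; apply (tends_ext_ev (fun _ => 1) _ _ 1); [|apply tends_const].
  intros [|n] Hn; [lia|].
  now rewrite (E n (fun m => z ^ m)).
Qed.

Lemma Wiener_add (r : R) (f g : C -> C) (A B : R) : (0 <= r)%R ->
  Wiener r f A -> Wiener r g B -> Wiener r (fun z => f z + g z) (A + B).
Proof.
intros Hr [c [H1 H2]] [d [H3 H4]]; exists (fun m => c m + d m); split.
- intros M; apply Rle_trans with
    (rsum (fun m => Cmod (c m) * r ^ m + Cmod (d m) * r ^ m)%R M).
  + apply rsum_le; intros i _; rewrite <- Rmult_plus_distr_r.
    apply Rmult_le_compat_r; [now apply pow_le | apply Cmod_triangle].
  + rewrite rsum_plus; apply Rplus_le_compat; auto.
- intros z Hz.
  apply tends_ext with
    (fun n => csum (fun m => c m * z ^ m) n + csum (fun m => d m * z ^ m) n).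
  + intros n; rewrite <- csum_plus; apply csum_ext; intros; ring.
  + apply tends_plus; [apply H2 | apply H4]; exact Hz.
Qed.

Lemma Wiener_scal (r : R) (k : C) (f : C -> C) (B : R) :
  Wiener r f B -> Wiener r (fun z => k * f z) (Cmod k * B).
Proof.
intros [c [H1 H2]]; exists (fun m => k * c m); split.
- intros M.
  rewrite (rsum_ext _ (fun m => Cmod k * (Cmod (c m) * r ^ m))%R)
    by (intros; rewrite Cmod_mult; ring).
  rewrite rsum_scal; apply Rmult_le_compat_l; [apply Cmod_ge_0 | apply H1].
- intros z Hz.
  apply tends_ext with (fun n => k * csum (fun m => c m * z ^ m) n).
  + intros n; rewrite <- csum_scal; apply csum_ext; intros; ring.
  + apply tends_scal, H2, Hz.
Qed.

Lemma csum_Sl (u : nat -> C) (n : nat) :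
  csum u (S n) = u O + csum (fun i => u (S i)) n.
Proof.
induction n as [|n IH]; [simpl; ring|].
change (csum u (S (S n))) with (csum u (S n) + u (S n)).
rewrite IH; simpl; ring.
Qed.

Lemma rsum_Sl (u : nat -> R) (n : nat) :
  rsum u (S n) = (u O + rsum (fun i => u (S i)) n)%R.
Proof.
induction n as [|n IH]; [simpl; ring|].
change (rsum u (S (S n))) with (rsum u (S n) + u (S n))%R.
rewrite IH; simpl; ring.
Qed.

Lemma Wiener_shift (r : R) (f : C -> C) (B : R) : (0 <= r)%R ->
  Wiener r f B -> Wiener r (fun z => z * f z) (r * B).
Proof.
intros Hr HP; assert (HB := Wiener_nonneg _ _ _ HP); destruct HP as [c [H1 H2]].
exists (fun m => match m with O => RtoC 0 | S i => c i end); split.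
- intros [|M]; [simpl; now apply Rmult_le_pos|].
  rewrite rsum_Sl, Cmod_0, Rmult_0_l, Rplus_0_l.
  rewrite (rsum_ext _ (fun m => r * (Cmod (c m) * r ^ m))%R)
    by (intros; simpl; ring).
  rewrite rsum_scal; now apply Rmult_le_compat_l.
- intros z Hz; apply (tends_unshift _ _ 1).
  apply tends_ext with (fun n => z * csum (fun m => c m * z ^ m) n).
  + intros n; rewrite Nat.add_1_r, csum_Sl, <- csum_scal.
    rewrite Cmult_0_l, Cplus_0_l.
    apply csum_ext; intros; rewrite Cpow_S; ring.
  + apply tends_scal, H2, Hz.
Qed.

Lemma sums_scal (k : C) (u : nat -> C) (l : C) :
  sums u l -> sums (fun n => k * u n) (k * l).
Proof.
intros H; apply tends_ext with (fun n => k * csum u n);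
  [intros; symmetry; apply csum_scal | now apply tends_scal].
Qed.

Lemma sums_ext (u v : nat -> C) (l : C) :
  (forall n, u n = v n) -> sums u l -> sums v l.
Proof.
intros E; apply tends_ext; intros n; apply csum_ext; auto.
Qed.

(** Completeness of the Wiener algebra: the coefficients of the sum are the
    column sums of the array of coefficients. They are obtained at z = r and
    rescaled, so that they do not depend on the point z. *)
Lemma Wiener_series (r : R) (f : nat -> C -> C) (B : nat -> R) (T : R)
    (F : C -> C) :
  (0 < r)%R ->
  (forall n, Wiener r (f n) (B n)) -> (forall K, (rsum B K <= T)%R) ->
  (forall z, (Cmod z <= r)%R -> sums (fun n => f n z) (F z)) ->
  Wiener r F T.
Proof.
intros Hr Hf HT HF.
destruct (functional_choice (fun n c =>
  (forall M, (rsum (fun m => Cmod (c m) * r ^ m)%R M <= B n)%R) /\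
  (forall z, (Cmod z <= r)%R -> sums (fun m => c m * z ^ m) (f n z))) Hf)
  as [c Hc].
assert (Hrm : forall m, RtoC (r ^ m)%R <> 0).
{ intros m E; apply RtoC_inj in E; revert E; apply pow_nonzero; lra. }
assert (Er : Cmod r = r) by (rewrite Cmod_R; apply Rabs_pos_eq; lra).
assert (HD : forall z, (Cmod z <= r)%R -> exists d G,
  (forall m, sums (fun n => c n m * z ^ m) (d m)) /\
  (forall M, (rsum (fun m => Cmod (d m)) M <= T)%R) /\
  sums d G /\ sums (fun n => f n z) G).
{ intros z Hz; apply (double_sum (fun n m => c n m * z ^ m) B T);
    [|exact HT|].
  - intros n M; eapply Rle_trans; [|apply (proj1 (Hc n) M)].
    apply rsum_le; intros; now apply Cmod_term_le.
  - intros n; now apply Hc. }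
destruct (HD (RtoC r)) as (d & G & Hd & HdT & _); [rewrite Er; lra|].
exists (fun m => / RtoC (r ^ m)%R * d m).
split.
- intros M; rewrite (rsum_ext _ (fun m => Cmod (d m))); [apply HdT|].
  intros m; rewrite Cmod_mult, Cmod_inv, Cmod_R by apply Hrm.
  rewrite Rabs_pos_eq by (apply pow_le; lra).
  field; apply pow_nonzero; lra.
- intros z Hz; destruct (HD z Hz) as (d' & G' & Hd' & _ & HG & HG').
  rewrite (tends_unique _ _ _ (HF z Hz) HG').
  revert HG; apply sums_ext; intros m.
  apply (tends_unique _ _ _ (Hd' m)).
  generalize (sums_scal (/ RtoC (r ^ m)%R * z ^ m) _ _ (Hd m)).
  replace (/ RtoC (r ^ m)%R * z ^ m * d m) with (/ RtoC (r ^ m)%R * d m * z ^ m)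
    by ring.
  apply sums_ext; intros n.
  assert (Q := Hrm m); rewrite RtoC_pow in Q |- *; field; exact Q.
Qed.

(** If the coefficients before the m-th vanish, then |c m| is at most
    |z i| times a constant at each zero z i of f, and the zeros tend to 0. *)
Lemma Wiener_zero_coef (r : R) (c : nat -> C) (B : R) (f : C -> C)
    (z : nat -> C) :
  (0 < r)%R ->
  (forall M, (rsum (fun m => Cmod (c m) * r ^ m)%R M <= B)%R) ->
  (forall w, (Cmod w <= r)%R -> sums (fun m => c m * w ^ m) (f w)) ->
  tends z 0 ->
  (forall i, z i <> 0) -> (forall i, (Cmod (z i) <= r)%R) ->
  (forall i, f (z i) = 0) ->
  forall m, c m = 0.
Proof.
intros Hr HB Hf Hz Hz0 Hzr Hfz m.
induction m as [m IH] using (well_founded_induction Wf_nat.lt_wf).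
assert (H : forall i, (Cmod (c m) <= Cmod (z i) * (/ r ^ S m * B))%R).
{ intros i.
  assert (Hw0 : (0 < Cmod (z i))%R) by now apply Cmod_gt_0.
  set (w := z i) in *.
  (* f vanishes at w and the earlier coefficients are zero, so the rest of the
     series sums to the opposite of its m-th term *)
  assert (HT : tends (fun n => csum (fun j => c (S m + j)%nat * w ^ (S m + j)) n)
    (- (c m * w ^ m))).
  { assert (HS := Hf w (Hzr i)); unfold w in HS at 2; rewrite Hfz in HS.
    replace (- (c m * w ^ m)) with (0 - c m * w ^ m) by ring.
    apply tends_ext with
      (fun n => csum (fun j => c j * w ^ j) (n + S m) - c m * w ^ m).
    - intros n; rewrite (Nat.add_comm n), csum_add; simpl csum at 1.
      rewrite (csum_0 _ m); [ring|].
      intros j Hj; rewrite IH by exact Hj; ring.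
    - apply tends_minus; [|apply tends_const].
      apply (tends_subseq _ _ (fun n => n + S m)%nat); [lia | exact HS]. }
  apply (tends_Cmod_le _ _ (Cmod w ^ S m * (/ r ^ S m * B))%R 0) in HT.
  - rewrite Cmod_opp, Cmod_mult, Cmod_pow in HT.
    apply Rmult_le_reg_r with (Cmod w ^ m)%R; [now apply pow_lt|].
    eapply Rle_trans; [exact HT|]; simpl; right; ring.
  - intros n _; eapply Rle_trans; [apply Cmod_csum_le|].
    apply Rle_trans with (rsum (fun j => Cmod w ^ S m * (/ r ^ S m
      * (Cmod (c (S m + j)%nat) * r ^ (S m + j))))%R n).
    + apply rsum_le; intros j _.
      rewrite Cmod_mult, Cmod_pow, !pow_add.
      replace (Cmod w ^ S m * (/ r ^ S m
        * (Cmod (c (S m + j)%nat) * (r ^ S m * r ^ j))))%R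
        with (Cmod (c (S m + j)%nat) * (Cmod w ^ S m * r ^ j))%R
        by (field; apply pow_nonzero; lra).
      apply Rmult_le_compat_l; [apply Cmod_ge_0|].
      apply Rmult_le_compat_l; [apply pow_le, Cmod_ge_0|].
      apply pow_incr; split; [apply Cmod_ge_0 | apply Hzr].
    + rewrite !rsum_scal.
      apply Rmult_le_compat_l; [apply pow_le, Cmod_ge_0|].
      apply Rmult_le_compat_l; [left; apply Rinv_0_lt_compat, pow_lt, Hr|].
      eapply Rle_trans; [|apply (HB (S m + n)%nat)].
      rewrite rsum_add.
      assert (P : (0 <= rsum (fun i0 => Cmod (c i0) * r ^ i0)%R (S m))%R); [|lra].
      apply rsum_nonneg; intros j; apply Rmult_le_pos;
        [apply Cmod_ge_0 | apply pow_le; lra]. }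
set (Q := (/ r ^ S m * B)%R) in *.
assert (HQ : (0 <= Q)%R).
{ unfold Q; apply Rmult_le_pos; [left; apply Rinv_0_lt_compat, pow_lt, Hr|].
  apply (HB 0%nat). }
apply Cmod_eq_0, Rle_antisym; [|apply Cmod_ge_0].
apply Rle_plus_epsilon; intros e He.
destruct (Hz (e / (Q + 1))%R) as [N HN]; [apply Rdiv_lt_0_compat; lra|].
specialize (HN N (le_n N)); specialize (H N).
replace (z N - 0) with (z N) in HN by ring.
assert (P : (Cmod (z N) * (Q + 1) < e / (Q + 1) * (Q + 1))%R)
  by (apply Rmult_lt_compat_r; lra).
replace (e / (Q + 1) * (Q + 1))%R with e in P by (field; lra).
generalize (Cmod_ge_0 (z N)); nra.
Qed.

Lemma Wiener_identity (r : R) (f : C -> C) (B : R) (z : nat -> C) (w : C) :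
  (0 < r)%R -> Wiener r f B -> tends z 0 ->
  (forall i, z i <> 0) -> (forall i, (Cmod (z i) <= r)%R) ->
  (forall i, f (z i) = 0) -> (Cmod w <= r)%R -> f w = 0.
Proof.
intros Hr [c [H1 H2]] Hz Hz0 Hzr Hfz Hw.
apply (tends_unique _ _ _ (H2 w Hw)).
apply tends_ext with (fun _ => 0); [|apply tends_const].
intros n; symmetry; apply csum_0; intros m _.
rewrite (Wiener_zero_coef r c B f z) by assumption; ring.
Qed.

(** * Multipliers of the Wiener algebra *)

(** Multiplication by g is bounded on the Wiener algebra by K. Products of
    multipliers are multipliers by composition, so products of power series never
    have to be expanded into Cauchy products. *)
Definition multiplier (r : R) (g : C -> C) (K : R) : Prop :=
  forall f B, Wiener r f B -> Wiener r (fun z => g z * f z) (K * B).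

Lemma multiplier_Wiener (r : R) (g : C -> C) (K : R) : multiplier r g K -> Wiener r g K.
Proof.
intros H; generalize (H _ _ (Wiener_const_1 r)); rewrite Rmult_1_r.
apply Wiener_ext; intros; ring.
Qed.

Lemma multiplier_nonneg (r : R) (g : C -> C) (K : R) : multiplier r g K -> (0 <= K)%R.
Proof. intros H; exact (Wiener_nonneg _ _ _ (multiplier_Wiener _ _ _ H)). Qed.

Lemma multiplier_const (r : R) (k : C) : multiplier r (fun _ => k) (Cmod k).
Proof. intros f B; apply Wiener_scal. Qed.

Lemma multiplier_1 (r : R) : multiplier r (fun _ => 1) 1.
Proof.
intros f B; rewrite Rmult_1_l; apply Wiener_ext; intros; ring.
Qed.

Lemma multiplier_id (r : R) : (0 <= r)%R -> multiplier r (fun z => z) r.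
Proof. intros Hr f B; now apply Wiener_shift. Qed.

Lemma multiplier_mono (r : R) (g : C -> C) (K K' : R) :
  (K <= K')%R -> multiplier r g K -> multiplier r g K'.
Proof.
intros HK H f B HP; apply Wiener_mono with (K * B)%R; [|now apply H].
apply Rmult_le_compat_r; [exact (Wiener_nonneg _ _ _ HP) | exact HK].
Qed.

Lemma multiplier_ext (r : R) (g h : C -> C) (K : R) :
  (forall z, g z = h z) -> multiplier r g K -> multiplier r h K.
Proof.
intros E H f B HP; apply Wiener_ext with (fun z => g z * f z);
  [intros z; now rewrite E | now apply H].
Qed.

Lemma multiplier_mul (r : R) (g h : C -> C) (K L : R) :
  multiplier r g K -> multiplier r h L -> multiplier r (fun z => g z * h z) (K * L).
Proof.
intros H1 H2 f B HP.
apply Wiener_mono with (K * (L * B))%R; [right; ring|].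
apply Wiener_ext with (fun z => g z * (h z * f z)); [intros; ring|].
now apply H1, H2.
Qed.

Lemma multiplier_add (r : R) (g h : C -> C) (K L : R) : (0 <= r)%R ->
  multiplier r g K -> multiplier r h L -> multiplier r (fun z => g z + h z) (K + L).
Proof.
intros Hr H1 H2 f B HP.
apply Wiener_mono with (K * B + L * B)%R; [right; ring|].
apply Wiener_ext with (fun z => g z * f z + h z * f z); [intros; ring|].
apply Wiener_add; auto.
Qed.

Lemma multiplier_factor (r : R) (g : C -> C) (G : R) (k : C) : (0 <= r)%R ->
  multiplier r g G -> multiplier r (fun z => 1 - g z * k) (1 + G * Cmod k).
Proof.
intros Hr H.
apply multiplier_ext with (fun z => 1 + g z * - k); [intros; ring|].
apply multiplier_add; [exact Hr | |].
- apply multiplier_1.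
- rewrite <- (Cmod_opp k); apply multiplier_mul; [exact H | apply multiplier_const].
Qed.

(** The product of the 1 + G |q|^j is at most exp (G / (1 - |q|)). *)
Definition qbound (G : R) (q : C) : R := exp (G / (1 - Cmod q)).

Lemma qbound_spec (G : R) (q : C) (n : nat) : (0 <= G)%R -> (Cmod q < 1)%R ->
  (exp (G * rsum (fun i => Cmod q ^ i) n) <= qbound G q)%R.
Proof.
intros HG Hq; unfold qbound, Rdiv.
assert (H : (G * rsum (fun i => Cmod q ^ i) n <= G * / (1 - Cmod q))%R).
{ apply Rmult_le_compat_l; [exact HG|].
  apply rsum_geom; split; [apply Cmod_ge_0 | exact Hq]. }
destruct H as [H|H]; [left; now apply exp_increasing | right; now rewrite H].
Qed.

Lemma multiplier_qpoch (r : R) (g : C -> C) (G : R) (q : C) (n : nat) :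
  (0 <= r)%R -> (Cmod q < 1)%R -> multiplier r g G ->
  multiplier r (fun z => qpoch (g z) q n) (qbound G q).
Proof.
intros Hr Hq Hg; assert (HG := multiplier_nonneg _ _ _ Hg).
apply multiplier_mono with (exp (G * rsum (fun i => Cmod q ^ i) n))%R;
  [now apply qbound_spec|].
induction n as [|n IH].
- simpl; rewrite Rmult_0_r, exp_0; apply multiplier_1.
- simpl; rewrite Rmult_plus_distr_l, exp_plus.
  apply multiplier_mul; [exact IH|].
  apply multiplier_mono with (1 + G * Cmod (q ^ n))%R;
    [rewrite Cmod_pow; apply exp_ineq1_le|].
  now apply multiplier_factor.
Qed.

Lemma Cmod_lt_1_pos (q : C) : (Cmod q < 1)%R -> (0 < / (1 - Cmod q))%R.
Proof. intros H; apply Rinv_0_lt_compat; lra. Qed.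

(** * Infinite products *)

Lemma qpoch_telescope (x q : C) (n : nat) :
  csum (fun j => - (x * q ^ j) * qpoch x q j) n = qpoch x q n - 1.
Proof. induction n as [|n IH]; simpl; [|rewrite IH]; ring. Qed.

Lemma Cmod_qpoch_le (x q : C) (n : nat) : (Cmod q < 1)%R ->
  (Cmod (qpoch x q n) <= qbound (Cmod x) q)%R.
Proof.
intros Hq.
assert (H := multiplier_Wiener _ _ _ (multiplier_qpoch 1 (fun _ => x) (Cmod x) q n
  ltac:(lra) Hq (multiplier_const 1 x))).
exact (Wiener_bound 1 _ _ 0 H ltac:(rewrite Cmod_0; lra)).
Qed.

Lemma rsum_geom_scal (K x : R) (n : nat) : (0 <= K)%R -> (0 <= x < 1)%R ->
  (rsum (fun i => K * x ^ i) n <= K * / (1 - x))%R.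
Proof.
intros HK Hx; rewrite rsum_scal.
apply Rmult_le_compat_l; [exact HK | now apply rsum_geom].
Qed.

Lemma qbound_pos (G : R) (q : C) : (0 < qbound G q)%R.
Proof. apply exp_pos. Qed.

Lemma qpoch_tends (x q : C) : (Cmod q < 1)%R ->
  tends (qpoch x q) (qpoch_inf x q).
Proof.
intros Hq.
destruct (sums_abs (fun j => - (x * q ^ j) * qpoch x q j)
  (Cmod x * qbound (Cmod x) q * / (1 - Cmod q))%R) as [l [Hl _]].
- intros n; eapply Rle_trans; [|apply rsum_geom_scal].
  + apply rsum_le; intros i _; rewrite Cmod_mult, Cmod_opp, Cmod_mult, Cmod_pow.
    generalize (Cmod_qpoch_le x q i Hq) (Cmod_ge_0 x)
      (pow_le _ i (Cmod_ge_0 q)); intros H1 H2 H3.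
    assert (H4 := Rmult_le_pos _ _ H2 H3).
    assert (H5 := Rmult_le_compat_l _ _ _ H4 H1); lra.
  + apply Rmult_le_pos; [apply Cmod_ge_0 | left; apply qbound_pos].
  + split; [apply Cmod_ge_0 | exact Hq].
- assert (H : tends (qpoch x q) (1 + l)).
  { apply tends_ext with
      (fun n => 1 + csum (fun j => - (x * q ^ j) * qpoch x q j) n).
    - intros n; rewrite qpoch_telescope; ring.
    - apply tends_plus; [apply tends_const | exact Hl]. }
  replace (qpoch_inf x q) with (1 + l); [exact H|].
  symmetry; apply Clim_seq_unique.
  exact (proj2 (tends_filterlim _ _) H).
Qed.

Definition qbound_inf (G : R) (q : C) : R :=
  (1 + G * qbound G q * / (1 - Cmod q))%R.

(** The infinite product is 1 - sum_j x q^j (x;q)_j, a series of multipliers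
    dominated by a geometric series. *)
Lemma multiplier_qpoch_inf (r : R) (g : C -> C) (G : R) (q : C) :
  (0 < r)%R -> (Cmod q < 1)%R -> multiplier r g G ->
  multiplier r (fun z => qpoch_inf (g z) q) (qbound_inf G q).
Proof.
intros Hr Hq Hg f B HP.
assert (HG := multiplier_nonneg _ _ _ Hg).
assert (HB := Wiener_nonneg _ _ _ HP).
set (B1 := (G * qbound G q * / (1 - Cmod q) * B)%R).
apply Wiener_mono with (B + B1)%R; [unfold B1, qbound_inf; right; ring|].
apply Wiener_ext with (fun z => f z + (qpoch_inf (g z) q - 1) * f z);
  [intros; ring|].
apply Wiener_add; [lra | exact HP |].
apply Wiener_series with
  (f := fun n z => - q ^ n * (g z * (qpoch (g z) q n * f z)))
  (B := fun n => (G * qbound G q * B * Cmod q ^ n)%R); [exact Hr | | |].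
- intros n; apply Wiener_mono with (Cmod (- q ^ n) * (G * (qbound G q * B)))%R.
  + right; rewrite Cmod_opp, Cmod_pow; ring.
  + apply Wiener_scal, Hg, multiplier_qpoch; auto; lra.
- intros K; unfold B1.
  eapply Rle_trans; [apply rsum_geom_scal|right; ring].
  + repeat apply Rmult_le_pos; auto; left; apply qbound_pos.
  + split; [apply Cmod_ge_0 | exact Hq].
- intros z _.
  apply tends_ext with (fun n => f z * (qpoch (g z) q n - 1)).
  + intros n; rewrite <- qpoch_telescope, <- csum_scal.
    apply csum_ext; intros; ring.
  + replace ((qpoch_inf (g z) q - 1) * f z) with (f z * (qpoch_inf (g z) q - 1))
      by ring.
    apply tends_scal, tends_minus; [now apply qpoch_tends | apply tends_const].
Qed.

Lemma qpoch_inf_split (x q : C) (n : nat) : (Cmod q < 1)%R ->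
  qpoch_inf x q = qpoch x q n * qpoch_inf (x * q ^ n) q.
Proof.
intros Hq.
apply (tends_unique (fun m => qpoch x q (n + m))).
- apply (tends_subseq _ _ (fun m => (n + m)%nat)); [lia | now apply qpoch_tends].
- apply tends_ext with (fun m => qpoch x q n * qpoch (x * q ^ n) q m);
    [intros; symmetry; apply qpoch_add|].
  apply tends_scal; now apply qpoch_tends.
Qed.

Lemma Cmod_sq_lt_1 (q : C) : (Cmod q < 1)%R -> (Cmod (q ^ 2) < 1)%R.
Proof. intros H; rewrite Cmod_pow; generalize (Cmod_ge_0 q); simpl; nra. Qed.

Lemma qpoch_inf_mul_opp (x q : C) : (Cmod q < 1)%R ->
  qpoch_inf x q * qpoch_inf (- x) q = qpoch_inf (x ^ 2) (q ^ 2).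
Proof.
intros Hq; assert (Hq2 := Cmod_sq_lt_1 _ Hq).
apply (tends_unique (fun m => qpoch x q m * qpoch (- x) q m)).
- apply tends_mult; now apply qpoch_tends.
- apply tends_ext with (qpoch (x ^ 2) (q ^ 2));
    [intros; symmetry; apply qpoch_mul_opp | now apply qpoch_tends].
Qed.

(** Weierstrass' inequality: a product of factors 1 - t_j with sum of the t_j at
    most 1/2 is at least 1/2. *)
Lemma qpoch_lower_small (x q : C) (n : nat) : (Cmod q < 1)%R ->
  (Cmod x * / (1 - Cmod q) <= / 2)%R -> (/ 2 <= Cmod (qpoch x q n))%R.
Proof.
intros Hq Hx.
assert (Hg : (0 <= Cmod q < 1)%R) by (split; [apply Cmod_ge_0 | exact Hq]).
assert (H : (1 - Cmod x * rsum (fun i => Cmod q ^ i) n <= Cmod (qpoch x q n))%R).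
{ assert (HS : forall n, (0 <= Cmod x * rsum (fun i => Cmod q ^ i) n <= / 2)%R).
  { intros m; split.
    - apply Rmult_le_pos; [apply Cmod_ge_0|].
      apply rsum_nonneg; intros; apply pow_le, Cmod_ge_0.
    - eapply Rle_trans; [|exact Hx].
      apply Rmult_le_compat_l; [apply Cmod_ge_0 | now apply rsum_geom]. }
  induction n as [|n IH]; [simpl; rewrite Cmod_1; lra|].
  cbn [rsum qpoch]; rewrite Cmod_mult.
  assert (T := Cmod_triangle (1 - x * q ^ n) (x * q ^ n)).
  replace (1 - x * q ^ n + x * q ^ n) with (RtoC 1) in T by ring.
  rewrite Cmod_1, Cmod_mult, Cmod_pow in T.
  assert (S1 := HS n); assert (S2 := HS (S n)); cbn [rsum] in S2.
  set (s := (Cmod x * rsum (fun i => Cmod q ^ i) n)%R) in *.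
  replace (Cmod x * (rsum (fun i => Cmod q ^ i) n + Cmod q ^ n))%R
    with (s + Cmod x * Cmod q ^ n)%R in * by (unfold s; ring).
  assert (P : (0 <= Cmod x * Cmod q ^ n)%R)
    by (apply Rmult_le_pos; [apply Cmod_ge_0 | apply pow_le, Cmod_ge_0]).
  set (t := (Cmod x * Cmod q ^ n)%R) in *.
  assert (Q : ((1 - s) * (1 - t) <= Cmod (qpoch x q n) * Cmod (1 - x * q ^ n))%R)
    by (apply Rmult_le_compat; lra).
  nra. }
assert (H2 := Rmult_le_compat_l _ _ _ (Cmod_ge_0 x) (rsum_geom _ n Hg)).
lra.
Qed.

(** For J large the tail (x q^J;q)_n falls under qpoch_lower_small, so all the
    products (x;q)_(J+n) stay away from 0; dividing by the J last factors, which
    are bounded, gives the bound at n. *)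
Lemma qpoch_lower (x q : C) : (Cmod q < 1)%R -> regular x q ->
  exists d, (0 < d)%R /\ forall n, (d <= Cmod (qpoch x q n))%R.
Proof.
intros Hq Hx.
assert (Hi := Cmod_lt_1_pos _ Hq).
destruct (tends_scal x _ _ (tends_Cpow_0 q Hq) ((1 - Cmod q) / 2)%R) as [J HJ];
  [lra|].
specialize (HJ J (le_n J)).
replace (x * q ^ J - x * 0) with (x * q ^ J) in HJ by ring.
assert (HJ2 : (Cmod (x * q ^ J) * / (1 - Cmod q) <= / 2)%R).
{ apply Rmult_le_reg_r with (1 - Cmod q)%R; [lra|].
  rewrite Rmult_assoc, Rinv_l by lra; lra. }
set (M := Cmod (qpoch x q J)).
assert (HM : (0 < M)%R) by (apply Cmod_gt_0, qpoch_neq_0, Hx).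
set (E := qbound (Cmod x) q).
assert (HE : (0 < E)%R) by apply qbound_pos.
exists (M * / 2 / E)%R; split; [apply Rdiv_lt_0_compat; lra|].
intros n.
assert (A : (M * / 2 <= Cmod (qpoch x q (J + n)))%R).
{ rewrite qpoch_add, Cmod_mult; apply Rmult_le_compat_l; [left; exact HM|].
  now apply qpoch_lower_small. }
rewrite Nat.add_comm, qpoch_add, Cmod_mult in A.
assert (U : (Cmod (qpoch (x * q ^ n) q J) <= E)%R).
{ eapply Rle_trans; [apply Cmod_qpoch_le, Hq|]; unfold E, qbound.
  assert (L : (Cmod (x * q ^ n) / (1 - Cmod q) <= Cmod x / (1 - Cmod q))%R).
  { apply Rmult_le_compat_r; [lra|].
    rewrite Cmod_mult, Cmod_pow.
    replace (Cmod x) with (Cmod x * 1)%R at 2 by ring.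
    apply Rmult_le_compat_l; [apply Cmod_ge_0|].
    rewrite <- (pow1 n); apply pow_incr; split; [apply Cmod_ge_0 | lra]. }
  destruct L as [L|L]; [left; now apply exp_increasing | right; now rewrite L]. }
apply Rmult_le_reg_r with E; [exact HE|].
replace (M * / 2 / E * E)%R with (M * / 2)%R by (field; lra).
eapply Rle_trans; [exact A|].
apply Rmult_le_compat_l; [apply Cmod_ge_0 | exact U].
Qed.

Lemma qpoch_inf_neq_0 (x q : C) : (Cmod q < 1)%R -> regular x q ->
  qpoch_inf x q <> 0.
Proof.
intros Hq Hx E; destruct (qpoch_lower x q Hq Hx) as [d [Hd H]].
destruct (qpoch_tends x q Hq d Hd) as [N HN]; specialize (HN N (le_n N)).
rewrite E in HN; specialize (H N).
replace (qpoch x q N - 0) with (qpoch x q N) in HN by ring; lra.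
Qed.

(** * Watson's sum in the terminating case *)

Lemma regular_lt_1 (x q : C) : (Cmod q < 1)%R -> (Cmod x < 1)%R -> regular x q.
Proof.
intros Hq Hx j E.
assert (E1 : x * q ^ j = 1).
{ replace (x * q ^ j) with (1 - (1 - x * q ^ j)) by ring; rewrite E; ring. }
apply (f_equal Cmod) in E1; rewrite Cmod_mult, Cmod_pow, Cmod_1 in E1.
assert (P : (Cmod q ^ j <= 1)%R).
{ rewrite <- (pow1 j); apply pow_incr; split; [apply Cmod_ge_0 | lra]. }
assert (Q := Rmult_le_compat_l _ _ _ (Cmod_ge_0 x) P); lra.
Qed.

Lemma regular_zero (q : C) : regular 0 q.
Proof.
intros j E; apply C1_nz; rewrite <- E; ring.
Qed.

Lemma tends_qpoch (x : nat -> C) (l q : C) (n : nat) :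
  tends x l -> tends (fun j => qpoch (x j) q n) (qpoch l q n).
Proof.
intros H; induction n as [|n IH]; simpl; [apply tends_const|].
apply tends_mult; [exact IH|].
apply tends_minus; [apply tends_const|].
apply tends_mult; [exact H | apply tends_const].
Qed.

Lemma tends_vwp_factor (x : nat -> C) (l q : C) (n : nat) :
  tends x l -> tends (fun j => vwp_factor (x j) q n) (vwp_factor l q n).
Proof.
intros H; destruct n as [|n]; [exact (tends_const 1)|].
unfold vwp_factor; apply tends_mult.
- apply tends_qpoch, tends_mult; [exact H | apply tends_const].
- apply tends_minus; [apply tends_const|].
  apply tends_mult; [exact H | apply tends_const].
Qed.

(** For kap = q^m the remaining terms vanish. *)
Definition watson_sum (kap q : C) (m : nat) (A B : C) : C :=
  csum (watson_term kap q A B) (S m).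

Lemma watson_term_sym (kap q A B : C) (n : nat) :
  watson_term kap q A B n = watson_term kap q B A n.
Proof.
unfold watson_term.
replace (kap * B * A) with (kap * A * B) by ring.
replace (kap ^ 2 * B * A * q) with (kap ^ 2 * A * B * q) by ring.
replace (B * A * q) with (A * B * q) by ring.
unfold Cdiv; f_equal; [ring | f_equal; ring].
Qed.

Lemma watson_sum_sym (kap q : C) (m : nat) (A B : C) :
  watson_sum kap q m A B = watson_sum kap q m B A.
Proof. apply csum_ext; intros; apply watson_term_sym. Qed.

(** (1;q)_n = 0 for n > 0: this value normalises the recurrence. *)
Lemma watson_sum_1 (kap q B : C) (m : nat) : watson_sum kap q m 1 B = 1.
Proof.
unfold watson_sum; rewrite csum_Sl, csum_0.
- unfold watson_term; simpl; field.
- intros i _; unfold watson_term; rewrite (qpoch_Sl 1).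
  replace (1 - 1) with (RtoC 0) by ring; unfold Cdiv; ring.
Qed.

Definition watson_regular (kap q A B : C) : Prop :=
  regular (A * kap * q) q /\ regular (B * kap * q) q
  /\ regular (kap ^ 2 * A * B * q) q /\ regular (A * B * q) (q ^ 2).

Lemma watson_regular_shift (kap q A B : C) :
  watson_regular kap q A B -> watson_regular kap q A (B * q ^ 2).
Proof.
intros (H1 & H2 & H3 & H4); repeat split.
- exact H1.
- replace (B * q ^ 2 * kap * q) with (B * kap * q * q ^ 2) by ring.
  now apply regular_shift.
- replace (kap ^ 2 * A * (B * q ^ 2) * q) with (kap ^ 2 * A * B * q * q ^ 2) by ring.
  now apply regular_shift.
- replace (A * (B * q ^ 2) * q) with (A * B * q * (q ^ 2) ^ 1) by ring.
  now apply regular_shift.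
Qed.

Lemma qpoch_inv_vanish (q : C) (m i : nat) : (m < i)%nat -> qpoch_inv (q ^ m) q i = 0.
Proof.
intros H; induction i as [|i IH]; [lia|].
simpl; destruct (Nat.eq_dec m i) as [<-|Hn].
- ring.
- rewrite IH by lia; ring.
Qed.

Lemma watson_sum_shift (q A B : C) (m : nat) : (Cmod q < 1)%R ->
  watson_regular (q ^ m) q A B ->
  watson_sum (q ^ m) q m A B
  = watson_ratio (q ^ m) q A B * watson_sum (q ^ m) q m A (B * q ^ 2).
Proof.
intros Hq (H1 & H2 & H3 & H4).
assert (E := watson_telescope (q ^ m) q A B (S m)
  (regular_lt_1 _ _ Hq Hq) H1 H2 H3 H4).
unfold watson_cert in E; rewrite (qpoch_inv_vanish q m (S m)) in E by lia.
fold (watson_sum (q ^ m) q m A B) in E.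
fold (watson_sum (q ^ m) q m A (B * q ^ 2)) in E.
match type of E with ?l - ?r = ?c =>
  replace l with (r + (l - r)) by ring; rewrite E end.
unfold Cdiv; ring.
Qed.

Lemma watson_sum_iterate (q A B : C) (m J : nat) : (Cmod q < 1)%R ->
  watson_regular (q ^ m) q A B ->
  watson_sum (q ^ m) q m A B
  * (qpoch (A * B * q) (q ^ 2) J * qpoch ((q ^ m) ^ 2 * A * B * q ^ 2) (q ^ 2) J
     * qpoch (B * q ^ m * q) q (2 * J))
  = qpoch (q ^ m * A * B * q) q (2 * J) * qpoch (B * q) (q ^ 2) J
    * qpoch (B * (q ^ m) ^ 2 * q ^ 2) (q ^ 2) J
    * watson_sum (q ^ m) q m A (B * (q ^ 2) ^ J).
Proof.
intros Hq H.
assert (HR : forall J, watson_regular (q ^ m) q A (B * (q ^ 2) ^ J)).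
{ intros I; induction I as [|I IHI].
  - now replace (B * (q ^ 2) ^ 0) with B by (simpl; ring).
  - replace (B * (q ^ 2) ^ S I) with (B * (q ^ 2) ^ I * q ^ 2)
      by (rewrite (Cpow_S (q ^ 2)); ring).
    now apply watson_regular_shift. }
clear H; induction J as [|J IH].
- replace (B * (q ^ 2) ^ 0) with B by (simpl; ring); simpl; ring.
- assert (E := watson_sum_shift q A _ m Hq (HR J)).
  assert (HJ := HR J); destruct HJ as (_ & H2 & H3 & H4).
  assert (E1 := regular_0 _ _ H4).
  assert (E2 := regular_0 _ _ H2).
  assert (E3 := regular_1 _ _ H2).
  assert (E5 := regular_1 _ _ H3).
  replace (2 * S J)%nat with (S (S (2 * J))) by lia.
  rewrite !qpoch_S.
  replace (B * (q ^ 2) ^ S J) with (B * (q ^ 2) ^ J * q ^ 2)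
    by (rewrite (Cpow_S (q ^ 2)); ring).
  rewrite (Cpow_S q (2 * J)), Cpow_double in *.
  rewrite Cpow_pow2 in *.
  set (Q := q ^ J) in *; set (kap := q ^ m) in *.
  set (S0 := watson_sum kap q m A B) in *.
  set (S1 := watson_sum kap q m A (B * Q ^ 2)) in *.
  set (S2 := watson_sum kap q m A (B * Q ^ 2 * q ^ 2)) in *.
  match type of IH with _ * ?d = ?n * S1 =>
    transitivity ((S0 * d) * ((1 - A * B * q * Q ^ 2)
      * (1 - kap ^ 2 * A * B * q ^ 2 * Q ^ 2) * (1 - B * kap * q * Q ^ 2)
      * (1 - B * kap * q * (q * Q ^ 2)))) end; [ring|].
  rewrite IH, E; unfold watson_ratio.
  field; nonzero.
Qed.

(** The recurrence in B iterated towards B = 0; the sum has finitely many terms,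
    hence is continuous at B = 0. *)
Lemma watson_sum_limit (q A B : C) (m : nat) : (Cmod q < 1)%R ->
  watson_regular (q ^ m) q A B ->
  watson_sum (q ^ m) q m A B
  * (qpoch_inf (A * B * q) (q ^ 2)
     * qpoch_inf ((q ^ m) ^ 2 * A * B * q ^ 2) (q ^ 2)
     * qpoch_inf (B * q ^ m * q) q)
  = qpoch_inf (q ^ m * A * B * q) q * qpoch_inf (B * q) (q ^ 2)
    * qpoch_inf (B * (q ^ m) ^ 2 * q ^ 2) (q ^ 2)
    * watson_sum (q ^ m) q m A 0.
Proof.
intros Hq H; assert (Hq2 := Cmod_sq_lt_1 _ Hq).
assert (D : forall x : C, tends (fun J => qpoch x q (2 * J)) (qpoch_inf x q)).
{ intros x; apply (tends_subseq _ _ (fun J => (2 * J)%nat)); [lia|].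
  now apply qpoch_tends. }
eapply tends_unique.
- apply tends_scal, tends_mult; [apply tends_mult|]; [| | apply D];
    apply qpoch_tends, Hq2.
- apply tends_ext with (1 := fun J => eq_sym (watson_sum_iterate q A B m J Hq H)).
  apply tends_mult; [apply tends_mult; [apply tends_mult|]|].
  + apply D.
  + now apply qpoch_tends.
  + now apply qpoch_tends.
  + set (x := fun J => B * (q ^ 2) ^ J).
    assert (Hx : tends x 0).
    { replace (RtoC 0) with (B * 0) by ring.
      now apply tends_scal, tends_Cpow_0. }
    apply (tends_csum (fun n J => watson_term (q ^ m) q A (x J) n)).
    intros n; unfold watson_term.
    destruct H as (H1 & _).
    assert (Hl : forall c d : C, tends (fun J => c * x J * d) (c * 0 * d)).
    { intros c d; apply tends_mult; [now apply tends_scal | apply tends_const]. }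
    apply tends_mult.
    * repeat apply tends_mult; try apply tends_const.
      -- apply tends_vwp_factor, tends_scal, Hx.
      -- apply tends_qpoch, Hx.
      -- apply tends_qpoch, Hl.
    * apply tends_inv.
      -- repeat apply Cmult_neq_0; apply qpoch_neq_0.
         ++ now apply regular_lt_1.
         ++ exact H1.
         ++ replace (0 * q ^ m * q) with (RtoC 0) by ring; apply regular_zero.
         ++ replace ((q ^ m) ^ 2 * A * 0 * q) with (RtoC 0) by ring;
              apply regular_zero.
         ++ replace (A * 0 * q) with (RtoC 0) by ring; apply regular_zero.
      -- repeat apply tends_mult; try apply tends_const.
         ++ apply tends_qpoch.
            apply tends_ext with (fun J => 1 * x J * (q ^ m * q));
              [intros; ring|].
            replace (0 * q ^ m * q) with (1 * 0 * (q ^ m * q)) by ring; apply Hl.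
         ++ apply tends_qpoch, Hl.
         ++ apply tends_qpoch, Hl.
Qed.

Lemma qpoch_inf_0 (q : C) : (Cmod q < 1)%R -> qpoch_inf 0 q = 1.
Proof.
intros Hq; apply (tends_unique (qpoch 0 q)); [now apply qpoch_tends|].
apply tends_ext with (fun _ => 1); [|apply tends_const].
intros n; induction n as [|n IH]; simpl; [reflexivity|].
rewrite <- IH; ring.
Qed.

(** By symmetry the same limit removes the parameter A. *)
Lemma watson_sum_0 (q A : C) (m : nat) : (Cmod q < 1)%R ->
  regular (A * q ^ m * q) q ->
  watson_sum (q ^ m) q m A 0 * qpoch_inf (A * q ^ m * q) q
  = qpoch_inf (A * q) (q ^ 2) * qpoch_inf (A * (q ^ m) ^ 2 * q ^ 2) (q ^ 2)
    * watson_sum (q ^ m) q m 0 0.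
Proof.
intros Hq H; assert (Hq2 := Cmod_sq_lt_1 _ Hq).
assert (E := watson_sum_limit q 0 A m Hq).
replace (0 * A * q) with (RtoC 0) in E by ring.
replace ((q ^ m) ^ 2 * 0 * A * q ^ 2) with (RtoC 0) in E by ring.
replace (q ^ m * 0 * A * q) with (RtoC 0) in E by ring.
rewrite !qpoch_inf_0 in E by assumption.
rewrite watson_sum_sym.
transitivity (watson_sum (q ^ m) q m 0 A * (1 * 1 * qpoch_inf (A * q ^ m * q) q));
  [ring|].
rewrite E; [ring|].
repeat split; [| exact H | |];
  match goal with |- regular ?x _ => replace x with (RtoC 0) by ring end;
  apply regular_zero.
Qed.

(** Watson's sum is thereby a product of infinite products and of the constant
    watson_sum 0 0, which the trivial case A = 1, B = 0 evaluates. Denominators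
    are multiplied out. *)
Lemma watson_sum_value (q A B : C) (m : nat) : (Cmod q < 1)%R ->
  watson_regular (q ^ m) q A B ->
  watson_sum (q ^ m) q m A B
  * (qpoch_inf (A * B * q) (q ^ 2)
     * qpoch_inf ((q ^ m) ^ 2 * A * B * q ^ 2) (q ^ 2)
     * qpoch_inf (A * q ^ m * q) q * qpoch_inf (B * q ^ m * q) q
     * qpoch_inf q (q ^ 2) * qpoch_inf (q ^ 2 * (q ^ m) ^ 2) (q ^ 2))
  = qpoch_inf (q ^ m * A * B * q) q * qpoch_inf (q ^ m * q) q
    * qpoch_inf (A * q) (q ^ 2) * qpoch_inf (A * (q ^ m) ^ 2 * q ^ 2) (q ^ 2)
    * qpoch_inf (B * q) (q ^ 2) * qpoch_inf (B * (q ^ m) ^ 2 * q ^ 2) (q ^ 2).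
Proof.
intros Hq H.
assert (E1 := watson_sum_limit q A B m Hq H).
assert (E2 := watson_sum_0 q A m Hq (proj1 H)).
assert (Hm : regular (1 * q ^ m * q) q).
{ apply regular_lt_1; [exact Hq|].
  rewrite !Cmod_mult, Cmod_1, Cmod_pow.
  assert (P : (Cmod q ^ m <= 1)%R).
  { rewrite <- (pow1 m); apply pow_incr; split; [apply Cmod_ge_0 | lra]. }
  generalize (Cmod_ge_0 q); nra. }
assert (E3 := watson_sum_0 q 1 m Hq Hm).
rewrite watson_sum_1, !Cmult_1_l, (Cmult_comm _ (q ^ 2)) in E3.
match type of E1 with ?s * ?d = ?n * ?s0 =>
  transitivity ((s * d) * (qpoch_inf (A * q ^ m * q) q
     * (qpoch_inf q (q ^ 2) * qpoch_inf (q ^ 2 * (q ^ m) ^ 2) (q ^ 2)))); [ring|];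
  rewrite E1;
  transitivity (n * (s0 * qpoch_inf (A * q ^ m * q) q)
     * (qpoch_inf q (q ^ 2) * qpoch_inf (q ^ 2 * (q ^ m) ^ 2) (q ^ 2))); [ring|]
end.
rewrite E2, E3; ring.
Qed.

(** * The two sides as entire functions of kap *)

(** The dependence on b of the n-th term of the series on the left, together with
    the infinite product in front of the series: (b;q)_n (kap b q;q)_oo divided by
    (kap b q;q)_n. *)
Definition half_left (kap q b : C) (n : nat) : C :=
  qpoch b q n * qpoch_inf (b * q ^ S n * kap) q.

(** The analogue for the series on the right. For N = 2n the first two factors are
    (b;q^2)_n (b q;q^2)_oo, and for N = 2n + 1 they are (b;q^2)_oo (b q;q^2)_n: this
    is how the two series become the even and odd parts of one. *)
Definition half_right (kap q b : C) (N : nat) : C :=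
  qpoch b q N * qpoch_inf (b * q ^ S N) (q ^ 2)
  * qpoch_inf (b * q ^ S (S N) * kap ^ 2) (q ^ 2).

Definition left_coef (p mu : C) (n : nat) : C :=
  qpoch_inf (p ^ 2) ((p ^ 2) ^ 2) * qpoch_inf (mu ^ 2 * p ^ 2) ((p ^ 2) ^ 2)
  * (qpoch (- mu) (p ^ 2) n
     / (qpoch (p ^ 2) (p ^ 2) n * qpoch (mu * p) (p ^ 2) n
        * qpoch (mu ^ 2) (p ^ 2) n) * (- p) ^ n).

(** The n-th term of the left-hand side multiplied by (k q, a q / k;q)_oo, all
    denominators that contain kap having been cancelled against the infinite
    products in front; it is therefore entire in kap. *)
Definition left_term (p mu b be : C) (n : nat) (kap : C) : C :=
  left_coef p mu n
  * (half_left kap (p ^ 2) b n * half_left kap (p ^ 2) be n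
     * (qpoch (mu * p * kap) (p ^ 2) n * qpoch (p ^ 2 * kap) (p ^ 2) n)
     * (qpoch_inf (p ^ 2 * mu * kap) (p ^ 2)
        * qpoch_inf (- ((p ^ 2) ^ S n * mu) * kap) (p ^ 2))
     * qpoch_inf ((p ^ 2) ^ 2 * kap ^ 2) ((p ^ 2) ^ 2)
     * vwp_factor (mu ^ 2 * kap) (p ^ 2) n).

Definition right_coef (p mu : C) (N : nat) : C :=
  (- p) ^ N / (qpoch p p N * qpoch mu p N).

(** The even and odd terms of the right-hand side, in one family and multiplied by
    (k q, a q / k;q)_oo. *)
Definition right_term (p mu b be : C) (N : nat) (kap : C) : C :=
  right_coef p mu N
  * (half_right kap (p ^ 2) b N * half_right kap (p ^ 2) be N
     * (qpoch_inf (mu ^ 2 * p ^ 2 * kap) (p ^ 2) * qpoch_inf (p ^ 2 * kap) (p ^ 2))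
     * vwp_factor (mu * kap) p N * qpoch (p * kap) p N).

Lemma multiplier_lin (r : R) (c : C) (G : R) : (0 <= r)%R -> (Cmod c * r <= G)%R ->
  multiplier r (fun z => c * z) G.
Proof.
intros Hr HG; apply multiplier_mono with (1 := HG).
apply multiplier_mul; [apply multiplier_const | now apply multiplier_id].
Qed.

Lemma multiplier_sq (r : R) (c : C) (G : R) : (0 <= r)%R ->
  (Cmod c * (r * r) <= G)%R -> multiplier r (fun z => c * z ^ 2) G.
Proof.
intros Hr HG; apply multiplier_mono with (1 := HG).
apply multiplier_ext with (fun z => c * (z * z)); [intros; ring|].
apply multiplier_mul; [apply multiplier_const|].
now apply multiplier_mul; apply multiplier_id.
Qed.

Lemma Cmod_pow_le_1 (q : C) (n : nat) : (Cmod q < 1)%R -> (Cmod (q ^ n) <= 1)%R.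
Proof.
intros Hq; rewrite Cmod_pow, <- (pow1 n); apply pow_incr.
split; [apply Cmod_ge_0 | lra].
Qed.

Definition vbound (G : R) (q : C) : R := (1 + qbound G q * (1 + G))%R.

Lemma multiplier_vwp_factor (r : R) (g : C -> C) (G : R) (q : C) (n : nat) :
  (0 <= r)%R -> (Cmod q < 1)%R -> multiplier r g G ->
  multiplier r (fun z => vwp_factor (g z) q n) (vbound G q).
Proof.
intros Hr Hq Hg; assert (HG := multiplier_nonneg _ _ _ Hg).
assert (P : (0 <= qbound G q * (1 + G))%R)
  by (apply Rmult_le_pos; [left; apply qbound_pos | lra]).
destruct n as [|n].
- apply multiplier_mono with 1%R; [unfold vbound; lra | apply multiplier_1].
- apply multiplier_mono with (qbound G q * (1 + G))%R; [unfold vbound; lra|].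
  unfold vwp_factor; apply multiplier_mul.
  + apply multiplier_qpoch; auto.
    apply multiplier_mono with (G * Cmod q)%R;
      [|apply multiplier_mul; [exact Hg | apply multiplier_const]].
    generalize (Cmod_ge_0 q); nra.
  + apply multiplier_mono with (1 + G * Cmod (q ^ (2 * S n)))%R;
      [|now apply multiplier_factor].
    generalize (Cmod_pow_le_1 q (2 * S n) Hq) (Cmod_ge_0 (q ^ (2 * S n))); nra.
Qed.

Lemma Cmod_mul_pow_le (b q : C) (n : nat) (r : R) : (0 <= r)%R ->
  (Cmod q < 1)%R -> (Cmod (b * q ^ n) * r <= Cmod b * r)%R.
Proof.
intros Hr Hq; apply Rmult_le_compat_r; [exact Hr|]; rewrite Cmod_mult.
generalize (Cmod_pow_le_1 q n Hq) (Cmod_ge_0 b); nra.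
Qed.

Definition uniform_multiplier (r : R) (g : nat -> C -> C) : Prop :=
  exists K, forall n, multiplier r (g n) K.

Lemma uniform_multiplier_mul (r : R) (g h : nat -> C -> C) :
  uniform_multiplier r g -> uniform_multiplier r h -> uniform_multiplier r (fun n z => g n z * h n z).
Proof.
intros [K HK] [L HL]; exists (K * L)%R; intros n; now apply multiplier_mul.
Qed.

Lemma uniform_multiplier_half_left (r : R) (q b : C) : (0 < r)%R -> (Cmod q < 1)%R ->
  uniform_multiplier r (fun n z => half_left z q b n).
Proof.
intros Hr Hq; unfold half_left; apply uniform_multiplier_mul.
- exists (qbound (Cmod b) q); intros n.
  apply multiplier_mono with (1 := Cmod_qpoch_le b q n Hq).
  apply multiplier_const.
- exists (qbound_inf (Cmod b * r) q); intros n.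
  apply (multiplier_qpoch_inf r (fun z => b * q ^ S n * z)); auto.
  apply multiplier_lin; [lra|]; apply Cmod_mul_pow_le; [lra | exact Hq].
Qed.

Lemma qpoch_inf_le (x q : C) (G : R) : (Cmod q < 1)%R -> (Cmod x <= G)%R ->
  (Cmod (qpoch_inf x q) <= qbound G q)%R.
Proof.
intros Hq HG; refine (tends_Cmod_le _ _ _ 0 _ (qpoch_tends x q Hq)).
intros n _.
apply (Wiener_bound 1 (fun z => qpoch x q n) _ 0); [|rewrite Cmod_0; lra].
apply multiplier_Wiener, (multiplier_qpoch 1 (fun _ => x)); [lra | exact Hq |].
apply multiplier_mono with (1 := HG), multiplier_const.
Qed.

Lemma uniform_multiplier_half_right (r : R) (q b : C) : (0 < r)%R -> (Cmod q < 1)%R ->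
  uniform_multiplier r (fun n z => half_right z q b n).
Proof.
intros Hr Hq; assert (Hq2 := Cmod_sq_lt_1 _ Hq).
assert (Hb : forall n, (Cmod (b * q ^ n) <= Cmod b)%R).
{ intros n; generalize (Cmod_mul_pow_le b q n 1 ltac:(lra) Hq); lra. }
unfold half_right; apply uniform_multiplier_mul; [apply uniform_multiplier_mul|].
- exists (qbound (Cmod b) q); intros n.
  apply multiplier_mono with (1 := Cmod_qpoch_le b q n Hq).
  apply multiplier_const.
- exists (qbound (Cmod b) (q ^ 2)); intros n.
  apply multiplier_mono with (1 := qpoch_inf_le _ _ _ Hq2 (Hb (S n))), multiplier_const.
- exists (qbound_inf (Cmod b * (r * r)) (q ^ 2)); intros n.
  apply (multiplier_qpoch_inf r (fun z => b * q ^ S (S n) * z ^ 2)); auto.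
  apply multiplier_sq; [lra|]; apply Rmult_le_compat_r; [nra | apply Hb].
Qed.

Definition bounded_seq (u : nat -> C) : Prop :=
  exists K, forall n, (Cmod (u n) <= K)%R.

Lemma bounded_const (c : C) : bounded_seq (fun _ => c).
Proof. exists (Cmod c); intros; lra. Qed.

Lemma bounded_mul (u v : nat -> C) :
  bounded_seq u -> bounded_seq v -> bounded_seq (fun n => u n * v n).
Proof.
intros [K HK] [L HL]; exists (K * L)%R; intros n; rewrite Cmod_mult.
apply Rmult_le_compat; auto using Cmod_ge_0.
Qed.

Lemma bounded_qpoch (x q : C) : (Cmod q < 1)%R -> bounded_seq (qpoch x q).
Proof. intros Hq; exists (qbound (Cmod x) q); intros; now apply Cmod_qpoch_le. Qed.

Lemma bounded_inv_qpoch (x q : C) : (Cmod q < 1)%R -> regular x q ->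
  bounded_seq (fun n => / qpoch x q n).
Proof.
intros Hq Hx; destruct (qpoch_lower x q Hq Hx) as [d [Hd H]].
exists (/ d)%R; intros n.
rewrite Cmod_inv by now apply qpoch_neq_0.
apply Rinv_le_contravar; auto.
Qed.

(** The conditions that do not involve kap. *)
Definition admissible (p mu : C) : Prop :=
  (Cmod p < 1)%R /\ regular mu p /\ regular (mu ^ 2) (p ^ 2).

Lemma left_coef_bound (p mu : C) : admissible p mu ->
  exists K, forall n, (Cmod (left_coef p mu n) <= K * Cmod p ^ n)%R.
Proof.
intros (Hp & Hmu & Hmu2); assert (Hq := Cmod_sq_lt_1 _ Hp).
apply regular_bisect in Hmu; destruct Hmu as [_ Hmup].
assert (B : bounded_seq (fun n => qpoch_inf (p ^ 2) ((p ^ 2) ^ 2)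
  * qpoch_inf (mu ^ 2 * p ^ 2) ((p ^ 2) ^ 2)
  * (qpoch (- mu) (p ^ 2) n
     * (/ qpoch (p ^ 2) (p ^ 2) n * / qpoch (mu * p) (p ^ 2) n
        * / qpoch (mu ^ 2) (p ^ 2) n)))).
{ repeat apply bounded_mul; try apply bounded_const.
  - now apply bounded_qpoch.
  - apply bounded_inv_qpoch; [exact Hq | now apply regular_lt_1].
  - now apply bounded_inv_qpoch.
  - now apply bounded_inv_qpoch. }
destruct B as [K HK]; exists K; intros n.
specialize (HK n).
replace (left_coef p mu n) with (qpoch_inf (p ^ 2) ((p ^ 2) ^ 2)
  * qpoch_inf (mu ^ 2 * p ^ 2) ((p ^ 2) ^ 2)
  * (qpoch (- mu) (p ^ 2) n
     * (/ qpoch (p ^ 2) (p ^ 2) n * / qpoch (mu * p) (p ^ 2) n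
        * / qpoch (mu ^ 2) (p ^ 2) n)) * (- p) ^ n).
- rewrite Cmod_mult, Cmod_pow, Cmod_opp.
  apply Rmult_le_compat_r; [apply pow_le, Cmod_ge_0 | exact HK].
- unfold left_coef; field; repeat split; apply qpoch_neq_0; auto.
  now apply regular_lt_1.
Qed.

Lemma right_coef_bound (p mu : C) : admissible p mu ->
  exists K, forall n, (Cmod (right_coef p mu n) <= K * Cmod p ^ n)%R.
Proof.
intros (Hp & Hmu & _).
assert (B : bounded_seq (fun n => / qpoch p p n * / qpoch mu p n)).
{ apply bounded_mul; apply bounded_inv_qpoch; auto; now apply regular_lt_1. }
destruct B as [K HK]; exists K; intros n; specialize (HK n).
replace (right_coef p mu n) with (/ qpoch p p n * / qpoch mu p n * (- p) ^ n).
- rewrite Cmod_mult, Cmod_pow, Cmod_opp.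
  apply Rmult_le_compat_r; [apply pow_le, Cmod_ge_0 | exact HK].
- unfold right_coef; field; split; apply qpoch_neq_0; auto.
  now apply regular_lt_1.
Qed.

Lemma geometric_multiplier (r : R) (x : C) (c : nat -> C) (g : nat -> C -> C) :
  (exists K, forall n, (Cmod (c n) <= K * Cmod x ^ n)%R) -> uniform_multiplier r g ->
  exists K, forall n, multiplier r (fun z => c n * g n z) (K * Cmod x ^ n)%R.
Proof.
intros [K HK] [L HL]; exists (K * L)%R; intros n.
apply multiplier_mono with (K * Cmod x ^ n * L)%R; [right; ring|].
apply multiplier_mul; [|apply HL].
apply multiplier_mono with (1 := HK n), multiplier_const.
Qed.

Lemma uniform_multiplier_intro (r : R) (g : nat -> C -> C) (K : R) :
  (forall n, multiplier r (g n) K) -> uniform_multiplier r g.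
Proof. now exists K. Qed.

Lemma left_term_multiplier (r : R) (p mu b be : C) : (0 < r)%R -> admissible p mu ->
  exists K, forall n, multiplier r (left_term p mu b be n) (K * Cmod p ^ n)%R.
Proof.
intros Hr Hg; assert (Hp := proj1 Hg); assert (Hq := Cmod_sq_lt_1 _ Hp).
assert (Hq2 := Cmod_sq_lt_1 _ Hq).
assert (Hr0 : (0 <= r)%R) by lra.
unfold left_term; apply geometric_multiplier; [now apply left_coef_bound|].
apply uniform_multiplier_mul; [apply uniform_multiplier_mul; [apply uniform_multiplier_mul; [apply uniform_multiplier_mul;
  [apply uniform_multiplier_mul|apply uniform_multiplier_mul]|apply uniform_multiplier_mul]|]|].
- now apply uniform_multiplier_half_left.
- now apply uniform_multiplier_half_left.
- eapply uniform_multiplier_intro; intros n;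
    apply (multiplier_qpoch r (fun z => mu * p * z)); auto.
  apply multiplier_lin; [exact Hr0 | apply Rle_refl].
- eapply uniform_multiplier_intro; intros n;
    apply (multiplier_qpoch r (fun z => p ^ 2 * z)); auto.
  apply multiplier_lin; [exact Hr0 | apply Rle_refl].
- eapply uniform_multiplier_intro; intros n;
    apply (multiplier_qpoch_inf r (fun z => p ^ 2 * mu * z)); auto.
  apply multiplier_lin; [exact Hr0 | apply Rle_refl].
- eapply uniform_multiplier_intro; intros n;
    apply (multiplier_qpoch_inf r (fun z => - ((p ^ 2) ^ S n * mu) * z)); auto.
  apply multiplier_lin; [exact Hr0|].
  rewrite Cmod_opp, Cmult_comm; now apply Cmod_mul_pow_le.
- eapply uniform_multiplier_intro; intros n;
    apply (multiplier_qpoch_inf r (fun z => (p ^ 2) ^ 2 * z ^ 2)); auto.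
  apply multiplier_sq; [exact Hr0 | apply Rle_refl].
- eapply uniform_multiplier_intro; intros n;
    apply (multiplier_vwp_factor r (fun z => mu ^ 2 * z)); auto.
  apply multiplier_lin; [exact Hr0 | apply Rle_refl].
Qed.

Lemma right_term_multiplier (r : R) (p mu b be : C) : (0 < r)%R -> admissible p mu ->
  exists K, forall n, multiplier r (right_term p mu b be n) (K * Cmod p ^ n)%R.
Proof.
intros Hr Hg; assert (Hp := proj1 Hg); assert (Hq := Cmod_sq_lt_1 _ Hp).
assert (Hr0 : (0 <= r)%R) by lra.
unfold right_term; apply geometric_multiplier; [now apply right_coef_bound|].
apply uniform_multiplier_mul; [apply uniform_multiplier_mul; [apply uniform_multiplier_mul;
  [apply uniform_multiplier_mul|apply uniform_multiplier_mul]|]|].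
- now apply uniform_multiplier_half_right.
- now apply uniform_multiplier_half_right.
- eapply uniform_multiplier_intro; intros n;
    apply (multiplier_qpoch_inf r (fun z => mu ^ 2 * p ^ 2 * z)); auto.
  apply multiplier_lin; [exact Hr0 | apply Rle_refl].
- eapply uniform_multiplier_intro; intros n;
    apply (multiplier_qpoch_inf r (fun z => p ^ 2 * z)); auto.
  apply multiplier_lin; [exact Hr0 | apply Rle_refl].
- eapply uniform_multiplier_intro; intros n;
    apply (multiplier_vwp_factor r (fun z => mu * z)); auto.
  apply multiplier_lin; [exact Hr0 | apply Rle_refl].
- eapply uniform_multiplier_intro; intros n;
    apply (multiplier_qpoch r (fun z => p * z)); auto.
  apply multiplier_lin; [exact Hr0 | apply Rle_refl].
Qed.

Lemma CSeries_sums (u : nat -> C) (l : C) : sums u l -> CSeries u = l.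
Proof. intros H; apply CSeries_unique, is_series_sums, H. Qed.

Lemma geometric_family (r : R) (x : C) (f : nat -> C -> C) (K : R) :
  (0 < r)%R -> (Cmod x < 1)%R ->
  (forall n, multiplier r (f n) (K * Cmod x ^ n)%R) ->
  (forall z, (Cmod z <= r)%R ->
     sums (fun n => f n z) (CSeries (fun n => f n z))) /\
  Wiener r (fun z => CSeries (fun n => f n z)) (K * / (1 - Cmod x)).
Proof.
intros Hr Hx Hf.
assert (HK : (0 <= K)%R).
{ generalize (multiplier_nonneg _ _ _ (Hf 0%nat)); simpl; lra. }
assert (HT : forall n, (rsum (fun i => K * Cmod x ^ i)%R n <= K * / (1 - Cmod x))%R).
{ intros n; apply rsum_geom_scal; [exact HK | split; [apply Cmod_ge_0 | exact Hx]]. }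
assert (HS : forall z, (Cmod z <= r)%R ->
     sums (fun n => f n z) (CSeries (fun n => f n z))).
{ intros z Hz; destruct (sums_abs (fun n => f n z) (K * / (1 - Cmod x))) as [l [Hl _]].
  - intros n; eapply Rle_trans; [|apply HT].
    apply rsum_le; intros i _; apply (Wiener_bound r _ _ z (multiplier_Wiener _ _ _ (Hf i)) Hz).
  - now rewrite (CSeries_sums _ _ Hl). }
split; [exact HS|].
apply Wiener_series with f (fun n => K * Cmod x ^ n)%R; auto.
intros n; now apply multiplier_Wiener.
Qed.

(** * The double sum behind the transformation *)

Definition cross_weight (p mu b be kap : C) (n : nat) : C :=
  qpoch_inf (p ^ 2) ((p ^ 2) ^ 2) * qpoch_inf (mu ^ 2 * p ^ 2) ((p ^ 2) ^ 2)
  * qpoch_inf ((p ^ 2 * mu * kap) ^ 2) ((p ^ 2) ^ 2)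
  * qpoch_inf ((p ^ 2) ^ 2 * kap ^ 2) ((p ^ 2) ^ 2)
  * (half_left kap (p ^ 2) b n * half_left kap (p ^ 2) be n)
  * ((1 - mu ^ 2 * kap * (p ^ 2) ^ (2 * n))
     * qpoch (mu ^ 2 * kap ^ 2 * p ^ 2) ((p ^ 2) ^ 2) n
     / qpoch (mu ^ 2 * p ^ 2) ((p ^ 2) ^ 2) n)
  / ((1 - mu ^ 2 * kap) * (1 - mu * kap)).

(** The array whose column sums are the left terms (with n = N + r fixed) and whose
    row sums are the right terms (with N fixed). *)
Definition cross_term (p mu b be kap : C) (N r : nat) : C :=
  cross_weight p mu b be kap (N + r) * jackson_term p mu kap N r.

(** Under this bound every factor 1 - x met in the two summation formulas and
    involving kap has |x| < 1. *)
Definition small (mu b be kap : C) : Prop :=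
  (Cmod kap * (1 + Cmod mu + Cmod mu * Cmod mu + Cmod b + Cmod be) < 1)%R.

Lemma small_lt_1 (mu b be kap : C) : small mu b be kap ->
  (Cmod kap < 1)%R /\ (Cmod (mu * kap) < 1)%R /\ (Cmod (mu ^ 2 * kap) < 1)%R
  /\ (Cmod (b * kap) < 1)%R /\ (Cmod (be * kap) < 1)%R.
Proof.
unfold small; intros H.
rewrite !Cmod_mult, Cmod_pow.
assert (H1 := Cmod_ge_0 kap); assert (H2 := Cmod_ge_0 mu).
assert (H3 := Cmod_ge_0 b); assert (H4 := Cmod_ge_0 be).
assert (P1 := Rmult_le_pos _ _ H1 H2).
assert (P2 := Rmult_le_pos _ _ H1 (Rmult_le_pos _ _ H2 H2)).
assert (P3 := Rmult_le_pos _ _ H1 H3).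
assert (P4 := Rmult_le_pos _ _ H1 H4).
repeat split; simpl; lra.
Qed.

Lemma Cmod_mul_lt_1 (x y : C) :
  (Cmod x < 1)%R -> (Cmod y <= 1)%R -> (Cmod (x * y) < 1)%R.
Proof.
rewrite Cmod_mult; generalize (Cmod_ge_0 x) (Cmod_ge_0 y); nra.
Qed.

Lemma Cmod_pow_le_1_weak (q : C) (n : nat) : (Cmod q <= 1)%R -> (Cmod (q ^ n) <= 1)%R.
Proof.
intros Hq; rewrite Cmod_pow, <- (pow1 n); apply pow_incr.
split; [apply Cmod_ge_0 | exact Hq].
Qed.

Lemma small_jackson_regular (p mu b be kap : C) : admissible p mu ->
  small mu b be kap -> jackson_regular p mu kap.
Proof.
intros (Hp & Hmu & Hmu2) Hs; assert (Hq := Cmod_sq_lt_1 _ Hp).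
destruct (small_lt_1 _ _ _ _ Hs) as (K0 & K1 & K2 & _).
repeat split; auto; apply regular_lt_1; auto.
- replace (mu ^ 2 * kap ^ 2 * p ^ 2) with (mu ^ 2 * kap * (kap * p ^ 2)) by ring.
  apply Cmod_mul_lt_1; [exact K2 | left; apply Cmod_mul_lt_1; lra].
- rewrite Cmod_opp; replace (p ^ 2 * mu * kap) with (mu * kap * p ^ 2) by ring.
  apply Cmod_mul_lt_1; lra.
- rewrite Cmod_opp; apply Cmod_mul_lt_1; lra.
Qed.

Lemma one_minus_neq_0 (x : C) : (Cmod x < 1)%R -> 1 - x <> 0.
Proof.
intros H; generalize (regular_0 x 0); intros R; apply R, regular_lt_1;
  [rewrite Cmod_0; lra | exact H].
Qed.

(** jackson_sum multiplied by cross_weight, which is constant along a column. *)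
Lemma column_value (p mu b be kap : C) (n : nat) : admissible p mu ->
  small mu b be kap ->
  csum (fun N => cross_term p mu b be kap N (n - N)) (S n)
  = left_term p mu b be n kap.
Proof.
intros Hg Hs; assert (HJ := small_jackson_regular _ _ _ _ _ Hg Hs).
destruct (small_lt_1 _ _ _ _ Hs) as (K0 & K1 & K2 & _).
apply one_minus_neq_0 in K1; apply one_minus_neq_0 in K2.
destruct Hg as (Hp & Hmu & Hmu2); assert (Hq := Cmod_sq_lt_1 _ Hp).
apply regular_bisect in Hmu; destruct Hmu as [_ Hmup].
rewrite (csum_ext _ (fun N => cross_weight p mu b be kap n
  * jackson_term p mu kap N (n - N))).
2: { intros i Hi; unfold cross_term; do 2 f_equal; lia. }
rewrite csum_scal, jackson_sum by exact HJ.
destruct HJ as (_ & Hqq & _ & Ha & _ & Hs1 & Hs2).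
assert (V := vwp_factor_spec (mu ^ 2 * kap) (p ^ 2) n).
assert (I1 := qpoch_mul_opp (mu * kap * p) (p ^ 2) n).
assert (I2 := qpoch_mul_opp (mu * p) (p ^ 2) n).
assert (I3 := qpoch_inf_mul_opp (p ^ 2 * mu * kap) _ Hq).
assert (I4 := qpoch_inf_split (- (p ^ 2 * mu * kap)) _ n Hq).
replace ((mu * kap * p) ^ 2) with (mu ^ 2 * kap ^ 2 * p ^ 2) in I1 by ring.
replace ((mu * p) ^ 2) with (mu ^ 2 * p ^ 2) in I2 by ring.
replace (- (p ^ 2 * mu * kap) * (p ^ 2) ^ n)
  with (- ((p ^ 2) ^ S n * mu) * kap) in I4 by (rewrite (Cpow_S (p ^ 2)); ring).
assert (N1 := qpoch_neq_0 _ _ n Hqq).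
assert (N2 := qpoch_neq_0 _ _ n Hmup).
assert (N3 := qpoch_neq_0 _ _ n Hmu2).
assert (N4 := qpoch_neq_0 _ _ n Hs1).
assert (N5 := qpoch_neq_0 _ _ n Hs2).
assert (N6 : qpoch (- (mu * p)) (p ^ 2) n <> 0).
{ apply qpoch_neq_0; intros j E.
  apply regular_bisect in Hmu2; destruct Hmu2 as [_ Hm].
  apply (Hm j).
  replace (1 - mu ^ 2 * p ^ 2 * ((p ^ 2) ^ 2) ^ j)
    with ((1 - - (mu * p) * (p ^ 2) ^ j) * (1 - mu * p * (p ^ 2) ^ j))
    by (rewrite !Cpow_pow2; ring).
  rewrite E; ring. }
unfold cross_weight, left_term, left_coef, jackson_value.
rewrite <- I1, <- I2, <- I3, I4.
apply Cdiv_unique in V; [rewrite V | exact K2].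
replace (mu * p * kap) with (mu * kap * p) by ring.
replace (p ^ 2 * kap) with (kap * p ^ 2) by ring.
set (hl := half_left kap (p ^ 2) b n); set (hl' := half_left kap (p ^ 2) be n).
abstract_qpoch.
field; nonzero.
Qed.

Lemma half_left_shift (kap q b : C) (N r : nat) : (Cmod q < 1)%R ->
  half_left kap q b (N + r) * qpoch (b * q ^ N * kap * q) q r
  = half_left kap q b N * qpoch (b * q ^ N) q r.
Proof.
intros Hq; unfold half_left.
rewrite qpoch_add, (qpoch_inf_split (b * q ^ S N * kap) q r Hq).
replace (b * q ^ S N * kap * q ^ r) with (b * q ^ S (N + r) * kap)
  by (rewrite !Cpow_S, Cpow_add_r; ring).
replace (b * q ^ N * kap * q) with (b * q ^ S N * kap) by (rewrite Cpow_S; ring).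
ring.
Qed.

Lemma generic_sq_regular (p mu : C) : admissible p mu ->
  regular (mu ^ 2 * p ^ 2) ((p ^ 2) ^ 2).
Proof. intros (_ & _ & H); now apply regular_bisect in H. Qed.

Lemma cross_watson_regular (p mu b be kap : C) (N : nat) :
  admissible p mu -> b * be = mu ^ 2 -> small mu b be kap ->
  watson_regular kap (p ^ 2) (b * (p ^ 2) ^ N) (be * (p ^ 2) ^ N).
Proof.
intros Hg Hb Hs; assert (Hp := proj1 Hg); assert (Hq := Cmod_sq_lt_1 _ Hp).
destruct (small_lt_1 _ _ _ _ Hs) as (K0 & _ & K2 & K3 & K4).
assert (HN := Cmod_pow_le_1 (p ^ 2) N Hq).
repeat split.
- apply regular_lt_1; [exact Hq|].
  replace (b * (p ^ 2) ^ N * kap * p ^ 2) with (b * kap * (p ^ 2) ^ N * p ^ 2) by ring.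
  apply Cmod_mul_lt_1; [now apply Cmod_mul_lt_1 | lra].
- apply regular_lt_1; [exact Hq|].
  replace (be * (p ^ 2) ^ N * kap * p ^ 2) with (be * kap * (p ^ 2) ^ N * p ^ 2) by ring.
  apply Cmod_mul_lt_1; [now apply Cmod_mul_lt_1 | lra].
- apply regular_lt_1; [exact Hq|].
  replace (kap ^ 2 * (b * (p ^ 2) ^ N) * (be * (p ^ 2) ^ N) * p ^ 2)
    with (b * be * kap * kap * (p ^ 2) ^ N * (p ^ 2) ^ N * p ^ 2) by ring.
  rewrite Hb.
  apply Cmod_mul_lt_1; [|lra].
  apply Cmod_mul_lt_1; [|exact HN].
  apply Cmod_mul_lt_1; [|exact HN].
  apply Cmod_mul_lt_1; [exact K2 | lra].
- replace (b * (p ^ 2) ^ N * (be * (p ^ 2) ^ N) * p ^ 2)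
    with (b * be * p ^ 2 * ((p ^ 2) ^ 2) ^ N) by (rewrite Cpow_pow2; ring).
  rewrite Hb; now apply regular_shift, generic_sq_regular.
Qed.

Lemma small_regular_k (p mu b be kap : C) : (Cmod p < 1)%R ->
  small mu b be kap -> regular (mu ^ 2 * kap) (p ^ 2).
Proof.
intros Hp Hs; apply regular_lt_1; [now apply Cmod_sq_lt_1|].
now destruct (small_lt_1 _ _ _ _ Hs) as (_ & _ & K2 & _).
Qed.

(** Along a row the dependence on r is that of the Watson series with
    A = b q^N and B = be q^N, whose leading parameter is k q^(2N). *)
Lemma cross_term_watson (p mu b be kap : C) (N r : nat) :
  admissible p mu -> b * be = mu ^ 2 -> small mu b be kap ->
  cross_term p mu b be kap N r
  = cross_term p mu b be kap N 0
    * watson_term kap (p ^ 2) (b * (p ^ 2) ^ N) (be * (p ^ 2) ^ N) r.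
Proof.
intros Hg Hb Hs.
destruct (cross_watson_regular p mu b be kap N Hg Hb Hs) as (R1 & R2 & R3 & R4).
assert (HJ := small_jackson_regular _ _ _ _ _ Hg Hs).
assert (Rm := generic_sq_regular _ _ Hg).
destruct (small_lt_1 _ _ _ _ Hs) as (K0 & K1 & K2 & _).
apply one_minus_neq_0 in K1; apply one_minus_neq_0 in K2.
assert (Hk := small_regular_k p _ _ _ _ (proj1 Hg) Hs (2 * N)%nat).
destruct Hg as (Hp & Hmu & _); assert (Hq := Cmod_sq_lt_1 _ Hp).
destruct HJ as (Hpp & Hqq & _ & Ha & _).
assert (E1 := half_left_shift kap (p ^ 2) b N r Hq).
assert (E2 := half_left_shift kap (p ^ 2) be N r Hq).
set (q := p ^ 2) in *; set (A := b * q ^ N) in *; set (B := be * q ^ N) in *.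
assert (HAB : A * B = mu ^ 2 * q ^ (2 * N)).
{ unfold A, B; rewrite Cpow_double, <- Hb; ring. }
assert (L1 : kap * A * B = mu ^ 2 * kap * q ^ (2 * N)).
{ transitivity (kap * (A * B)); [ring | rewrite HAB; ring]. }
assert (L2 : kap ^ 2 * A * B * q = mu ^ 2 * kap ^ 2 * q * q ^ (2 * N)).
{ transitivity (kap ^ 2 * (A * B) * q); [ring | rewrite HAB; ring]. }
assert (L3 : A * B * q = mu ^ 2 * q * q ^ (2 * N)) by (rewrite HAB; ring).
assert (V := vwp_factor_spec (kap * A * B) q r).
rewrite <- L1 in Hk.
assert (N1 := qpoch_neq_0 _ _ r R1).
assert (N2 := qpoch_neq_0 _ _ r R2).
assert (N3 := qpoch_neq_0 _ _ r R3).
assert (N4 := qpoch_neq_0 _ _ r R4).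
assert (N5 := qpoch_neq_0 _ _ r Hqq).
assert (N6 := qpoch_neq_0 _ _ (2 * N) Ha).
assert (N7 := qpoch_neq_0 _ _ N Hpp).
assert (N8 := qpoch_neq_0 _ _ N Hmu).
assert (N9 := qpoch_neq_0 _ _ N Rm).
apply Cdiv_unique in V; [|exact Hk].
rewrite Cmult_comm in E1, E2.
apply Cdiv_unique in E1; [|exact N1].
apply Cdiv_unique in E2; [|exact N2].
unfold cross_term, cross_weight, jackson_term, watson_term.
fold q; rewrite V, E1, E2, !Nat.add_0_r.
rewrite (qpoch_add (mu ^ 2 * kap) q (2 * N) r),
  (qpoch_add (mu ^ 2 * kap ^ 2 * q) q (2 * N) r),
  (qpoch_add (mu ^ 2 * kap ^ 2 * q) (q ^ 2) N r),
  (qpoch_add (mu ^ 2 * q) (q ^ 2) N r).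
replace ((q ^ 2) ^ N) with (q ^ (2 * N)) by (rewrite Cpow_pow2, Cpow_double; ring).
rewrite <- L1, <- L2, <- L3.
replace (mu ^ 2 * kap * q ^ (2 * (N + r))) with (kap * A * B * q ^ (2 * r)).
2: { rewrite L1, Nat.mul_add_distr_l, Cpow_add_r; ring. }
change (qpoch_inv kap q 0) with (RtoC 1); change (qpoch q q 0) with (RtoC 1).
clear V E1 E2 R1 R2 R3 R4 Rm Ha Hqq L1 L2 L3.
generalize dependent (q ^ (2 * r)); intros Qr.
set (hl := half_left kap q b N); set (hl' := half_left kap q be N).
abstract_qpoch.
field; nonzero.
Qed.

Lemma row_value (p mu b be : C) (m N : nat) :
  admissible p mu -> b * be = mu ^ 2 -> small mu b be ((p ^ 2) ^ m) ->
  csum (cross_term p mu b be ((p ^ 2) ^ m) N) (S m)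
  = right_term p mu b be N ((p ^ 2) ^ m).
Proof.
intros Hg Hb Hs.
assert (HW := cross_watson_regular p mu b be _ N Hg Hb Hs).
assert (Hp := proj1 Hg); assert (Hq := Cmod_sq_lt_1 _ Hp).
assert (Hq2 := Cmod_sq_lt_1 _ Hq).
assert (Ev := watson_sum_value _ _ _ m Hq HW).
rewrite (csum_ext _ (fun r => cross_term p mu b be ((p ^ 2) ^ m) N 0
    * watson_term ((p ^ 2) ^ m) (p ^ 2) (b * (p ^ 2) ^ N) (be * (p ^ 2) ^ N) r))
  by (intros; now apply cross_term_watson).
rewrite csum_scal.
fold (watson_sum ((p ^ 2) ^ m) (p ^ 2) m (b * (p ^ 2) ^ N) (be * (p ^ 2) ^ N)).
destruct HW as (R1 & R2 & R3 & R4).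
assert (HJ := small_jackson_regular _ _ _ _ _ Hg Hs).
assert (Rm := generic_sq_regular _ _ Hg).
destruct (small_lt_1 _ _ _ _ Hs) as (K0 & K1 & K2 & _).
assert (Rk := regular_lt_1 (mu ^ 2 * (p ^ 2) ^ m * p ^ 2) (p ^ 2) Hq
  ltac:(apply Cmod_mul_lt_1; lra)).
apply one_minus_neq_0 in K1; apply one_minus_neq_0 in K2.
destruct Hg as (_ & Hmu & _).
destruct HJ as (Hpp & Hqq & _ & Ha & _).
set (kap := (p ^ 2) ^ m) in *.
set (W := watson_sum _ _ _ _ _) in *.
set (q := p ^ 2) in *; set (A := b * q ^ N) in *; set (B := be * q ^ N) in *.
assert (HAB : A * B = mu ^ 2 * q ^ (2 * N)).
{ unfold A, B; rewrite Cpow_double, <- Hb; ring. }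
assert (EqN : (q ^ 2) ^ N = q ^ (2 * N)) by (rewrite Cpow_pow2, Cpow_double; ring).
assert (L1 : kap * A * B = mu ^ 2 * kap * q ^ (2 * N)).
{ transitivity (kap * (A * B)); [ring | rewrite HAB; ring]. }
assert (D1 : qpoch_inf (A * B * q) (q ^ 2) <> 0) by now apply qpoch_inf_neq_0.
assert (D2 : qpoch_inf (kap ^ 2 * A * B * q ^ 2) (q ^ 2) <> 0).
{ apply qpoch_inf_neq_0; [exact Hq2|].
  apply regular_bisect in R3; destruct R3 as [_ R3].
  now replace (kap ^ 2 * A * B * q ^ 2) with (kap ^ 2 * A * B * q * q) by ring. }
assert (D3 : qpoch_inf (A * kap * q) q <> 0) by now apply qpoch_inf_neq_0.
assert (D4 : qpoch_inf (B * kap * q) q <> 0) by now apply qpoch_inf_neq_0.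
assert (D5 : qpoch_inf q (q ^ 2) <> 0).
{ apply qpoch_inf_neq_0; [exact Hq2 | now apply regular_lt_1]. }
assert (D6 : qpoch_inf (q ^ 2 * kap ^ 2) (q ^ 2) <> 0).
{ apply qpoch_inf_neq_0; [exact Hq2|]; apply regular_lt_1; [exact Hq2|].
  apply Cmod_mul_lt_1; [exact Hq2 | apply Cmod_pow_le_1_weak; lra]. }
assert (Ia := qpoch_inf_split (mu ^ 2 * q) (q ^ 2) N Hq2).
replace (mu ^ 2 * q * (q ^ 2) ^ N) with (A * B * q) in Ia
  by (rewrite HAB, EqN; ring).
assert (Ib := qpoch_inf_split ((q * mu * kap) ^ 2) (q ^ 2) N Hq2).
replace ((q * mu * kap) ^ 2 * (q ^ 2) ^ N) with (kap ^ 2 * A * B * q ^ 2) in Ib.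
2: { transitivity (kap ^ 2 * (A * B) * q ^ 2); [ring | rewrite HAB, EqN; ring]. }
assert (Ib2 := qpoch_bisect (mu ^ 2 * kap ^ 2 * q) q N).
replace (mu ^ 2 * kap ^ 2 * q * q) with ((q * mu * kap) ^ 2) in Ib2 by ring.
assert (Ic1 := qpoch_inf_split (mu ^ 2 * kap) q 1 Hq).
assert (Ic2 := qpoch_inf_split (mu ^ 2 * kap) q (2 * N) Hq).
rewrite <- L1 in Ic2.
rewrite (qpoch_inf_split (kap * A * B) q 1 Hq) in Ic2.
rewrite Ic1 in Ic2; clear Ic1.
change (qpoch (mu ^ 2 * kap) q 1) with (1 * (1 - mu ^ 2 * kap * 1)) in Ic2.
change (qpoch (kap * A * B) q 1) with (1 * (1 - kap * A * B * 1)) in Ic2.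
rewrite Cpow_1_r in Ic2.
assert (V := vwp_factor_spec (mu * kap) p N).
rewrite Cpow_double in V.
assert (N6 := qpoch_neq_0 _ _ (2 * N) Ha).
rewrite Ib2 in N6.
assert (N7 := qpoch_neq_0 _ _ N Hpp).
assert (N8 := qpoch_neq_0 _ _ N Hmu).
assert (N9 := qpoch_neq_0 _ _ N Rm).
rewrite Cmult_comm in Ev; apply Cdiv_unique in Ev; [|nonzero].
apply Cdiv_unique in V; [|exact K1].
assert (Ic : qpoch_inf (mu ^ 2 * q * kap) q
  = qpoch (mu ^ 2 * kap) q (2 * N) * (1 - kap * A * B)
    * qpoch_inf (kap * A * B * q) q / (1 - mu ^ 2 * kap)).
{ apply Cdiv_unique; [exact K2|].
  replace (mu ^ 2 * q * kap) with (mu ^ 2 * kap * q) by ring.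
  transitivity (1 * (1 - mu ^ 2 * kap * 1) * qpoch_inf (mu ^ 2 * kap * q) q); [ring|].
  rewrite Ic2; ring. }
unfold cross_term, cross_weight, jackson_term, right_term, right_coef,
  half_left, half_right.
fold q; rewrite !Nat.add_0_r, Ev, V, Ia, Ib, Ib2, Ic, <- L1.
change (qpoch_inv kap q 0) with (RtoC 1); change (qpoch q q 0) with (RtoC 1).
rewrite !(Cpow_S q (S N)), !(Cpow_S q N).
replace (b * (q * q ^ N) * kap) with (A * kap * q) by (unfold A; ring).
replace (be * (q * q ^ N) * kap) with (B * kap * q) by (unfold B; ring).
replace (b * (q * (q * q ^ N)) * kap ^ 2) with (A * kap ^ 2 * q ^ 2)
  by (unfold A; ring).
replace (be * (q * (q * q ^ N)) * kap ^ 2) with (B * kap ^ 2 * q ^ 2)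
  by (unfold B; ring).
replace (b * (q * q ^ N)) with (A * q) by (unfold A; ring).
replace (be * (q * q ^ N)) with (B * q) by (unfold B; ring).
replace (q * kap) with (kap * q) by ring.
replace (p * kap) with (kap * p) by ring.
clear - D1 D2 D3 D4 D5 D6 N6 N7 N8 N9 K1 K2.
generalize dependent (qpoch_inf q (q ^ 2)); intros P1 D5.
generalize dependent (qpoch_inf (q ^ 2 * kap ^ 2) (q ^ 2)); intros P2 D6.
generalize dependent (qpoch_inf (A * B * q) (q ^ 2)); intros P3 D1.
generalize dependent (qpoch_inf (kap ^ 2 * A * B * q ^ 2) (q ^ 2)); intros P4 D2.
generalize dependent (qpoch_inf (A * kap * q) q); intros P5 D3.
generalize dependent (qpoch_inf (B * kap * q) q); intros P6 D4.
apply Cmult_neq_0_inv in N6; destruct N6.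
abstract_qpoch.
field; nonzero.
Qed.

(** * Interchange and continuation in kap *)

Lemma bounded_factor (c q : C) (f : nat -> nat) : (Cmod q < 1)%R ->
  bounded_seq (fun n => 1 - c * q ^ f n).
Proof.
intros Hq; exists (1 + Cmod c)%R; intros n.
replace (1 - c * q ^ f n) with (1 + - (c * q ^ f n)) by ring.
eapply Rle_trans; [apply Cmod_triangle|].
rewrite Cmod_1, Cmod_opp, Cmod_mult.
generalize (Cmod_pow_le_1 q (f n) Hq) (Cmod_ge_0 c); nra.
Qed.

Lemma bounded_half_left (kap q b : C) : (Cmod q < 1)%R -> (Cmod kap <= 1)%R ->
  bounded_seq (half_left kap q b).
Proof.
intros Hq Hk; destruct (uniform_multiplier_half_left 1 q b ltac:(lra) Hq) as [K HK].
exists K; intros n.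
exact (Wiener_bound 1 _ _ kap (multiplier_Wiener _ _ _ (HK n)) Hk).
Qed.

Lemma cross_weight_bounded (p mu b be kap : C) : admissible p mu ->
  small mu b be kap -> bounded_seq (cross_weight p mu b be kap).
Proof.
intros Hg Hs; assert (Rm := generic_sq_regular _ _ Hg).
destruct (small_lt_1 _ _ _ _ Hs) as (K0 & _).
destruct Hg as (Hp & _); assert (Hq := Cmod_sq_lt_1 _ Hp).
assert (Hq2 := Cmod_sq_lt_1 _ Hq).
unfold cross_weight, Cdiv.
apply bounded_mul; [|apply bounded_const].
apply bounded_mul; [apply bounded_mul; [apply bounded_const|]|].
- apply bounded_mul; apply bounded_half_left; auto; lra.
- apply bounded_mul; [apply bounded_mul|].
  + apply (bounded_factor _ _ (fun n => (2 * n)%nat)); exact Hq.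
  + now apply bounded_qpoch.
  + now apply bounded_inv_qpoch.
Qed.

(** All factors of the array are bounded except p^N, which gives the decay in
    N, and the terminating factor. *)
Lemma cross_term_bound (p mu b be kap : C) : admissible p mu ->
  small mu b be kap ->
  exists K, (0 <= K)%R /\ forall N r, (Cmod (cross_term p mu b be kap N r)
    <= K * Cmod p ^ N * Cmod (qpoch_inv kap (p ^ 2) r))%R.
Proof.
intros Hg Hs.
destruct (cross_weight_bounded _ _ _ _ _ Hg Hs) as [K1 H1].
assert (HJ := small_jackson_regular _ _ _ _ _ Hg Hs).
destruct HJ as (Rp & Rq & Rmu & Ra & _).
destruct Hg as (Hp & _); assert (Hq := Cmod_sq_lt_1 _ Hp).
destruct (bounded_mul _ _ (bounded_qpoch (mu ^ 2 * kap) _ Hq)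
  (bounded_inv_qpoch _ _ Hq Ra)) as [K2 H2].
destruct (bounded_inv_qpoch _ _ Hq Rq) as [K3 H3].
assert (B4 : bounded_seq (fun N => (1 - mu * kap * p ^ (2 * N)) * qpoch (mu * kap) p N
  * qpoch (kap * p) p N * (/ qpoch p p N * / qpoch mu p N))).
{ repeat apply bounded_mul.
  - apply (bounded_factor _ _ (fun n => (2 * n)%nat)); exact Hp.
  - now apply bounded_qpoch.
  - now apply bounded_qpoch.
  - now apply bounded_inv_qpoch.
  - now apply bounded_inv_qpoch. }
destruct B4 as [K4 H4].
assert (G1 := Rle_trans _ _ _ (Cmod_ge_0 _) (H1 0%nat)).
assert (G2 := Rle_trans _ _ _ (Cmod_ge_0 _) (H2 0%nat)).
assert (G3 := Rle_trans _ _ _ (Cmod_ge_0 _) (H3 0%nat)).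
assert (G4 := Rle_trans _ _ _ (Cmod_ge_0 _) (H4 0%nat)).
exists (K1 * K2 * K3 * K4)%R.
split; [repeat apply Rmult_le_pos; assumption|].
intros N r.
replace (cross_term p mu b be kap N r) with
  (cross_weight p mu b be kap (N + r)
   * (qpoch (mu ^ 2 * kap) (p ^ 2) (2 * N + r)
      * / qpoch (mu ^ 2 * kap ^ 2 * p ^ 2) (p ^ 2) (2 * N + r))
   * / qpoch (p ^ 2) (p ^ 2) r
   * ((1 - mu * kap * p ^ (2 * N)) * qpoch (mu * kap) p N
      * qpoch (kap * p) p N * (/ qpoch p p N * / qpoch mu p N))
   * (- p) ^ N * qpoch_inv kap (p ^ 2) r).
2: { unfold cross_term, jackson_term; rewrite Cpow_double.
     field; repeat split; apply qpoch_neq_0; assumption. }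
rewrite (Cmod_mult _ (qpoch_inv _ _ _)), (Cmod_mult _ ((- p) ^ N)), Cmod_pow, Cmod_opp.
apply Rmult_le_compat_r; [apply Cmod_ge_0|].
apply Rmult_le_compat_r; [apply pow_le, Cmod_ge_0|].
rewrite (Cmod_mult _ (_ * _ * _ * _)), (Cmod_mult _ (/ _)),
  (Cmod_mult (cross_weight _ _ _ _ _ _)).
apply Rmult_le_compat; [| apply Cmod_ge_0 | | apply H4].
{ repeat apply Rmult_le_pos; apply Cmod_ge_0. }
apply Rmult_le_compat; [| apply Cmod_ge_0 | | apply H3].
{ apply Rmult_le_pos; apply Cmod_ge_0. }
apply Rmult_le_compat; [apply Cmod_ge_0 | apply Cmod_ge_0 | apply H1 | apply H2].
Qed.

(** Placing the N-th row of the array at the positions n = N, N + 1, ... turns the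
    sums with N + r fixed into column sums. *)
Definition delay {T : Type} (zero : T) (N : nat) (u : nat -> T) (n : nat) : T :=
  if Nat.leb N n then u (n - N)%nat else zero.

Lemma csum_delay (u : nat -> C) (N M : nat) :
  csum (delay (RtoC 0) N u) M = csum u (M - N).
Proof.
induction M as [|M IH]; [reflexivity|].
simpl csum at 1; rewrite IH; unfold delay.
destruct (Nat.leb_spec N M).
- replace (S M - N)%nat with (S (M - N)) by lia; reflexivity.
- replace (M - N)%nat with 0%nat by lia; replace (S M - N)%nat with 0%nat by lia.
  simpl; ring.
Qed.

Lemma rsum_delay (u : nat -> C) (N M : nat) :
  rsum (fun n => Cmod (delay (RtoC 0) N u n)) M
  = rsum (fun n => Cmod (u n)) (M - N).
Proof.
induction M as [|M IH]; [reflexivity|].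
simpl rsum at 1; rewrite IH; unfold delay.
destruct (Nat.leb_spec N M).
- replace (S M - N)%nat with (S (M - N)) by lia; reflexivity.
- replace (M - N)%nat with 0%nat by lia; replace (S M - N)%nat with 0%nat by lia.
  rewrite Cmod_0; simpl; ring.
Qed.

Lemma csum_vanish (u : nat -> C) (m n : nat) :
  (forall i, (m <= i)%nat -> u i = 0) -> (m <= n)%nat -> csum u n = csum u m.
Proof.
intros H Hn; replace n with (m + (n - m))%nat by lia.
rewrite csum_add, (csum_0 (fun i => u (m + i)%nat)); [ring|].
intros; apply H; lia.
Qed.

Lemma rsum_vanish_le (u : nat -> R) (m n : nat) :
  (forall i, (0 <= u i)%R) -> (forall i, (m <= i)%nat -> u i = 0%R) ->
  (rsum u n <= rsum u m)%R.
Proof.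
intros H0 H; induction n as [|n IH]; simpl; [now apply rsum_nonneg|].
destruct (Nat.le_gt_cases m n) as [Hmn|Hmn].
- rewrite (H n Hmn); lra.
- replace m with (S n + (m - S n))%nat by lia; rewrite rsum_add; simpl.
  generalize (rsum_nonneg (fun i => u (S (n + i))) (m - S n) (fun i => H0 _)); lra.
Qed.

(** For kap = q^m the rows are finite, so no convergence condition on kap arises in
    Watson's sum and double_sum applies. *)
Lemma quadratic_transformation_q_pow (p mu b be : C) (m : nat) (l l' : C) :
  admissible p mu -> b * be = mu ^ 2 -> small mu b be ((p ^ 2) ^ m) ->
  sums (fun n => left_term p mu b be n ((p ^ 2) ^ m)) l ->
  sums (fun N => right_term p mu b be N ((p ^ 2) ^ m)) l' ->
  l = l'.
Proof.
intros Hg Hb Hs Hl Hl'.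
destruct (cross_term_bound _ _ _ _ _ Hg Hs) as (K & HK0 & HK).
assert (Hp := proj1 Hg).
set (kap := (p ^ 2) ^ m) in *.
set (y := fun r => Cmod (qpoch_inv kap (p ^ 2) r)).
assert (Hy : forall i, (S m <= i)%nat -> qpoch_inv kap (p ^ 2) i = 0)
  by (intros i Hi; apply qpoch_inv_vanish; lia).
set (Y := rsum y (S m)).
assert (HY : (0 <= Y)%R) by (apply rsum_nonneg; intros; apply Cmod_ge_0).
assert (Hv : forall N i, (S m <= i)%nat -> cross_term p mu b be kap N i = 0).
{ intros N i Hi; unfold cross_term, jackson_term; rewrite Hy by exact Hi.
  unfold Cdiv; ring. }
destruct (double_sum
  (fun N => delay (RtoC 0) N (cross_term p mu b be kap N))
  (fun N => K * Y * Cmod p ^ N)%R (K * Y * / (1 - Cmod p))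
  (fun N => right_term p mu b be N kap)) as (c & F & Hc & _ & HcF & HF).
- intros N M; rewrite rsum_delay.
  apply Rle_trans with (rsum (fun r => K * Cmod p ^ N * y r)%R (M - N)).
  + apply rsum_le; intros i _; apply HK.
  + rewrite rsum_scal.
    replace (K * Y * Cmod p ^ N)%R with (K * Cmod p ^ N * Y)%R by ring.
    apply Rmult_le_compat_l;
      [apply Rmult_le_pos; [exact HK0 | apply pow_le, Cmod_ge_0]|].
    apply rsum_vanish_le; [intros; apply Cmod_ge_0|].
    intros i Hi; unfold y; rewrite Hy by exact Hi; apply Cmod_0.
- intros n; apply rsum_geom_scal; [now apply Rmult_le_pos|].
  split; [apply Cmod_ge_0 | exact Hp].
- intros N; assert (E := row_value p mu b be m N Hg Hb Hs); fold kap in E.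
  rewrite <- E.
  apply (tends_ext_ev
    (fun _ => csum (cross_term p mu b be kap N) (S m)) _ _ (N + S m));
    [|apply tends_const].
  intros M HM; rewrite csum_delay; symmetry; apply csum_vanish; [apply Hv | lia].
- rewrite (tends_unique _ _ _ Hl' HF).
  apply (tends_unique _ _ _ Hl).
  revert HcF; apply sums_ext; intros n.
  apply (tends_unique _ _ _ (Hc n)).
  rewrite <- column_value by assumption.
  apply (tends_ext_ev
    (fun _ => csum (fun N => cross_term p mu b be kap N (n - N)) (S n)) _ _ (S n));
    [|apply tends_const].
  intros M HM; symmetry; rewrite (csum_vanish _ (S n) M); [| | exact HM].
  + apply csum_ext; intros i Hi; unfold delay.
    destruct (Nat.leb_spec i n); [reflexivity | lia].
  + intros i Hi; unfold delay; destruct (Nat.leb_spec i n); [lia | reflexivity].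
Qed.

Lemma small_eventually (p mu b be : C) : (Cmod p < 1)%R ->
  exists m0, forall m, (m0 <= m)%nat -> small mu b be ((p ^ 2) ^ m).
Proof.
intros Hp; assert (Hq := Cmod_sq_lt_1 _ Hp); unfold small.
set (L := (1 + Cmod mu + Cmod mu * Cmod mu + Cmod b + Cmod be)%R).
assert (HL : (0 < L)%R).
{ generalize (Cmod_ge_0 mu) (Cmod_ge_0 b) (Cmod_ge_0 be); unfold L; nra. }
destruct (tends_Cpow_0 _ Hq (/ L)%R) as [m0 H]; [now apply Rinv_0_lt_compat|].
exists m0; intros m Hm; specialize (H m Hm).
replace ((p ^ 2) ^ m - 0) with ((p ^ 2) ^ m) in H by ring.
apply (Rmult_lt_compat_r L) in H; [|exact HL].
now rewrite Rinv_l in H by lra.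
Qed.

(** Both sides are power series in kap converging on every disc and agree at
    kap = q^m for all large m; these points accumulate at 0. *)
Theorem quadratic_transformation (p mu b be kap : C) (l l' : C) :
  p <> 0 -> admissible p mu -> b * be = mu ^ 2 ->
  sums (fun n => left_term p mu b be n kap) l ->
  sums (fun N => right_term p mu b be N kap) l' ->
  l = l'.
Proof.
intros Hp0 Hg Hb Hl Hl'; assert (Hp := proj1 Hg).
assert (Hq := Cmod_sq_lt_1 _ Hp).
set (r := (1 + Cmod kap)%R).
assert (Hr : (0 < r)%R) by (generalize (Cmod_ge_0 kap); unfold r; lra).
destruct (left_term_multiplier r p mu b be Hr Hg) as [K HK].
destruct (right_term_multiplier r p mu b be Hr Hg) as [L HL].
destruct (geometric_family r p _ K Hr Hp HK) as [S1 P1].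
destruct (geometric_family r p _ L Hr Hp HL) as [S2 P2].
destruct (small_eventually p mu b be Hp) as [m0 Hm0].
assert (P := Wiener_add r _ _ _ _ (Rlt_le _ _ Hr) P1 (Wiener_scal r (- (1)) _ _ P2)).
assert (Z : forall i, (Cmod ((p ^ 2) ^ (m0 + i)) <= r)%R).
{ intros i; eapply Rle_trans; [now apply Cmod_pow_le_1|].
  unfold r; generalize (Cmod_ge_0 kap); lra. }
assert (Hk : (Cmod kap <= r)%R) by (unfold r; lra).
assert (E := Wiener_identity r _ _ (fun i => (p ^ 2) ^ (m0 + i)) kap Hr P).
cbv beta in E.
rewrite <- (CSeries_sums _ _ Hl), <- (CSeries_sums _ _ Hl').
set (u := CSeries _) in E |- *; set (v := CSeries _) in E |- *.
assert (E' : u + - (1) * v = 0).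
{ apply E; auto.
  - apply (tends_subseq _ _ (fun i => (m0 + i)%nat)); [lia | now apply tends_Cpow_0].
  - intros i; now apply Cpow_nz, Cpow_nz.
  - intros i.
    rewrite (quadratic_transformation_q_pow p mu b be (m0 + i) _ _ Hg Hb
      (Hm0 _ (Nat.le_add_r _ _)) (S1 _ (Z i)) (S2 _ (Z i))).
    ring. }
replace u with (u + - (1) * v + v) by ring; rewrite E'; ring.
Qed.

(** * Back to the very-well-poised series *)

Lemma sums_interleave (u : nat -> C) (l l' : C) :
  sums (fun n => u (2 * n)%nat) l -> sums (fun n => u (S (2 * n))) l' ->
  sums u (l + l').
Proof.
intros H H'.
assert (E : forall n, csum u (2 * n)
  = csum (fun n => u (2 * n)%nat) n + csum (fun n => u (S (2 * n))) n).
{ induction n as [|n IH]; [simpl; ring|].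
  replace (2 * S n)%nat with (S (S (2 * n))) by lia.
  cbn [csum]; rewrite IH; ring. }
assert (T0 := tends_plus _ _ _ _ H H').
assert (T1 := tends_plus _ _ _ _
  (tends_subseq _ _ S (fun n => Nat.le_succ_diag_r n) H) H').
intros e He; destruct (T0 e He) as [N0 H0]; destruct (T1 e He) as [N1 H1].
exists (2 * (N0 + N1))%nat; intros n Hn.
destruct (Nat.Even_or_Odd n) as [[i ->]|[i ->]].
- rewrite E; apply H0; lia.
- rewrite Nat.add_1_r; cbn [csum]; rewrite E.
  specialize (H1 i ltac:(lia)); cbn [csum] in H1.
  match type of H1 with (Cmod ?x < _)%R =>
    match goal with |- (Cmod ?y < _)%R => replace y with x by ring; exact H1 end
  end.
Qed.

Lemma qpochs_no_zero_factor_regular (xs : list C) (q x : C) :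
  qpochs_no_zero_factor xs q -> In x xs -> regular x q.
Proof. intros H Hx j; now apply H. Qed.

(** The square roots in the very-well-poised part disappear: (q s, - q s;q)_n over
    (s, - s;q)_n equals (1 - s^2 q^(2n)) / (1 - s^2). *)
Lemma vwp_term_factor (a1 s : C) (l : list C) (q x : C) (n : nat) :
  s ^ 2 = a1 -> vwp_den_nonzero a1 s l q ->
  vwp_term a1 s l q x n
  = vwp_factor a1 q n * qpochs l q n
    / (qpoch q q n * qpochs (map (fun c => a1 * q / c) l) q n) * x ^ n.
Proof.
intros Hs Hd.
assert (Rs : regular s q)
  by (apply (qpochs_no_zero_factor_regular _ _ _ Hd); simpl; auto).
assert (Rs' : regular (- s) q)
  by (apply (qpochs_no_zero_factor_regular _ _ _ Hd); simpl; auto).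
assert (Rq : regular q q)
  by (apply (qpochs_no_zero_factor_regular _ _ _ Hd); simpl; auto).
assert (N0 : qpochs (map (fun c => a1 * q / c) l) q n <> 0).
{ assert (HR : forall y, In y (map (fun c => a1 * q / c) l) -> regular y q).
  { intros y Hy; apply (qpochs_no_zero_factor_regular _ _ _ Hd); simpl; auto. }
  induction (map (fun c => a1 * q / c) l) as [|y ys IH]; simpl; [exact C1_nz|].
  apply Cmult_neq_0.
  - apply qpoch_neq_0, HR; simpl; auto.
  - apply IH; intros z Hz; apply HR; simpl; auto. }
unfold vwp_term, vwp_num, vwp_den.
change (qpochs (a1 :: q * s :: - (q * s) :: l) q n) with
  (qpoch a1 q n * (qpoch (q * s) q n * (qpoch (- (q * s)) q n * qpochs l q n))).
change (qpochs (q :: s :: - s :: map (fun c => a1 * q / c) l) q n) with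
  (qpoch q q n * (qpoch s q n * (qpoch (- s) q n
     * qpochs (map (fun c => a1 * q / c) l) q n))).
assert (E1 := qpoch_Sl s q n); rewrite qpoch_S in E1.
assert (E2 := qpoch_Sl (- s) q n); rewrite qpoch_S in E2.
replace (s * q) with (q * s) in E1 by ring.
replace (- s * q) with (- (q * s)) in E2 by ring.
assert (V := vwp_factor_spec a1 q n); rewrite Cpow_double in V.
assert (N1 := regular_0 _ _ Rs); assert (N2 := regular_0 _ _ Rs').
assert (N3 : 1 - a1 <> 0).
{ rewrite <- Hs; replace (1 - s ^ 2) with ((1 - s) * (1 - - s)) by ring.
  now apply Cmult_neq_0. }
assert (N4 := qpoch_neq_0 _ _ n Rs); assert (N5 := qpoch_neq_0 _ _ n Rs').
assert (N6 := qpoch_neq_0 _ _ n Rq).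
symmetry in E1; apply Cdiv_unique in E1; [|exact N1].
symmetry in E2; apply Cdiv_unique in E2; [|exact N2].
apply Cdiv_unique in V; [|exact N3].
rewrite V, E1, E2.
set (X := q ^ n); clear - N0 N1 N2 N3 N4 N5 N6 Hs; subst a1.
generalize dependent (qpochs (map (fun c => s ^ 2 * q / c) l) q n); intros Pd N0.
generalize (qpochs l q n) as Pl; intros Pl.
abstract_qpoch.
field; nonzero.
Qed.

Lemma half_right_even (kap q b : C) (n : nat) : (Cmod q < 1)%R ->
  regular (b * q ^ 2 * kap ^ 2) (q ^ 2) ->
  half_right kap q b (2 * n)
  = qpoch_inf (b * q) (q ^ 2) * qpoch_inf (b * q ^ 2 * kap ^ 2) (q ^ 2)
    * (qpoch b (q ^ 2) n / qpoch (b * q ^ 2 * kap ^ 2) (q ^ 2) n).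
Proof.
intros Hq HR; assert (Hq2 := Cmod_sq_lt_1 _ Hq).
unfold half_right.
rewrite qpoch_bisect, (qpoch_inf_split (b * q) (q ^ 2) n Hq2),
  (qpoch_inf_split (b * q ^ 2 * kap ^ 2) (q ^ 2) n Hq2).
replace (b * q * (q ^ 2) ^ n) with (b * q ^ S (2 * n))
  by (rewrite (Cpow_S q (2 * n)), Cpow_pow2, Cpow_double; ring).
replace (b * q ^ 2 * kap ^ 2 * (q ^ 2) ^ n) with (b * q ^ S (S (2 * n)) * kap ^ 2)
  by (rewrite (Cpow_S q (S (2 * n))), (Cpow_S q (2 * n)), Cpow_pow2, Cpow_double; ring).
field; now apply qpoch_neq_0.
Qed.

Lemma half_right_odd (kap q b : C) (n : nat) : (Cmod q < 1)%R ->
  regular (b * q ^ 3 * kap ^ 2) (q ^ 2) ->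
  half_right kap q b (S (2 * n))
  = qpoch_inf b (q ^ 2) * qpoch_inf (b * q ^ 3 * kap ^ 2) (q ^ 2)
    * (qpoch (b * q) (q ^ 2) n / qpoch (b * q ^ 3 * kap ^ 2) (q ^ 2) n).
Proof.
intros Hq HR; assert (Hq2 := Cmod_sq_lt_1 _ Hq).
unfold half_right.
rewrite qpoch_bisect_S, (qpoch_inf_split b (q ^ 2) (S n) Hq2),
  (qpoch_inf_split (b * q ^ 3 * kap ^ 2) (q ^ 2) n Hq2).
replace (b * (q ^ 2) ^ S n) with (b * q ^ S (S (2 * n)))
  by (rewrite (Cpow_S q (S (2 * n))), (Cpow_S q (2 * n)), (Cpow_S (q ^ 2) n),
        Cpow_pow2, Cpow_double; ring).
replace (b * q ^ 3 * kap ^ 2 * (q ^ 2) ^ n)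
  with (b * q ^ S (S (S (2 * n))) * kap ^ 2)
  by (rewrite (Cpow_S q (S (S (2 * n)))), (Cpow_S q (S (2 * n))),
        (Cpow_S q (2 * n)), Cpow_pow2, Cpow_double; ring).
field; now apply qpoch_neq_0.
Qed.

Lemma vwp_factor_even (x p : C) (n : nat) : 1 - x <> 0 ->
  vwp_factor x p (2 * n) = vwp_factor x (p ^ 2) n * qpoch (x * p) (p ^ 2) n.
Proof.
intros Hx.
assert (V1 := vwp_factor_spec x p (2 * n)); assert (V2 := vwp_factor_spec x (p ^ 2) n).
apply Cdiv_unique in V1; [|exact Hx].
apply Cdiv_unique in V2; [|exact Hx].
rewrite V1, V2, qpoch_bisect, (Cpow_mult_r p 2 (2 * n)); field; exact Hx.
Qed.

Lemma vwp_factor_odd (x p : C) (n : nat) :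
  vwp_factor x p (S (2 * n))
  = (1 - p ^ 2 * x) * vwp_factor (p ^ 2 * x) (p ^ 2) n * qpoch (x * p) (p ^ 2) n.
Proof.
rewrite vwp_factor_spec; unfold vwp_factor.
rewrite qpoch_bisect.
replace (x * p * p) with (p ^ 2 * x) by ring.
replace (p ^ (2 * S (2 * n))) with (p ^ 2 * (p ^ 2) ^ (2 * n)).
- ring.
- rewrite <- Cpow_mult_r, <- Cpow_add_r; f_equal; lia.
Qed.

Lemma qpochs_cons (x : C) (xs : list C) (q : C) (n : nat) :
  qpochs (x :: xs) q n = qpoch x q n * qpochs xs q n.
Proof. reflexivity. Qed.

Lemma qpochs_pair (x : C) (xs : list C) (q : C) (n : nat) :
  qpochs (x :: - x :: xs) q n = qpoch (x ^ 2) (q ^ 2) n * qpochs xs q n.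
Proof. rewrite !qpochs_cons, <- qpoch_mul_opp; ring. Qed.

Lemma regular_sq (x q : C) : regular x q -> regular (- x) q ->
  regular (x ^ 2) (q ^ 2).
Proof.
intros H1 H2 j.
rewrite Cpow_pow2.
replace (1 - x ^ 2 * (q ^ j) ^ 2) with ((1 - x * q ^ j) * (1 - - x * q ^ j)) by ring.
apply Cmult_neq_0; auto.
Qed.

Lemma one_minus_sq_neq_0 (x q : C) : regular x q -> regular (- x) q ->
  1 - x ^ 2 <> 0.
Proof. intros H1 H2; exact (regular_0 _ _ (regular_sq _ _ H1 H2)). Qed.

Ltac in_den H := apply (qpochs_no_zero_factor_regular _ _ _ H); simpl; tauto.

(** The even terms are those of the first series on the right: in base p,
    (x;p)_(2n) = (x, x p;q)_n. *)
Lemma right_term_even (p mu b be kap ra c1 c2 c3 c4 : C) (n : nat) :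
  admissible p mu -> p <> 0 -> mu <> 0 -> kap <> 0 -> b <> 0 ->
  b * be = mu ^ 2 ->
  c1 ^ 2 = be -> c2 = - c1 -> c3 ^ 2 = b -> c4 = - c3 ->
  ra ^ 2 = mu * kap ->
  vwp_den_nonzero (mu * kap) ra
    [c1; c2; c3; c4; mu * kap * p; kap * p; kap * p ^ 2] (p ^ 2) ->
  right_term p mu b be (2 * n) kap
  = qpoch_inf (mu ^ 2 * p ^ 2 * kap) (p ^ 2) * qpoch_inf (p ^ 2 * kap) (p ^ 2)
    * (qpoch_inf (b * p ^ 2) ((p ^ 2) ^ 2)
       * qpoch_inf (b * (p ^ 2) ^ 2 * kap ^ 2) ((p ^ 2) ^ 2)
       * qpoch_inf (be * p ^ 2) ((p ^ 2) ^ 2)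
       * qpoch_inf (be * (p ^ 2) ^ 2 * kap ^ 2) ((p ^ 2) ^ 2))
    * vwp_term (mu * kap) ra
        [c1; c2; c3; c4; mu * kap * p; kap * p; kap * p ^ 2] (p ^ 2) (p ^ 2) n.
Proof.
intros Hg Hp0 Hmu0 Hk0 Hb0 Hb Hc1 Hc2 Hc3 Hc4 Hra Hd.
assert (Hbe0 : be <> 0).
{ intros E; apply (Cpow_nz mu 2 Hmu0); rewrite <- Hb, E; ring. }
assert (Hc10 : c1 <> 0) by (intros E; apply Hbe0; rewrite <- Hc1, E; ring).
assert (Hc30 : c3 <> 0) by (intros E; apply Hb0; rewrite <- Hc3, E; ring).
rewrite vwp_term_factor by assumption.
unfold vwp_den_nonzero, vwp_den in Hd.
cbn [map] in Hd |- *.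
subst c2 c4.
replace (mu * kap * p ^ 2 / - c1) with (- (mu * kap * p ^ 2 / c1)) in * by (field; auto).
replace (mu * kap * p ^ 2 / - c3) with (- (mu * kap * p ^ 2 / c3)) in * by (field; auto).
replace (mu * kap * p ^ 2 / (mu * kap * p)) with p in * by (field; auto).
replace (mu * kap * p ^ 2 / (kap * p)) with (mu * p) in * by (field; auto).
replace (mu * kap * p ^ 2 / (kap * p ^ 2)) with mu in * by (field; auto).
assert (Hp := proj1 Hg); assert (Hq := Cmod_sq_lt_1 _ Hp).
set (q := p ^ 2) in *.
set (e1 := mu * kap * q / c1) in *; set (e3 := mu * kap * q / c3) in *.
assert (E1 : e1 ^ 2 = b * q ^ 2 * kap ^ 2).
{ transitivity (mu ^ 2 * kap ^ 2 * q ^ 2 / c1 ^ 2); [unfold e1; field; auto|].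
  rewrite Hc1, <- Hb; field; auto. }
assert (E3 : e3 ^ 2 = be * q ^ 2 * kap ^ 2).
{ transitivity (mu ^ 2 * kap ^ 2 * q ^ 2 / c3 ^ 2); [unfold e3; field; auto|].
  rewrite Hc3, <- Hb; field; auto. }
assert (R1 : regular (e1 ^ 2) (q ^ 2)) by (apply regular_sq; in_den Hd).
assert (R3 : regular (e3 ^ 2) (q ^ 2)) by (apply regular_sq; in_den Hd).
assert (Rp : regular p q) by in_den Hd.
assert (Rq : regular q q) by in_den Hd.
assert (Rmu : regular mu q) by in_den Hd.
assert (Rmp : regular (mu * p) q) by in_den Hd.
assert (N0 : 1 - mu * kap <> 0).
{ rewrite <- Hra; apply (one_minus_sq_neq_0 _ q); in_den Hd. }
rewrite !qpochs_pair, Hc1, Hc3, E1, E3, !qpochs_cons.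
rewrite E1 in R1; rewrite E3 in R3.
change (qpochs [] q n) with (RtoC 1).
unfold right_term, right_coef.
fold q; rewrite !half_right_even by assumption.
rewrite vwp_factor_even by exact N0.
fold q.
rewrite !(qpoch_bisect _ p).
fold q.
replace (p * p) with q by (unfold q; ring).
replace ((- p) ^ (2 * n)) with (q ^ n)
  by (unfold q; rewrite Cpow_mult_r; f_equal; ring).
replace (p * kap) with (kap * p) by ring.
replace (kap * p * p) with (kap * q) by (unfold q; ring).
assert (M1 := qpoch_neq_0 _ _ n R1).
assert (M2 := qpoch_neq_0 _ _ n R3).
assert (M3 := qpoch_neq_0 _ _ n Rp).
assert (M4 := qpoch_neq_0 _ _ n Rq).
assert (M5 := qpoch_neq_0 _ _ n Rmu).
assert (M6 := qpoch_neq_0 _ _ n Rmp).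
clear - M1 M2 M3 M4 M5 M6.
generalize (qpoch_inf (mu ^ 2 * q * kap) q) (qpoch_inf (q * kap) q)
  (qpoch_inf (b * q) (q ^ 2)) (qpoch_inf (b * q ^ 2 * kap ^ 2) (q ^ 2))
  (qpoch_inf (be * q) (q ^ 2)) (qpoch_inf (be * q ^ 2 * kap ^ 2) (q ^ 2)).
intros.
abstract_qpoch; field; nonzero.
Qed.

(** The odd terms are those of the second series; (x;p)_(2n+1) equals
    (1 - x) (x p, x q;q)_n, and the factors 1 - x make up the coefficient in front of
    that series. *)
Lemma right_term_odd (p mu b be kap ra c1 c2 c3 c4 : C) (n : nat) :
  admissible p mu -> p <> 0 -> mu <> 0 -> kap <> 0 -> b <> 0 ->
  (1 - p) * (1 - mu) <> 0 ->
  b * be = mu ^ 2 ->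
  c1 ^ 2 = be * p ^ 2 -> c2 = - c1 -> c3 ^ 2 = b * p ^ 2 -> c4 = - c3 ->
  ra ^ 2 = p ^ 2 * (mu * kap) ->
  vwp_den_nonzero (p ^ 2 * (mu * kap)) ra
    [c1; c2; c3; c4; mu * kap * p; kap * (p ^ 2 * p); kap * p ^ 2] (p ^ 2) ->
  right_term p mu b be (S (2 * n)) kap
  = qpoch_inf (mu ^ 2 * p ^ 2 * kap) (p ^ 2) * qpoch_inf (p ^ 2 * kap) (p ^ 2)
    * (- p * ((1 - p ^ 2 * (mu * kap)) * (1 - kap * p) / ((1 - p) * (1 - mu)))
       * (qpoch_inf b ((p ^ 2) ^ 2)
       * qpoch_inf (b * (p ^ 2) ^ 3 * kap ^ 2) ((p ^ 2) ^ 2)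
       * qpoch_inf be ((p ^ 2) ^ 2)
       * qpoch_inf (be * (p ^ 2) ^ 3 * kap ^ 2) ((p ^ 2) ^ 2)))
    * vwp_term (p ^ 2 * (mu * kap)) ra
        [c1; c2; c3; c4; mu * kap * p; kap * (p ^ 2 * p); kap * p ^ 2]
        (p ^ 2) (p ^ 2) n.
Proof.
intros Hg Hp0 Hmu0 Hk0 Hb0 H1 Hb Hc1 Hc2 Hc3 Hc4 Hra Hd.
assert (Hbe0 : be <> 0).
{ intros E; apply (Cpow_nz mu 2 Hmu0); rewrite <- Hb, E; ring. }
assert (Hq0 : p ^ 2 <> 0) by now apply Cpow_nz.
assert (Hc10 : c1 <> 0).
{ intros E; apply (Cmult_neq_0 _ _ Hbe0 Hq0); rewrite <- Hc1, E; ring. }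
assert (Hc30 : c3 <> 0).
{ intros E; apply (Cmult_neq_0 _ _ Hb0 Hq0); rewrite <- Hc3, E; ring. }
rewrite vwp_term_factor by assumption.
unfold vwp_den_nonzero, vwp_den in Hd.
cbn [map] in Hd |- *.
subst c2 c4.
replace (p ^ 2 * (mu * kap) * p ^ 2 / - c1)
  with (- (p ^ 2 * (mu * kap) * p ^ 2 / c1)) in * by (field; auto).
replace (p ^ 2 * (mu * kap) * p ^ 2 / - c3)
  with (- (p ^ 2 * (mu * kap) * p ^ 2 / c3)) in * by (field; auto).
replace (p ^ 2 * (mu * kap) * p ^ 2 / (mu * kap * p)) with (p ^ 2 * p) in *
  by (field; auto).
replace (p ^ 2 * (mu * kap) * p ^ 2 / (kap * (p ^ 2 * p))) with (mu * p) in *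
  by (field; auto).
replace (p ^ 2 * (mu * kap) * p ^ 2 / (kap * p ^ 2)) with (mu * p ^ 2) in *
  by (field; auto).
assert (Hp := proj1 Hg); assert (Hq := Cmod_sq_lt_1 _ Hp).
set (q := p ^ 2) in *.
set (e1 := q * (mu * kap) * q / c1) in *; set (e3 := q * (mu * kap) * q / c3) in *.
assert (E1 : e1 ^ 2 = b * q ^ 3 * kap ^ 2).
{ transitivity (mu ^ 2 * kap ^ 2 * q ^ 4 / c1 ^ 2); [unfold e1; field; auto|].
  rewrite Hc1, <- Hb; field; auto. }
assert (E3 : e3 ^ 2 = be * q ^ 3 * kap ^ 2).
{ transitivity (mu ^ 2 * kap ^ 2 * q ^ 4 / c3 ^ 2); [unfold e3; field; auto|].
  rewrite Hc3, <- Hb; field; auto. }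
assert (R1 : regular (e1 ^ 2) (q ^ 2)) by (apply regular_sq; in_den Hd).
assert (R3 : regular (e3 ^ 2) (q ^ 2)) by (apply regular_sq; in_den Hd).
assert (Rp : regular (q * p) q) by in_den Hd.
assert (Rq : regular q q) by in_den Hd.
assert (Rmu : regular (mu * q) q) by in_den Hd.
assert (Rmp : regular (mu * p) q) by in_den Hd.
rewrite !qpochs_pair, Hc1, Hc3, E1, E3, !qpochs_cons.
rewrite E1 in R1; rewrite E3 in R3.
change (qpochs [] q n) with (RtoC 1).
unfold right_term, right_coef.
fold q; rewrite !half_right_odd by assumption.
rewrite vwp_factor_odd.
fold q.
rewrite !(qpoch_Sl _ p), !(qpoch_bisect _ p).
fold q.
replace (p * p * p) with (q * p) by (unfold q; ring).
replace (p * p) with q by (unfold q; ring).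
replace (mu * p * p) with (mu * q) by (unfold q; ring).
rewrite (Cpow_S (- p)).
replace ((- p) ^ (2 * n)) with (q ^ n)
  by (unfold q; rewrite Cpow_mult_r; f_equal; ring).
replace (p * kap * p * p) with (kap * (q * p)) by (unfold q; ring).
replace (p * kap * p) with (kap * q) by (unfold q; ring).
replace (p * kap) with (kap * p) by ring.
assert (M1 := qpoch_neq_0 _ _ n R1).
assert (M2 := qpoch_neq_0 _ _ n R3).
assert (M3 := qpoch_neq_0 _ _ n Rp).
assert (M4 := qpoch_neq_0 _ _ n Rq).
assert (M5 := qpoch_neq_0 _ _ n Rmu).
assert (M6 := qpoch_neq_0 _ _ n Rmp).
apply Cmult_neq_0_inv in H1; destruct H1 as [H1 H2].
clear - M1 M2 M3 M4 M5 M6 H1 H2.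
generalize (qpoch_inf (mu ^ 2 * q * kap) q) (qpoch_inf (q * kap) q)
  (qpoch_inf b (q ^ 2)) (qpoch_inf (b * q ^ 3 * kap ^ 2) (q ^ 2))
  (qpoch_inf be (q ^ 2)) (qpoch_inf (be * q ^ 3 * kap ^ 2) (q ^ 2)).
intros.
abstract_qpoch; field; nonzero.
Qed.

Lemma left_term_vwp (p mu b be kap sk : C) (n : nat) :
  admissible p mu -> p <> 0 -> mu <> 0 -> kap <> 0 -> b <> 0 ->
  b * be = mu ^ 2 -> sk ^ 2 = mu ^ 2 * kap ->
  vwp_den_nonzero (mu ^ 2 * kap) sk [be; b; mu * kap * p; kap * p ^ 2; - mu] (p ^ 2) ->
  left_term p mu b be n kap
  = qpoch_inf (b * kap * p ^ 2) (p ^ 2) * qpoch_inf (be * kap * p ^ 2) (p ^ 2)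
    * (qpoch_inf (p ^ 2) ((p ^ 2) ^ 2) * qpoch_inf (mu ^ 2 * p ^ 2) ((p ^ 2) ^ 2)
       * qpoch_inf ((p ^ 2 * mu * kap) ^ 2) ((p ^ 2) ^ 2)
       * qpoch_inf ((p ^ 2) ^ 2 * kap ^ 2) ((p ^ 2) ^ 2))
    * vwp_term (mu ^ 2 * kap) sk
        [be; b; mu * kap * p; kap * p ^ 2; - mu] (p ^ 2) (- p) n.
Proof.
intros Hg Hp0 Hmu0 Hk0 Hb0 Hb Hsk Hd.
assert (Hbe0 : be <> 0).
{ intros E; apply (Cpow_nz mu 2 Hmu0); rewrite <- Hb, E; ring. }
rewrite vwp_term_factor by assumption.
unfold vwp_den_nonzero, vwp_den in Hd.
cbn [map] in Hd |- *.
replace (mu ^ 2 * kap * p ^ 2 / be) with (b * kap * p ^ 2) in *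
  by (rewrite <- Hb; field; auto).
replace (mu ^ 2 * kap * p ^ 2 / b) with (be * kap * p ^ 2) in *
  by (rewrite <- Hb; field; auto).
replace (mu ^ 2 * kap * p ^ 2 / (mu * kap * p)) with (mu * p) in * by (field; auto).
replace (mu ^ 2 * kap * p ^ 2 / (kap * p ^ 2)) with (mu ^ 2) in * by (field; auto).
replace (mu ^ 2 * kap * p ^ 2 / - mu) with (- (p ^ 2 * mu * kap)) in *
  by (field; auto).
assert (Hp := proj1 Hg); assert (Hq := Cmod_sq_lt_1 _ Hp).
set (q := p ^ 2) in *.
assert (R1 : regular (b * kap * q) q) by in_den Hd.
assert (R2 : regular (be * kap * q) q) by in_den Hd.
assert (R3 : regular (mu * p) q) by in_den Hd.
assert (R4 : regular (mu ^ 2) q) by in_den Hd.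
assert (R5 : regular (- (q * mu * kap)) q) by in_den Hd.
assert (R6 : regular q q) by in_den Hd.
assert (M1 := qpoch_neq_0 _ _ n R1).
assert (M2 := qpoch_neq_0 _ _ n R2).
assert (M3 := qpoch_neq_0 _ _ n R3).
assert (M4 := qpoch_neq_0 _ _ n R4).
assert (M5 := qpoch_neq_0 _ _ n R5).
assert (M6 := qpoch_neq_0 _ _ n R6).
rewrite !qpochs_cons; change (qpochs [] q n) with (RtoC 1).
rewrite (qpoch_inf_split (b * kap * q) q n Hq),
  (qpoch_inf_split (be * kap * q) q n Hq).
rewrite <- (qpoch_inf_mul_opp (q * mu * kap) q Hq).
rewrite (qpoch_inf_split (- (q * mu * kap)) q n Hq).
unfold left_term, left_coef, half_left; fold q.
rewrite !(Cpow_S q n).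
replace (b * (q * q ^ n) * kap) with (b * kap * q * q ^ n) by ring.
replace (be * (q * q ^ n) * kap) with (be * kap * q * q ^ n) by ring.
replace (- (q * q ^ n * mu) * kap) with (- (q * mu * kap) * q ^ n) by ring.
replace (mu * p * kap) with (mu * kap * p) by ring.
replace (q * kap) with (kap * q) by ring.
clear - M1 M2 M3 M4 M5 M6.
generalize (qpoch_inf q (q ^ 2)) (qpoch_inf (mu ^ 2 * q) (q ^ 2))
  (qpoch_inf (b * kap * q * q ^ n) q) (qpoch_inf (be * kap * q * q ^ n) q)
  (qpoch_inf (q * mu * kap) q) (qpoch_inf (- (q * mu * kap) * q ^ n) q)
  (qpoch_inf (q ^ 2 * kap ^ 2) (q ^ 2)).
intros.
abstract_qpoch; field; nonzero.
Qed.

Lemma Cdiv_neq_0 (x y : C) : x <> 0 -> y <> 0 -> x / y <> 0.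
Proof.
intros Hx Hy E; apply Hx; replace x with (x / y * y) by (field; exact Hy).
rewrite E; ring.
Qed.

Lemma vwp_abs_cv_sums (a1 s : C) (l : list C) (q x : C) :
  vwp_abs_cv a1 s l q x -> sums (vwp_term a1 s l q x) (vwp a1 s l q x).
Proof.
intros H.
destruct (ex_series_le (K := C_AbsRing) (V := C_CompleteNormedModule)
  (vwp_term a1 s l q x) _ (fun n => Rle_refl _) H) as [z Hz].
apply is_series_sums in Hz.
unfold vwp; now rewrite (CSeries_sums _ _ Hz).
Qed.

(* [sa], [sq] are the fixed square roots of a and q, so that sqrt(aq) is
   [sa * sq] and sqrt(q^3) is [q * sq]. The other square roots are arbitrary:
   [sk], [sb], [sab], [sqab], [sbq] of k, b, ab, q/(ab), bq, and [ra], [rqa] of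
   the leading parameters sqrt(a), q sqrt(a) of the two 10W9 series. *)
Theorem corollary4 (q a b k sa sq sk sb sab sqab sbq ra rqa : C)
  (hq0 : q <> 0) (ha0 : a <> 0) (hb0 : b <> 0) (hk0 : k <> 0)
  (hq1 : (Cmod q < 1)%R)
  (hsa : sa ^ 2 = a) (hsq : sq ^ 2 = q)
  (hsk : sk ^ 2 = k) (hsb : sb ^ 2 = b) (hsab : sab ^ 2 = a * b)
  (hsqab : sqab ^ 2 = q / (a * b)) (hsbq : sbq ^ 2 = b * q)
  (hra : ra ^ 2 = sa) (hrqa : rqa ^ 2 = q * sa)
  (hden0 : qpochs_no_zero_factor [k * q; q * a / k] q)
  (hden1 : vwp_den_nonzero k sk
     [k ^ 2 / (a * b); b; sa * sq; a * q / k; - k / sa] q)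
  (hden2 : vwp_den_nonzero sa ra
     [k / sab; - k / sab; sb; - sb; sa * sq; a * sq / k; a * q / k] q)
  (hden3 : (1 - sq) * (1 - k / sa) <> 0)
  (hden4 : vwp_den_nonzero (q * sa) rqa
     [k * sqab; - k * sqab; sbq; - sbq; sa * sq; a * (q * sq) / k; a * q / k] q)
  (hcv1 : vwp_abs_cv k sk
     [k ^ 2 / (a * b); b; sa * sq; a * q / k; - k / sa] q (- sq))
  (hcv2 : vwp_abs_cv sa ra
     [k / sab; - k / sab; sb; - sb; sa * sq; a * sq / k; a * q / k] q q)
  (hcv3 : vwp_abs_cv (q * sa) rqa
     [k * sqab; - k * sqab; sbq; - sbq; sa * sq; a * (q * sq) / k; a * q / k]
     q q) :
  qpochs_inf [q * a * b / k; k * q / b] q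
  * qpochs_inf [q; k ^ 2 * q / a; q ^ 2 * a; q ^ 2 * a ^ 2 / k ^ 2] (q ^ 2)
  / qpochs_inf [k * q; q * a / k] q
  * vwp k sk [k ^ 2 / (a * b); b; sa * sq; a * q / k; - k / sa] q (- sq)
  =
  qpochs_inf [k ^ 2 * q / (a * b); b * q; a ^ 2 * b * q ^ 2 / k ^ 2;
              q ^ 2 * a / b] (q ^ 2)
  * vwp sa ra
      [k / sab; - k / sab; sb; - sb; sa * sq; a * sq / k; a * q / k] q q
  - sq * ((1 - q * sa) * (1 - a * sq / k) / ((1 - sq) * (1 - k / sa)))
    * qpochs_inf [k ^ 2 / (a * b); b; a ^ 2 * b * q ^ 3 / k ^ 2;
                  q ^ 3 * a / b] (q ^ 2)
    * vwp (q * sa) rqa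
        [k * sqab; - k * sqab; sbq; - sbq; sa * sq; a * (q * sq) / k; a * q / k]
        q q.
Proof.
assert (Hp0 : sq <> 0) by (intros E; apply hq0; rewrite <- hsq, E; ring).
assert (Hsa0 : sa <> 0) by (intros E; apply ha0; rewrite <- hsa, E; ring).
assert (Hp : (Cmod sq < 1)%R).
{ apply Rnot_le_lt; intros H; apply (Rlt_not_le _ _ hq1).
  rewrite <- hsq, Cmod_pow; simpl; nra. }
assert (Hmk : exists mu kap : C, mu <> 0 /\ kap <> 0 /\
  k = mu ^ 2 * kap /\ sa = mu * kap).
{ exists (k / sa), (sa ^ 2 / k); repeat split.
  - now apply Cdiv_neq_0.
  - apply Cdiv_neq_0; [now apply Cpow_nz | exact hk0].
  - field; auto.
  - field; auto. }
destruct Hmk as (mu & kap & Hmu0 & Hkap0 & -> & ->).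
assert (Hbe : exists be : C, be = mu ^ 2 / b) by eauto.
destruct Hbe as (be & Hbe).
assert (Hb : b * be = mu ^ 2) by (rewrite Hbe; field; exact hb0).
rename sq into p; subst a q.
replace ((mu ^ 2 * kap) ^ 2 / ((mu * kap) ^ 2 * b)) with be in *
  by (rewrite Hbe; field; auto).
replace ((mu * kap) ^ 2 * p ^ 2 / (mu ^ 2 * kap)) with (kap * p ^ 2) in *
  by (field; auto).
replace (- (mu ^ 2 * kap) / (mu * kap)) with (- mu) in * by (field; auto).
replace ((mu * kap) ^ 2 * p / (mu ^ 2 * kap)) with (kap * p) in * by (field; auto).
replace ((mu * kap) ^ 2 * (p ^ 2 * p) / (mu ^ 2 * kap)) with (kap * (p ^ 2 * p)) in *
  by (field; auto).
replace (mu ^ 2 * kap / (mu * kap)) with mu in * by (field; auto).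
assert (Hsab0 : sab <> 0).
{ intros E; apply (Cmult_neq_0 _ _ ha0 hb0); rewrite <- hsab, E; ring. }
assert (Hc1 : (mu ^ 2 * kap / sab) ^ 2 = be).
{ transitivity ((mu ^ 2 * kap) ^ 2 / sab ^ 2); [field; auto|].
  rewrite hsab, Hbe; field; auto. }
assert (Hc1' : - (mu ^ 2 * kap) / sab = - (mu ^ 2 * kap / sab)) by (field; auto).
assert (Hd1 : (mu ^ 2 * kap * sqab) ^ 2 = be * p ^ 2).
{ transitivity ((mu ^ 2 * kap) ^ 2 * sqab ^ 2); [ring|].
  rewrite hsqab, Hbe; field; auto. }
assert (Hd1' : - (mu ^ 2 * kap) * sqab = - (mu ^ 2 * kap * sqab)) by ring.
assert (Hg : admissible p mu).
{ split; [exact Hp|split].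
  - apply regular_bisect; split.
    + apply (qpochs_no_zero_factor_regular _ _ _ hden2).
      unfold vwp_den; cbn [map].
      replace (mu * kap * p ^ 2 / (kap * p ^ 2)) with mu by (field; auto).
      simpl; tauto.
    + apply (qpochs_no_zero_factor_regular _ _ _ hden2).
      unfold vwp_den; cbn [map].
      replace (mu * kap * p ^ 2 / (kap * p)) with (mu * p) by (field; auto).
      simpl; tauto.
  - apply (qpochs_no_zero_factor_regular _ _ _ hden1).
    unfold vwp_den; cbn [map].
    replace (mu ^ 2 * kap * p ^ 2 / (kap * p ^ 2)) with (mu ^ 2) by (field; auto).
    simpl; tauto. }
assert (T1 := fun n => left_term_vwp p mu b be kap sk n Hg Hp0 Hmu0 Hkap0 hb0 Hb
  hsk hden1).
assert (T2 := fun n => right_term_even p mu b be kap ra _ _ _ _ n Hg Hp0 Hmu0 Hkap0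
  hb0 Hb Hc1 Hc1' hsb eq_refl hra hden2).
assert (T3 := fun n => right_term_odd p mu b be kap rqa _ _ _ _ n Hg Hp0 Hmu0 Hkap0
  hb0 hden3 Hb Hd1 Hd1' hsbq eq_refl hrqa hden4).
apply vwp_abs_cv_sums in hcv1.
apply vwp_abs_cv_sums in hcv2.
apply vwp_abs_cv_sums in hcv3.
assert (E := quadratic_transformation p mu b be kap _ _ Hp0 Hg Hb
  (sums_ext _ _ _ (fun n => eq_sym (T1 n)) (sums_scal _ _ _ hcv1))
  (sums_interleave _ _ _
    (sums_ext _ _ _ (fun n => eq_sym (T2 n)) (sums_scal _ _ _ hcv2))
    (sums_ext _ _ _ (fun n => eq_sym (T3 n)) (sums_scal _ _ _ hcv3)))).
clear T1 T2 T3.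
replace (p ^ 2 * (mu * kap) ^ 2 / (mu ^ 2 * kap)) with (p ^ 2 * kap) in *
  by (field; auto).
assert (P1 : qpoch_inf (mu ^ 2 * kap * p ^ 2) (p ^ 2) <> 0).
{ apply qpoch_inf_neq_0; [exact hq1|].
  apply (qpochs_no_zero_factor_regular _ _ _ hden0); simpl; tauto. }
assert (P2 : qpoch_inf (p ^ 2 * kap) (p ^ 2) <> 0).
{ apply qpoch_inf_neq_0; [exact hq1|].
  apply (qpochs_no_zero_factor_regular _ _ _ hden0); simpl; tauto. }
unfold qpochs_inf; cbn [fold_right].
replace (p ^ 2 * (mu * kap) ^ 2 * b / (mu ^ 2 * kap)) with (b * kap * p ^ 2)
  by (field; auto).
replace (mu ^ 2 * kap * p ^ 2 / b) with (be * kap * p ^ 2)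
  by (rewrite Hbe; field; auto).
replace ((mu ^ 2 * kap) ^ 2 * p ^ 2 / (mu * kap) ^ 2) with (mu ^ 2 * p ^ 2)
  by (field; auto).
replace ((p ^ 2) ^ 2 * (mu * kap) ^ 2) with ((p ^ 2 * mu * kap) ^ 2) by ring.
replace ((p ^ 2) ^ 2 * ((mu * kap) ^ 2) ^ 2 / (mu ^ 2 * kap) ^ 2)
  with ((p ^ 2) ^ 2 * kap ^ 2) by (field; auto).
replace ((mu ^ 2 * kap) ^ 2 * p ^ 2 / ((mu * kap) ^ 2 * b)) with (be * p ^ 2)
  by (rewrite Hbe; field; auto).
replace (((mu * kap) ^ 2) ^ 2 * b * (p ^ 2) ^ 2 / (mu ^ 2 * kap) ^ 2)
  with (b * (p ^ 2) ^ 2 * kap ^ 2) by (field; auto).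
replace ((p ^ 2 * mu * kap) ^ 2 / b) with (be * (p ^ 2) ^ 2 * kap ^ 2)
  by (rewrite Hbe; field; auto).
replace (((mu * kap) ^ 2) ^ 2 * b * (p ^ 2) ^ 3 / (mu ^ 2 * kap) ^ 2)
  with (b * (p ^ 2) ^ 3 * kap ^ 2) by (field; auto).
replace ((p ^ 2) ^ 3 * (mu * kap) ^ 2 / b) with (be * (p ^ 2) ^ 3 * kap ^ 2)
  by (rewrite Hbe; field; auto).
replace (mu ^ 2 * p ^ 2 * kap) with (mu ^ 2 * kap * p ^ 2) in E by ring.
apply Cmult_neq_0_inv in hden3; destruct hden3 as [H1 H2].
match type of E with ?l = _ =>
  transitivity (l / (qpoch_inf (mu ^ 2 * kap * p ^ 2) (p ^ 2)
    * qpoch_inf (p ^ 2 * kap) (p ^ 2))) end.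
- unfold Cdiv; rewrite !Cmult_1_r; ring.
- rewrite E; clear - P1 P2 H1 H2.
  set (W2 := vwp (mu * kap) _ _ _ _); clearbody W2.
  set (W3 := vwp (p ^ 2 * (mu * kap)) _ _ _ _); clearbody W3.
  generalize dependent (qpoch_inf (mu ^ 2 * kap * p ^ 2) (p ^ 2)); intros.
  generalize dependent (qpoch_inf (p ^ 2 * kap) (p ^ 2)); intros.
  generalize (qpoch_inf (b * p ^ 2) ((p ^ 2) ^ 2))
    (qpoch_inf (be * p ^ 2) ((p ^ 2) ^ 2))
    (qpoch_inf b ((p ^ 2) ^ 2)) (qpoch_inf be ((p ^ 2) ^ 2))
    (qpoch_inf (b * (p ^ 2) ^ 2 * kap ^ 2) ((p ^ 2) ^ 2))
    (qpoch_inf (be * (p ^ 2) ^ 2 * kap ^ 2) ((p ^ 2) ^ 2))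
    (qpoch_inf (b * (p ^ 2) ^ 3 * kap ^ 2) ((p ^ 2) ^ 2))
    (qpoch_inf (be * (p ^ 2) ^ 3 * kap ^ 2) ((p ^ 2) ^ 2)).
  intros; field; nonzero.
Qed.
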